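(* Let $T_j(x)$ denote the $j$-th Chebyshev polynomial of the first kind, let $i=\sqrt{-1}$, and let $\xi_{h,d}:=\cos\left(\frac{h\pi}{2d+1}\right)$ and $\zeta_{h,d}:=\cos\left(\frac{(2h-1)\pi}{4d}\right)$ for all integers $h$ and $d\neq0$. Then for all integers $m,n\geq 1$, the following five numbers are equal: (1) the number of symmetric recurrents on the sandpile grid graph $\mathrm{S}\Gamma_{2m\times(2n-1)}$; (2) if $n>1$, the number of domino tilings of the Möbius-weighted $2m\times 2n$ checkerboard, and if $n=1$, the number of domino tilings of the Möbius-weighted $(2m-1)\times 2$ checkerboard, in both cases counted according to weight; (3) $(-1)^{mn}\,2^m\prod_{h=1}^m T_{2n}(i\,\xi_{h,m})$; (4) $\prod_{h=1}^{m}\prod_{k=1}^{n}\left(4\,\xi_{h,m}^2+4\,\zeta_{k,n}^2\right)$; (5) the number of domino tilings of a $2m\times 2n$ Möbius checkerboard.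
   Context: Chebyshev polynomials of the first kind: $T_0(x)=1$, $T_1(x)=x$, $T_j(x)=2x\,T_{j-1}(x)-T_{j-2}(x)$ for $j\ge 2$. Grid graph: for integers $p,q\ge1$, $\Gamma_{p\times q}$ is the undirected graph with vertex set $[p]\times[q]$ and edges $\{(a,b),(a',b')\}$ with $|a-a'|+|b-b'|=1$. The sandpile grid graph $\mathrm{S}\Gamma_{p\times q}$ is obtained from $\Gamma_{p\times q}$ by adding a new vertex $s$ (the sink) and, for each grid vertex $v$, an edge between $v$ and $s$ of weight $4-\deg_{\Gamma_{p\times q}}(v)$ (no edge if this is $0$), so that every non-sink vertex has total degree $4$. Recurrents: a configuration on $\mathrm{S}\Gamma_{p\times q}$ is a function $c\colon[p]\times[q]\to\mathbb{N}=\{0,1,2,\dots\}$. A vertex $v$ is unstable in $c$ if $c_v\ge4$; firing an unstable $v$ subtracts $4$ from $c_v$ and adds $1$ to $c_w$ for each neighbor $w$ of $v$ in $\Gamma_{p\times q}$. Repeatedly firing unstable vertices always leads, after finitely many steps, to a stable configuration (one with no unstable vertices) $c^\circ$ that depends only on $c$. A configuration $c$ is recurrent if it is stable and for every configuration $a$ there is a configuration $b$ with $(a+b)^\circ=c$. A symmetric recurrent on $\mathrm{S}\Gamma_{p\times q}$ is a recurrent configuration $c$ such that $c_{(a,b)}=c_{(a,q-b+1)}=c_{(p-a+1,b)}$ for all $(a,b)\in[p]\times[q]$. Möbius checkerboard: the $p\times q$ Möbius grid graph is formed from $\Gamma_{p\times q}$ by adding the edges $\{(h,1),(p-h+1,q)\}$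 for $1\le h\le p$. Domino tilings of the $p\times q$ Möbius checkerboard (an ordinary checkerboard with its left and right sides glued with a twist) are identified with perfect matchings of the $p\times q$ Möbius grid graph. Möbius-weighted checkerboard: the Möbius-weighted $p\times q$ grid graph is $\Gamma_{p\times q}$ with the following edge weights: each edge $\{(p-2h,q-1),(p-2h,q)\}$ with $0\le h<\lfloor p/2\rfloor$ has weight $2$; if $p$ is odd (including $p=1$), the edge $\{(1,q-1),(1,q)\}$ has weight $3$; all other edges have weight $1$. Domino tilings of the Möbius-weighted $p\times q$ checkerboard are the perfect matchings of this graph, the weight of a matching is the product of the weights of its edges, and counting according to weight means taking the sum of the weights of all perfect matchings. *)

(* Defs.v *)
From Stdlib Require Import Relation_Operators.
From mathcomp Require Import all_boot all_order all_algebra finmap.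
From mathcomp Require Import all_classical all_reals all_analysis.
From mathcomp Require Import complex.

Set Implicit Arguments.
Unset Strict Implicit.
Unset Printing Implicit Defensive.

Import Order.TTheory GRing.Theory Num.Theory.
Local Open Scope ring_scope.

Fixpoint chebyshevT (A : nzRingType) (j : nat) : {poly A} :=
  match j with
  | 0%N => 1
  | 1%N => 'X
  | (k.+1 as k1).+1 => 2%:R * 'X * chebyshevT A k1 - chebyshevT A k
  end.

Definition xi (R : realType) (h d : int) : R :=
  cos (h%:~R * pi / (2 * d + 1)%:~R).

Definition zeta (R : realType) (h d : int) : R :=
  cos ((2 * h - 1)%:~R * pi / (4 * d)%:~R).

(* The vertex (a, b) of [p] x [q] is represented by the pair of ordinals with
   values (a - 1, b - 1); [rev_ord] is then a |-> p - a + 1. *)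
Definition gvertex (p q : nat) : finType := ('I_p * 'I_q)%type.

Definition grid_adj (p q : nat) : rel (gvertex p q) :=
  fun x y => (`|x.1 - y.1| + `|x.2 - y.2| == 1)%N.

(* Since the total degree of every non-sink vertex is 4, the sink does not
   occur explicitly: grains sent to it disappear. *)
Definition configuration (p q : nat) := {ffun gvertex p q -> nat}.

Definition unstable (p q : nat) (c : configuration p q) (v : gvertex p q) :=
  (4 <= c v)%N.

Definition fire (p q : nat) (c : configuration p q) (v : gvertex p q) :
    configuration p q :=
  [ffun w => if w == v then (c w - 4)%N else (c w + grid_adj v w)%N].

Definition firing (p q : nat) (c d : configuration p q) : Prop :=
  exists2 v, unstable c v & d = fire c v.

Definition stable (p q : nat) (c : configuration p q) : bool :=
  [forall v, ~~ unstable c v].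

(* The graph of the function that maps c to its stabilization. *)
Definition stabilizes_to (p q : nat) (c d : configuration p q) : Prop :=
  clos_refl_trans (configuration p q) (@firing p q) c d /\ stable d.

Definition recurrent (p q : nat) (c : configuration p q) : Prop :=
  stable c /\
  forall a : configuration p q, exists b : configuration p q,
    stabilizes_to [ffun v => (a v + b v)%N] c.

Definition grid_symmetric (p q : nat) (c : configuration p q) : Prop :=
  forall (a : 'I_p) (b : 'I_q),
    c (a, b) = c (a, rev_ord b) /\ c (a, b) = c (rev_ord a, b).

Definition symmetric_recurrents (p q : nat) : set (configuration p q) :=
  [set c | recurrent c /\ grid_symmetric c]%classic.
Arguments symmetric_recurrents : clear implicits.

(* Needed below: [fset_set] is empty on infinite sets. *)
Lemma finite_symmetric_recurrents (p q : nat) :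
  finite_set (symmetric_recurrents p q).
Proof.
pose f (g : {ffun gvertex p q -> 'I_4}) : configuration p q :=
  [ffun v => nat_of_ord (g v)].
apply: (sub_finite_set (B := (f @` setT)%classic)); last first.
  by apply: finite_image; exact: finite_finset.
move=> c [[/forallP c_stable _] _].
exists [ffun v => inord (c v)] => //.
apply/ffunP => v; rewrite !ffunE inordK //.
by rewrite ltnNge; exact: c_stable.
Qed.

Definition num_symmetric_recurrents (p q : nat) : nat :=
  #|` fset_set (symmetric_recurrents p q)|.

Section PerfectMatchings.
Variables (V : finType) (e : rel V).

Definition edges : {set {set V}} :=
  [set E | [exists x, exists y, [&& x != y, e x y & E == [set x; y]]]].

Definition perfect_matchings : {set {set {set V}}} :=
  [set M : {set {set V}} | (M \subset edges) &&
           [forall v, #|[set E in M | v \in E]| == 1%N]].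

Definition weighted_matchings (w : {set V} -> nat) : nat :=
  (\sum_(M in perfect_matchings) \prod_(E in M) w E)%N.

End PerfectMatchings.

(* [twist x y] holds iff x = (h, 1) and y = (p - h + 1, q) for some h. *)
Definition twist (p q : nat) : rel (gvertex p q) :=
  fun x y => [&& x.2 == 0%N :> nat, y.2.+1 == q & y.1 == rev_ord x.1].

(* A simple graph: an added edge that is a loop or parallel to another edge is
   lost, which only happens when q = 1, or when p is odd and q = 2. *)
Definition mobius_adj (p q : nat) : rel (gvertex p q) :=
  fun x y => [|| grid_adj x y, twist x y | twist y x].

Definition mobius_tilings (p q : nat) : nat :=
  #|perfect_matchings (@mobius_adj p q)|.

(* The singleton of the vertex (a, b), in 1-based coordinates; it is empty when
   (a, b) lies outside of the grid. *)
Definition cell (p q a b : nat) : {set gvertex p q} :=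
  [set v : gvertex p q | (v.1.+1 == a) && (v.2.+1 == b)].

Definition last_edge (p q a : nat) : {set gvertex p q} :=
  cell p q a (q - 1) :|: cell p q a q.

Definition mobius_weight (p q : nat) (E : {set gvertex p q}) : nat :=
  (if [exists h : 'I_(p./2), E == last_edge p q (p - 2 * h)] then 2
   else if odd p && (E == last_edge p q 1) then 3
   else 1)%N.

Definition mobius_weighted_tilings (p q : nat) : nat :=
  weighted_matchings (@grid_adj p q) (@mobius_weight p q).

(* Main.v *)
Require Import Defs.
From Stdlib Require Import Relation_Operators.
From mathcomp Require Import all_boot all_order all_algebra all_fingroup.
From mathcomp Require Import zify ring lra.

(* With t_n(x) = 2 T_n(x / 2), every number equals det t_n(A), where A is the
   tridiagonal matrix of size m with diagonal (4, ..., 4, 3) and entries 1 next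
   to the diagonal.

   Tilings: let S_j be the set of rows in which a horizontal domino joins
   columns j and j + 1. After complementing S_j on one colour of the
   checkerboard, the dominoes of a tiling describe particles that hop between
   neighbouring rows without ever overtaking each other. Hence tilings are
   counted by minors of alternating products of M = 1 + E P and M' = 1 + E' P,
   where P is the adjacency matrix of a path and E, E' are the projections on
   the odd and on the even rows. As P exchanges E and E', the product M M' and
   its inverse add up to 2 + P^2, so their n-th powers add up to t_n(2 + P^2),
   and the block of 2 + P^2 on the odd rows is A. On the planar board the
   weights in the last column produce precisely this sum of two powers. On the
   Moebius board one gets the sum, over all sets of half of the rows, of the
   minors with these rows and the complementary columns of a matrix built from
   (M M')^n. Like a Pfaffian, this sum depends only on the antisymmetric part
   of the matrix, which is again t_n(2 + P^2) up to signs and reversal of the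
   columns; as it has no entry between rows of equal parity, one may replace
   the matrix by one for which a single minor survives, namely det t_n(A).

   Recurrents: every symmetric function on the grid is congruent, modulo the
   Laplacian, to exactly one symmetric recurrent. By folding, symmetric
   functions live on an m by n grid; solving the Laplace equation column by
   column leaves only the equation t_n(A') v = w, where A' is conjugate to A by
   a diagonal sign matrix. So the symmetric recurrents are as many as the
   elements of the cokernel of t_n(A').

   Finally, the eigenvalues of A are 2 + 4 xi^2, by sine eigenvectors, and the
   roots of t_n are 2 - 4 zeta^2. *)

Set Implicit Arguments.
Unset Strict Implicit.
Unset Printing Implicit Defensive.

Import Order.TTheory GRing.Theory Num.Theory.
Local Open Scope ring_scope.

(** * Particles hopping between rows, and minors *)

Section HopLists.
Variables (K : comNzRingType) (p : nat).
Implicit Types (L : seq ('I_p * 'I_p * K)) (A C : {set 'I_p}).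

(* The particles on the rows in [A] are moved to the rows in [C] by offering the
   hops in [L] one after the other; each may be taken, with its weight, or not. *)
Fixpoint hop_count L A C : K :=
  if L is (a, b, w) :: L' then
    hop_count L' A C +
    (if (a \in A) && (b \notin A :\ a)
     then w * hop_count L' (b |: (A :\ a)) C else 0)
  else (A == C)%:R.

(** The one-particle version of [hop_count]. A hop with equal ends is allowed; it multiplies the
    weight of a particle in that row by 1 + w. *)
Fixpoint hop_mx L : 'M[K]_p :=
  if L is (a, b, w) :: L' then (1%:M + w *: delta_mx a b) *m hop_mx L'
  else 1%:M.

Definition hop_near (o : 'I_p * 'I_p * K) :=
  ((o.1.1 <= o.1.2.+1) && (o.1.2 <= o.1.1.+1))%N.

Lemma hop_mx_cat L1 L2 : hop_mx (L1 ++ L2) = hop_mx L1 *m hop_mx L2.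
Proof.
elim: L1 => [|[[a b] w] L1 IH] /=; first by rewrite mul1mx.
by rewrite IH mulmxA.
Qed.

Lemma hop_count_cat L1 L2 A C :
  hop_count (L1 ++ L2) A C =
  \sum_(B : {set 'I_p}) hop_count L1 A B * hop_count L2 B C.
Proof.
elim: L1 A => [|[[a b] w] L1 IH] A /=.
  rewrite (bigD1 A) //= eqxx mul1r big1 ?addr0 // => B.
  by rewrite eq_sym => /negbTE->; rewrite mul0r.
rewrite IH; under [RHS]eq_bigr do rewrite mulrDl.
rewrite big_split /=; congr (_ + _); case: ifP => _.
  by rewrite IH mulr_sumr; apply: eq_bigr => B _; rewrite mulrA.
by rewrite big1 // => B _; rewrite mul0r.
Qed.

Lemma hop_count_card L A C : hop_count L A C != 0 -> #|A| = #|C|.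
Proof.
elim: L A => [|[[a b] w] L IH] A /=.
  by have [->|_] := eqVneq A C; rewrite ?eqxx.
case: ifP => [/andP[aA bA]|_]; last by rewrite addr0 => /IH.
have [/IH-> //|] := boolP (hop_count L A C != 0).
rewrite negbK => /eqP->; rewrite add0r => nz0.
have : hop_count L (b |: A :\ a) C != 0.
  by apply: contra nz0 => /eqP->; rewrite mulr0.
move=> /IH <-; rewrite cardsU1 bA add1n (cardsD1 a A) aA /=.
by rewrite add1n.
Qed.

Definition increasing k (x : 'I_k -> 'I_p) := {homo x : i j / (i < j)%N}.

Lemma increasing_inj k (x : 'I_k -> 'I_p) : increasing x -> injective x.
Proof.
move=> incx i j xij; apply: val_inj; case: (ltngtP i j) => //.
  by move/incx; rewrite xij ltnn.
by move/incx; rewrite xij ltnn.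
Qed.

Lemma increasing_eq k (x y : 'I_k -> 'I_p) :
  increasing x -> increasing y -> x @: setT = y @: setT -> x =1 y.
Proof.
move=> incx incy exy i.
have s (z : 'I_k -> 'I_p) : increasing z -> sorted ltn (map (val \o z) (enum 'I_k)).
  move=> incz; rewrite sorted_map.
  apply: (sub_sorted (e := relpre val ltn)) => [u v|]; first exact: incz.
  by rewrite -sorted_map val_enum_ord iota_ltn_sorted.
have : map (val \o x) (enum 'I_k) = map (val \o y) (enum 'I_k).
  apply: (irr_sorted_eq ltn_trans ltnn (s _ incx) (s _ incy)) => v.
  have im (z : 'I_k -> 'I_p) : (v \in map (val \o z) (enum 'I_k)) =
      (v \in map val (enum (z @: setT))).
    apply/mapP/mapP => -[u]; first by move=> _ ->; exists (z u) => //;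
      rewrite mem_enum imset_f.
    by rewrite mem_enum => /imsetP[j _ ->] ->; exists j; rewrite ?mem_enum.
  by rewrite !im exy.
move=> /eq_in_map /(_ i); rewrite mem_enum => /(_ isT) /= h.
exact: val_inj.
Qed.

(** If the images differ, some [x i] matches no column and the minor has a zero row; otherwise [x]
    and [y] agree, both listing the same set in order. *)
Lemma det_mxsub1 k (x y : 'I_k -> 'I_p) : increasing x -> increasing y ->
  \det (mxsub x y (1%:M : 'M[K]_p)) = (x @: setT == y @: setT)%:R.
Proof.
move=> incx incy; have [exy|nxy] := eqVneq.
  have ee := increasing_eq incx incy exy.
  rewrite (_ : mxsub _ _ _ = 1%:M) ?det1 //.
  apply/matrixP => i j; rewrite !mxE -ee.
  by rewrite (inj_eq (increasing_inj incx)).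
have [i xi] : exists i, x i \notin y @: setT.
  apply/existsP; rewrite -[X in is_true X]negbK negb_exists; apply: contra nxy => /forallP h.
  rewrite eqEcard !card_imset; try exact: increasing_inj.
  rewrite leqnn andbT; apply/subsetP => _ /imsetP[i _ ->].
  by have := h i; rewrite negbK.
rewrite (expand_det_row _ i) big1 // => j _; rewrite !mxE.
case: eqP => [xy|_]; last by rewrite mul0r.
by rewrite xy imset_f in xi.
Qed.

(* A hop between neighbouring rows cannot overtake another particle, so every
   nonintersecting family of paths contributes to the minor with sign +1. *)
Lemma det_hop_mx k (x y : 'I_k -> 'I_p) L : all hop_near L ->
  increasing x -> increasing y ->
  \det (mxsub x y (hop_mx L)) = hop_count L (x @: setT) (y @: setT).
Proof.
move=> + + incy; elim: L x => [|[[a b] w] L IH] x /=.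
  by move=> _ incx; rewrite det_mxsub1.
move=> /andP[nab allL] incx; set Y := hop_mx L.
have rowE i j : mxsub x y ((1%:M + w *: delta_mx a b) *m Y) i j =
    Y (x i) (y j) + (if x i == a then w * Y b (y j) else 0).
  rewrite mxE mulmxDl mul1mx mxE; congr (_ + _).
  rewrite -scalemxAl mxE mxE (bigD1 b) //= big1 => [|l nlb]; last first.
    by rewrite mxE (negbTE nlb) andbF mul0r.
  by rewrite addr0 mxE eqxx andbT; case: eqP => _; rewrite ?mul1r ?mul0r ?mulr0.
have [/imsetP[i0 _ xi0]|naA] /= := boolP (a \in x @: setT); last first.
  rewrite addr0 -(IH _ allL incx); congr (\det _).
  apply/matrixP => i j; rewrite rowE [RHS]mxE; case: eqP => [xa|_]; last first.
    by rewrite addr0.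
  by rewrite -xa imset_f in naA.
(* Only the row of the particle at [a] changes. By multilinearity the minor splits into the case
   where the particle stays and w times the case where it moves to [b]. *)
pose x' i := if i == i0 then b else x i.
have x'E i : i != i0 -> x' i = x i by rewrite /x' => /negbTE->.
rewrite (determinant_multilinear (i0 := i0) (A := mxsub x y _)
  (B := mxsub x y Y) (C := mxsub x' y Y) (b := 1) (c := w)); first last.
- apply/matrixP => i j; rewrite [RHS]mxE rowE [LHS]mxE [LHS]mxE ?x'E 1?eq_sym ?neq_lift //.
  case: eqP => [|_]; last by rewrite addr0.
  by rewrite xi0 => /(increasing_inj incx)/eqP; rewrite ?(negbTE (neq_lift _ _)) // eq_sym (negbTE (neq_lift _ _)).
- apply/matrixP => i j; rewrite [RHS]mxE rowE [LHS]mxE [LHS]mxE ?x'E 1?eq_sym ?neq_lift //.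
  case: eqP => [|_]; last by rewrite addr0.
  by rewrite xi0 => /(increasing_inj incx)/eqP; rewrite ?(negbTE (neq_lift _ _)) // eq_sym (negbTE (neq_lift _ _)).
- apply/rowP => j; rewrite [LHS]mxE rowE !mxE mul1r -xi0 eqxx.
  by rewrite /x' eqxx.
rewrite mul1r IH //; congr (_ + _).
case: ifP => [nb|/negbFE].
  have sep i : i != i0 -> x i != b.
    move=> ni; apply: contra nb => /eqP<-; rewrite in_setD1 imset_f // andbT.
    by rewrite xi0 (inj_eq (increasing_inj incx)).
  rewrite -(_ : x' @: setT = b |: (x @: setT) :\ a); last first.
    apply/setP => c; rewrite !inE; apply/imsetP/orP => [[i _ ->]|].
      have [->|ni] := eqVneq i i0; first by left; rewrite /x' eqxx.
      right; rewrite x'E // imset_f // andbT xi0.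
      by rewrite (inj_eq (increasing_inj incx)).
    case => [/eqP->|/andP[nca /imsetP[i _ ci]]]; first by exists i0; rewrite /x' ?eqxx.
    exists i => //; rewrite x'E //; apply: contra nca => /eqP ii.
    by rewrite ci ii xi0.
  (* Since [b] is free and at distance at most 1 from [a], no particle is overtaken and [x'] is
     again increasing. *)
  congr (_ * _); apply: IH => // i j ltij; move: nab; rewrite /hop_near /= xi0.
  case/andP=> ab ba.
  rewrite /x'; have [ei|ni] := eqVneq i i0; have [ej|nj] := eqVneq j i0.
  - by rewrite ei ej ltnn in ltij.
  - have := incx _ _ ltij; have := sep _ nj; rewrite -val_eqE /= ei => /negbTE h1 h2.
    by move: ba h2 h1; case: ltngtP => //; lia.
  - have := incx _ _ ltij; have := sep _ ni; rewrite -val_eqE /= ej => /negbTE h1 h2.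
    by move: ab h2 h1; lia.
  - exact: incx.
(* Another particle sits at [b]: two rows coincide and the minor vanishes, in accordance with the
   forbidden hop. *)
rewrite in_setD1 => /andP[nba /imsetP[i1 _ bi1]].
have ni : i0 != i1 by apply: contra nba => /eqP ii; rewrite bi1 -ii xi0.
rewrite (determinant_alternate ni) ?mulr0 // => j; rewrite !mxE /x' eqxx.
by rewrite eq_sym (negbTE ni) -bi1.
Qed.

End HopLists.

(** * Dominoes in one column *)

Section Columns.
Variables (K : comNzRingType) (p : nat).
Implicit Types (A C S V : {set 'I_p}) (c : bool).

(** Hops lead from a row of parity [c] to one of the other parity, so no particle hops twice within
    a column. [ordS] wraps around only in the last row, which [column_hops] leaves out. *)
Definition column_hop c (r : 'I_p) : 'I_p * 'I_p * K :=
  if odd r == c then (r, ordS r, 1) else (ordS r, r, 1).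

Definition column_hops c :=
  [seq column_hop c r | r : 'I_p <- enum 'I_p & (r.+1 < p)%N].

(* [V] stands for the vertical dominoes on the rows [r] and [r.+1], [r \in V]. *)
Definition down_up V (r : 'I_p) : nat :=
  ((r \in V) + ((0 < r)%N && (ord_pred r \in V)))%N.

Definition inner_rows V := [forall r in V, r.+1 < p]%N.

Definition rows_from k V := [forall r in V, k <= r]%N.

Definition column_tiling S S' V :=
  inner_rows V && [forall r, (r \in S) + (r \in S') + down_up V r == 1]%N.

(** Conservation of particles in each row: a vertical domino takes one away from a row of parity [c]
    and brings one to a row of the other parity. *)
Definition flow c A C V :=
  [forall r : 'I_p, if odd r == c then (r \in A) == (r \in C) + down_up V r :> nat
                    else (r \in C) == (r \in A) + down_up V r :> nat]%N.

(* In a row of parity [c] the horizontal dominoes are the holes, in the other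
   rows they are the particles; the vertical dominoes become the hops. *)
Definition toggle c S : {set 'I_p} := [set r : 'I_p | (r \in S) (+) (odd r == c)].

Lemma toggleK c : involutive (toggle c).
Proof. by move=> S; apply/setP => r; rewrite !inE -addbA addbb addbF. Qed.

(** A row is covered once if S + S' + d = 1, where d counts its vertical dominoes. With S = 1 - A
    and S' = C in rows of parity [c] this reads A = C + d; with S = A and S' = 1 - C in the others
    it reads C = A + d. *)
Lemma column_tilingE c S S' V :
  column_tiling S S' V =
  inner_rows V && flow c (toggle c S) (toggle (~~ c) S') V.
Proof.
congr (_ && _); apply: eq_forallb => r; rewrite !inE.
by case: (odd r) c (r \in S) (r \in S') => [] [] [] [];
  case: (down_up V r) => [|[|k]].
Qed.

Lemma val_ordS (k : 'I_p) : (k.+1 < p)%N -> ordS k = k.+1 :> nat.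
Proof. by move=> h; rewrite /= modn_small. Qed.

Lemma val_ord_pred (k : 'I_p) : (0 < k)%N -> ord_pred k = k.-1 :> nat.
Proof.
case: p k => [|p'] [k hk] //= k0; rewrite addnS /=.
by rewrite -(prednK k0) /= addSn -addnS modnDr modn_small //; lia.
Qed.

Lemma eq_ordS (k r : 'I_p) : (k.+1 < p)%N -> (r == ordS k) = (r == k.+1 :> nat).
Proof. by move=> kp; rewrite -(val_ordS kp). Qed.

Lemma eq_ord_pred (k r : 'I_p) :
  (0 < r)%N -> (ord_pred r == k) = (r == k.+1 :> nat).
Proof.
move=> r0; rewrite -(inj_eq (@ord_inj _)) val_ord_pred //.
by apply/eqP/eqP; lia.
Qed.

Lemma down_upU1 (k : 'I_p) V r : (k.+1 < p)%N -> k \notin V ->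
  down_up (k |: V) r = (down_up V r + (r == k) + (r == ordS k))%N.
Proof.
move=> kp kV; rewrite /down_up !inE eq_ordS //.
case r0: (0 < r)%N; rewrite /= ?eq_ord_pred //; last first.
  have -> : (r == k.+1 :> nat) = false by lia.
  by have [->|_] := eqVneq r k; rewrite ?(negbTE kV) /= !addn0.
have [->|nrk] := eqVneq r k.
  have -> : (k == k.+1 :> nat) = false by lia.
  by rewrite (negbTE kV) /= addn0 addnC.
have [e|ne] := eqVneq (r : nat) k.+1; last by rewrite /= !addn0.
have -> : ord_pred r = k by apply/eqP; rewrite eq_ord_pred // e.
by rewrite (negbTE kV) /= !addn0.
Qed.

(** No domino of [V] touches row [k], so the extra domino changes only the balances of rows [k] and
    [k.+1], just as if its hop were made before all the others. *)
Lemma flowU1 c (k : 'I_p) A C V : (k.+1 < p)%N ->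
  rows_from k.+1 V ->
  let: (a, b, _) := column_hop c k in
  flow c A C (k |: V) =
  [&& a \in A, b \notin A :\ a & flow c (b |: (A :\ a)) C V].
Proof.
move=> kp /forallP hV.
have kV : k \notin V by apply/negP => h; have := hV k; rewrite h ltnn.
have kS : ordS k != k by rewrite eq_sym eq_ordS //; lia.
have kS' : k == ordS k = false by rewrite eq_sym (negbTE kS).
have ok : odd (ordS k) = ~~ odd k by rewrite val_ordS.
have d0 : down_up V k = 0%N.
  rewrite /down_up (negbTE kV); case k0: (0 < k)%N => //=.
  apply/eqP; rewrite eqb0; apply/negP => h.
  by have := hV (ord_pred k); rewrite h val_ord_pred //=; lia.
have dU r := down_upU1 r kp kV.
rewrite /column_hop; have [oc|oc] := eqVneq (odd k) c.
- apply/forallP/and3P => [h|[aA bA /forallP h r]].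
    have := h k; rewrite oc eqxx dU d0 eqxx kS' => hk.
    have := h (ordS k); rewrite ok oc dU eqxx (negbTE kS).
    have -> : (~~ c == c) = false by case: (c).
    move=> hS.
    have aA : k \in A by move: hk; case: (k \in A) => //; rewrite addn0 addn1 => /eqP.
    have bA : ordS k \notin A :\ k.
      rewrite in_setD1 kS /=; apply/negP => h1; rewrite h1 in hS.
      by move: hS; case: (_ \in C) => /eqP; lia.
    split=> //; apply/forallP => r; have := h r.
    rewrite dU !inE.
    have [->|nrk] := eqVneq r k.
      rewrite oc eqxx d0 aA kS' /=; case: (k \in C) => //.
    have [->|nrS] := eqVneq r (ordS k).
      rewrite ok oc; have -> : (~~ c == c) = false by case: (c).
      move: bA; rewrite in_setD1 kS /= => /negbTE->.
      by rewrite !addn0 add0n addnC.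
    by rewrite /= !addn0.
  have := h r; rewrite dU !inE.
  have [->|nrk] := eqVneq r k.
    by rewrite oc eqxx d0 aA kS' /=; case: (k \in C).
  have [->|nrS] := eqVneq r (ordS k).
    rewrite ok oc; have -> : (~~ c == c) = false by case: (c).
    move: bA; rewrite in_setD1 kS /= => /negbTE->.
    by rewrite !addn0 add0n addnC.
  by rewrite /= !addn0.
have {}oc : odd k = ~~ c by case: (odd k) (c) oc => [] [].
have cc : (~~ c == c) = false by case: (c).
apply/forallP/and3P => [h|[aA bA /forallP h r]].
  have := h k; rewrite oc cc dU d0 eqxx kS' => hk.
  have := h (ordS k); rewrite ok oc negbK eqxx dU eqxx (negbTE kS) => hS.
  have aA : ordS k \in A by move: hS; case: (_ \in A) => // /eqP; lia.
  have bA : k \notin A :\ ordS k.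
    rewrite in_setD1 kS' /=; apply/negP => h1; rewrite h1 in hk.
    by move: hk; case: (_ \in C) => /eqP; lia.
  split=> //; apply/forallP => r; have := h r.
  rewrite dU !inE.
  have [->|nrk] := eqVneq r k.
    rewrite oc cc d0 kS' /=; move: bA; rewrite in_setD1 kS' /= => /negbTE->.
    by case: (k \in C).
  have [->|nrS] := eqVneq r (ordS k).
    rewrite ok oc negbK eqxx aA /=; case: (_ \in C); case: (down_up V _) => [|[|?]] //=.
  by rewrite /= !addn0.
have := h r; rewrite dU !inE.
have [->|nrk] := eqVneq r k.
  rewrite oc cc d0 kS' /=; move: bA; rewrite in_setD1 kS' /= => /negbTE->.
  by case: (k \in C).
have [->|nrS] := eqVneq r (ordS k).
  by rewrite ok oc negbK eqxx aA /=; case: (_ \in C); case: (down_up V _) => [|[|?]].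
by rewrite /= !addn0.
Qed.

Lemma hop_count_column c A C :
  hop_count (column_hops c) A C =
  #|[set V : {set 'I_p} | inner_rows V && flow c A C V]|%:R.
Proof.
(* Hops are offered from top to bottom; the induction is on the number [d] of rows still to come,
   with the dominoes confined to these rows. *)
suff H d (k := (p - d)%N) : forall A, (d <= p)%N ->
    hop_count [seq column_hop c r | r : 'I_p <- drop k (enum 'I_p) & (r.+1 < p)%N]
      A C =
    #|[set V : {set 'I_p} | [&& rows_from k V, inner_rows V & flow c A C V]]|%:R.
  have := H p A (leqnn p); rewrite subnn drop0 => ->; congr (_%:R).
  apply: eq_card => V; rewrite !inE.
  by have -> : rows_from 0 V by apply/forallP => r; apply/implyP.
elim: d @k => [|d IH] /= {}A.
  move=> _; rewrite subn0 drop_oversize ?size_enum_ord //=; congr (_%:R).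
  rewrite -(eq_card (A := [pred V : {set 'I_p} | (V == set0) && (A == C)])); last first.
    move=> V; rewrite !inE; have [->|/set0Pn[r rV]] /= := eqVneq V set0.
      have -> : rows_from p set0 by apply/forallP => r; rewrite inE.
      have -> /= : inner_rows set0 by apply/forallP => r; rewrite inE.
      have d0 r : down_up set0 r = 0%N by rewrite /down_up !inE andbF.
      apply/eqP/forallP => [-> r|h]; first by rewrite d0 addn0 eqxx if_same.
      apply/setP => r; have := h r; rewrite d0 !addn0.
      by case: ifP => _; case: (_ \in A); case: (_ \in C).
    apply/esym/negP => /andP[/forallP/(_ r)]; rewrite rV /= leqNgt ltn_ord //.
  have [e|e] /= := eqVneq A C.
    by rewrite (eq_card (B := pred1 set0)) ?card1 // => V; rewrite !inE /= ?andbT.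
  by rewrite eq_card0 // => V; rewrite !inE /= ?andbF.
move=> dp; set k := (p - d.+1)%N.
have kp : (k < p)%N by rewrite /k; lia.
have ek : (p - d = k.+1)%N by rewrite /k; lia.
pose ko := Ordinal kp.
have -> : drop k (enum 'I_p) = ko :: drop k.+1 (enum 'I_p).
  rewrite (drop_nth ko) ?size_enum_ord //; congr (_ :: _).
  by apply: ord_inj; rewrite nth_enum_ord.
rewrite ek in IH; have {}IH A' := IH A' (ltnW dp).
pose D A' := [set V : {set 'I_p} | [&& rows_from k.+1 V, inner_rows V & flow c A' C V]].
have inD A' V : V \in D A' -> ko \notin V.
  rewrite inE => /andP[/forallP/(_ ko) h _]; apply/negP => kV.
  by move: h; rewrite kV /= ltnn.
have rowsU V : rows_from k.+1 V -> rows_from k V.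
  move=> /forallP h; apply/forallP => r; apply/implyP => rV.
  by have := h r; rewrite rV /= => /ltnW.
have rowsD V : rows_from k V -> rows_from k.+1 (V :\ ko).
  move=> /forallP h; apply/forallP => r; apply/implyP; rewrite !inE.
  rewrite -val_eqE /= => /andP[nrk rV].
  by have := h r; rewrite rV /=; lia.
(* The sets without [ko] decline the first hop, the sets containing [ko] take it. *)
rewrite -(cardsID [set V : {set 'I_p} | ko \notin V]) natrD.
rewrite (_ : _ :&: _ = D A); last first.
  apply/setP => V; rewrite !inE; have [kV|kV] /= := boolP (ko \in V).
    rewrite andbF; apply/esym/negP => h; have := @inD A V; rewrite kV inE.
    by move/(_ h).
  rewrite andbT; congr (_ && _); apply/idP/idP; last exact: rowsU.
  by move/rowsD; rewrite (setDidPl _) // disjoint_sym disjoints1.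
rewrite /=; case: ifP => kp1; last first.
  rewrite IH -[LHS]addr0; congr (_ + _); apply/esym.
  rewrite eq_card0 // => V; rewrite !inE negbK.
  by apply/negP => /andP[kV /and3P[_ /forallP/(_ ko)]]; rewrite kV /= kp1.
have fU V : rows_from k.+1 V ->
  let: (a, b, _) := column_hop c ko in
  flow c A C (ko |: V) =
  [&& a \in A, b \notin A :\ a & flow c (b |: (A :\ a)) C V].
  by move=> hV; apply: flowU1.
rewrite /=; case e: (column_hop c ko) fU => [[a b] w] fU.
have -> : w = 1 by move: e; rewrite /column_hop; case: ifP => _ [].
rewrite mul1r !IH; congr (_ + _).
case: ifP => [/andP[aA bA]|nab]; last first.
  rewrite eq_card0 // => V; rewrite !inE negbK.
  apply/negP => /and4P[kV rV _]; rewrite -(setD1K kV) fU ?rowsD //.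
  by rewrite andbA nab.
congr (_%:R); rewrite -[LHS](card_in_imset (f := fun V => ko |: V)).
  apply: eq_card => V; rewrite !inE negbK; apply/imsetP/idP => [[V0 V0D ->]|].
    have kV0 := inD _ _ V0D; move: V0D; rewrite inE => /and3P[rV iV fV].
    rewrite setU11 /= fU // aA bA fV !andbT; apply/andP; split.
      apply/forallP => r; apply/implyP; rewrite !inE => /orP[/eqP->//|rV0].
      by have /forallP/(_ r) := rV; rewrite rV0 /= => /ltnW.
    apply/forallP => r; apply/implyP; rewrite !inE => /orP[/eqP->//|rV0].
    by have /forallP/(_ r) := iV; rewrite rV0.
  case/and4P=> kV rV iV fV; exists (V :\ ko); last by rewrite setD1K.
  rewrite inE rowsD //=; apply/andP; split.
    apply/forallP => r; apply/implyP; rewrite !inE => /andP[_ rV0].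
    by have /forallP/(_ r) := iV; rewrite rV0.
  by move: fV; rewrite -{1}(setD1K kV) fU ?rowsD // aA bA.
move=> V V' /inD kV /inD kV' /= eV.
by rewrite -(setU1K kV) eV setU1K.
Qed.

Lemma hop_count_column_tiling c S S' :
  hop_count (column_hops c) (toggle c S) (toggle (~~ c) S') =
  #|[set V : {set 'I_p} | column_tiling S S' V]|%:R.
Proof.
rewrite hop_count_column; congr (_%:R); apply: eq_card => V.
by rewrite !inE (column_tilingE c).
Qed.

Lemma column_hops_near c : all (@hop_near K p) (column_hops c).
Proof.
apply/allP => _ /mapP[r + ->]; rewrite mem_filter => /andP[rp _].
rewrite /column_hop /hop_near; case: ifP => _ /=; rewrite modn_small //.
  by rewrite leqnn andbT; lia.
by rewrite leqnn /=; lia.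
Qed.

End Columns.

(** * Perfect matchings as sequences of sets of rows *)

Lemma weighted_matchings_reindex (V T : finType) (e : rel V) (w : {set V} -> nat)
    (D : {set T}) (ed : T -> {set V}) :
  {in D &, injective ed} -> edges e = ed @: D ->
  weighted_matchings e w =
  (\sum_(X : {set T} | (X \subset D) &&
      [forall v, #|[set s in X | v \in ed s]| == 1]) \prod_(s in X) w (ed s))%N.
Proof.
move=> inj_ed edgesE; rewrite /weighted_matchings.
rewrite (reindex_onto (fun X : {set T} => ed @: X)
  (fun M : {set {set V}} => [set s in D | ed s \in M])) /=; last first.
  move=> M; rewrite inE edgesE => /andP[/subsetP sub _]; apply/setP => E.
  apply/imsetP/idP => [[s]|EM]; first by rewrite inE => /andP[_ sM] ->.
  have /imsetP[s sD es] := sub _ EM; exists s => //.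
  by rewrite inE sD -es.
have subK (X : {set T}) : ([set s in D | ed s \in ed @: X] == X) = (X \subset D).
  apply/eqP/idP => [<-|/subsetP sub]; first by apply/subsetP => s; rewrite inE => /andP[].
  apply/setP => s; rewrite inE; apply/andP/idP => [[sD /imsetP[t tX st]]|sX].
    by rewrite (inj_ed _ _ sD (sub _ tX) st).
  by rewrite sub // imset_f.
apply: eq_big => [X|X]; last first.
  rewrite subK => /andP[_ /subsetP sub]; rewrite big_imset //= => s t sX tX.
  by apply: inj_ed; apply: sub.
rewrite subK andbC; have [sub|] //= := boolP (X \subset D).
rewrite inE edgesE imsetS //=; apply: eq_forallb => v; congr (_ == _).
rewrite -(card_in_imset (f := ed) (D := mem [set s in X | v \in ed s])).
  apply: eq_card => E; rewrite !inE.
  apply/andP/imsetP => [[/imsetP[s sX ->] vs]|[s]].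
    by exists s => //; rewrite inE sX.
  by rewrite inE => /andP[sX vs] ->; rewrite imset_f.
by move=> s t; rewrite !inE => /andP[sX _] /andP[tX _]; apply: inj_ed; apply: (subsetP sub).
Qed.

(* A slot [(h, j, r)] is the edge that goes from the vertex [(r, j)] to the next
   column if [h], and to the next row otherwise; [tw] tells the Moebius board,
   whose last column is followed by the first one, upside down. *)
Section Slots.
Variables (p q : nat).
Hypothesis q_gt1 : (1 < q)%N.
Local Notation slot := (bool * 'I_q * 'I_p)%type.
Implicit Types (s : slot) (tw : bool) (S : {set 'I_p}).

Definition next_row (j : 'I_q) (r : 'I_p) := if j.+1 == q then rev_ord r else r.

Definition slot_edge s : {set gvertex p q} :=
  let: (h, j, r) := s in
  if h then [set (r, j); (next_row j r, ordS j)] else [set (r, j); (ordS r, j)].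

Definition slots tw : {set slot} :=
  [set s : slot | if s.1.1 then tw || (s.1.2.+1 < q)%N else (s.2.+1 < p)%N].

Definition tiling_adj tw : rel (gvertex p q) :=
  if tw then @mobius_adj p q else @grid_adj p q.

Lemma ordS_neq (j : 'I_q) : ordS j != j.
Proof.
have jlt := ltn_ord j; apply/eqP => /(congr1 (@nat_of_ord _)) /=.
have [jq|jq] : (j.+1 < q)%N \/ (j.+1 = q :> nat) by lia.
  by rewrite modn_small //; lia.
by rewrite jq modnn; lia.
Qed.

Lemma next_rowK j : involutive (next_row j).
Proof. by move=> r; rewrite /next_row; case: (j.+1 == q); rewrite ?rev_ordK. Qed.

Lemma rev_ord_neq (r : 'I_p) : ~~ odd p -> rev_ord r != r.
Proof.
move=> op; apply/eqP => /(congr1 (@nat_of_ord _)) /= e.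
by have := ltn_ord r; have := odd_double_half p; lia.
Qed.

(** Two horizontal slots can share an edge with exchanged ends only if q = 2 and the board is
    twisted. That would need a row fixed by the reversal, which an even number of rows excludes. *)
Lemma slot_edge_inj tw : (tw -> ~~ odd p) -> {in slots tw &, injective slot_edge}.
Proof.
move=> twp.
have dbl (x y z t : gvertex p q) : [set x; y] = [set z; t] ->
    x = z /\ y = t \/ x = t /\ y = z.
  move=> e; have := set21 x y; rewrite e !inE => /orP[] /eqP xe; [left|right]; split=> //.
    have := set22 x y; rewrite e !inE => /orP[] /eqP ye //.
    have := set22 z t; rewrite -e !inE => /orP[] /eqP te; by rewrite te ?xe -?ye.
  have := set22 x y; rewrite e !inE => /orP[] /eqP ye //.
  have := set21 z t; rewrite -e !inE => /orP[] /eqP te; by rewrite te ?xe -?ye.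
move=> [[h j] r] [[h' j'] r']; rewrite !inE /=.
case: h; case: h' => v v' /dbl [] [[e1 e2] [e3 e4]] //; try by rewrite e1 e2.
- have jj : ordS (ordS j) = j by rewrite e4 e2.
  have q2 : q = 2%N.
    move/(congr1 (@nat_of_ord _)): jj => /=; have jlt := ltn_ord j.
    have [jq|jq] : (j.+1 < q)%N \/ (j.+1 = q :> nat) by lia.
      rewrite (modn_small jq).
      have [jq'|jq'] : (j.+2 < q)%N \/ (j.+2 = q :> nat) by lia.
        by rewrite modn_small //; lia.
      by rewrite jq' modnn; lia.
    by rewrite jq modnn modn_small //; lia.
  have jlt := ltn_ord j; have jlt' := ltn_ord j'.
  have nj : j != j' by rewrite -e4 eq_sym ordS_neq.
  have nj' : (j : nat) != j' by [].
  exfalso; have e5 : r' = rev_ord r.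
    move: e1 e3; rewrite /next_row; case: ifP => a; case: ifP => b.
    - by lia.
    - by move=> e1 e3; rewrite -e3 -?e1 // {1}e1 e3.
    - by move=> _ ->.
    - by lia.
  have e6 : r' = r.
    move: e1 e3; rewrite /next_row; case: ifP => a; case: ifP => b.
    - by lia.
    - by move=> _ ->.
    - by move=> ->.
    - by lia.
  have tw1 : tw.
    by move: v v'; case: (tw) => //=; lia.
  by move: (rev_ord_neq r (twp tw1)); rewrite -e5 e6 eqxx.
- by move: (ordS_neq j); rewrite e4 e2 eqxx.
- by move: (ordS_neq j); rewrite e4 -e2 eqxx.
- by move: (ordS_neq j'); rewrite -e4 -e2 eqxx.
- by move: (ordS_neq j'); rewrite -e2 e4 eqxx.
- move/(congr1 (@nat_of_ord _)): e1; move/(congr1 (@nat_of_ord _)): e3.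
  by rewrite !val_ordS //; lia.
Qed.

Lemma grid_adjP (r r' : 'I_p) (j j' : 'I_q) :
  reflect ([\/ r = r' /\ j' = j.+1 :> nat, r = r' /\ j = j'.+1 :> nat,
               j = j' /\ r' = r.+1 :> nat | j = j' /\ r = r'.+1 :> nat])
          (@grid_adj p q (r, j) (r', j')).
Proof.
rewrite /grid_adj /=; apply: (iffP idP) => [e|].
  have [rr|nrr] := eqVneq r r'.
    have [jj|jj] : (j' = j.+1 :> nat) \/ (j = j'.+1 :> nat) by rewrite rr in e; lia.
      by constructor 1.
    by constructor 2.
  have nrr' : (r : nat) != r' by [].
  have jj : j = j' by apply: ord_inj; lia.
  rewrite jj in e; have [rr|rr] : (r' = r.+1 :> nat) \/ (r = r'.+1 :> nat) by lia.
    by constructor 3.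
  by constructor 4.
by case=> [] [-> e]; lia.
Qed.

Lemma edges_tiling tw : (tw -> ~~ odd p) -> edges (tiling_adj tw) = slot_edge @: slots tw.
Proof.
move=> twp.
have imH (r : 'I_p) (j j' : 'I_q) : j' = j.+1 :> nat ->
    [set (r, j); (r, j')] \in slot_edge @: slots tw.
  move=> e; have jq : (j.+1 < q)%N by rewrite -e ltn_ord.
  apply/imsetP; exists (true, j, r); first by rewrite inE /= jq orbT.
  rewrite /= /next_row ltn_eqF //; congr [set _; (_, _)].
  by apply: ord_inj; rewrite val_ordS.
have imV (r r' : 'I_p) (j : 'I_q) : r' = r.+1 :> nat ->
    [set (r, j); (r', j)] \in slot_edge @: slots tw.
  move=> e; have rp : (r.+1 < p)%N by rewrite -e ltn_ord.
  apply/imsetP; exists (false, j, r); first by rewrite inE.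
  rewrite /=; congr [set _; (_, _)].
  by apply: ord_inj; rewrite val_ordS.
have imT (r r' : 'I_p) (j j' : 'I_q) : tw -> twist (r, j) (r', j') ->
    [set (r', j'); (r, j)] \in slot_edge @: slots tw.
  rewrite /twist /= => twT /and3P[/eqP j0 /eqP jq /eqP ->].
  apply/imsetP; exists (true, j', rev_ord r); first by rewrite inE /= twT.
  rewrite /= /next_row jq eqxx rev_ordK; congr [set _; (_, _)].
  by apply: ord_inj; rewrite /= jq modnn.
have imG (r r' : 'I_p) (j j' : 'I_q) : @grid_adj p q (r, j) (r', j') ->
    [set (r, j); (r', j')] \in slot_edge @: slots tw.
  move/grid_adjP => [] [-> e]; try by [exact: imH|exact: imV].
    by rewrite setUC; exact: imH.
  by rewrite setUC; exact: imV.
have im (x y : gvertex p q) : tiling_adj tw x y -> [set x; y] \in slot_edge @: slots tw.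
  case: x y => [r j] [r' j'] adj.
  have {adj} [|[twT]] : grid_adj (r, j) (r', j') \/ tw /\ mobius_adj (r, j) (r', j').
    by move: adj; rewrite /tiling_adj; case: (tw); [right | left].
    exact: imG.
  case/or3P => [|t|t]; first exact: imG.
    by rewrite setUC; apply: imT.
  exact: imT.
apply/setP => E; rewrite inE; apply/idP/idP.
  by case/existsP => x /existsP[y] /and3P[_ + /eqP->]; exact: im.
case/imsetP => -[[h j] r]; rewrite inE; case: h => /= v ->; last first.
  apply/existsP; exists (r, j); apply/existsP; exists (ordS r, j).
  rewrite eqxx andbT; apply/andP; split.
    by rewrite xpair_eqE eqxx andbT eq_ordS //; lia.
  have : @grid_adj p q (r, j) (ordS r, j).
    by apply/grid_adjP; constructor 3; rewrite val_ordS.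
  by rewrite /tiling_adj; case: (tw) => // g; rewrite /mobius_adj g.
apply/existsP; exists (r, j); apply/existsP; exists (next_row j r, ordS j).
rewrite eqxx andbT; apply/andP; split.
  by rewrite xpair_eqE negb_and (eq_sym j) ordS_neq orbT.
have [jq|jq] := ltnP j.+1 q.
  have : @grid_adj p q (r, j) (next_row j r, ordS j).
    by apply/grid_adjP; constructor 1; rewrite /next_row ltn_eqF // val_ordS.
  by rewrite /tiling_adj; case: (tw) => // g; rewrite /mobius_adj g.
have {}jq : j.+1 = q by have := ltn_ord j; lia.
have twT : tw by move: v; rewrite jq ltnn orbF.
rewrite /tiling_adj twT /mobius_adj /twist /= /next_row jq eqxx modnn rev_ordK !eqxx.
by rewrite !orbT.
Qed.

(** For the first column [ord_pred] wraps around to the last one, read upside down. On the planar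
    board that set is required to be empty. *)
Definition prev_rows (H : {ffun 'I_q -> {set 'I_p}}) (j : 'I_q) : {set 'I_p} :=
  [set r | next_row (ord_pred j) r \in H (ord_pred j)].

(** The slots at a vertex are those to the right, to the left, below and above. They are pairwise
    distinct, as q > 1, so the indicators may be added. *)
Lemma mem_slot_edge tw s (r : 'I_p) (j : 'I_q) : s \in slots tw ->
  ((r, j) \in slot_edge s) =
  ((s == (true, j, r)) + (s == (true, ord_pred j, next_row (ord_pred j) r)) +
   (s == (false, j, r)) + ((0 < r) && (s == (false, j, ord_pred r))))%N :> nat.
Proof.
case: s => [[h j'] r']; rewrite inE !xpair_eqE; case: h => /= v.
  rewrite andbF !addn0 !inE !xpair_eqE.
  have -> : (r == next_row j' r') && (j == ordS j') =
      (j' == ord_pred j) && (r' == next_row (ord_pred j) r).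
    apply/andP/andP => -[/eqP-> /eqP->]; rewrite ?ordSK ?ord_predK ?next_rowK //.
  have [->|_] := eqVneq j j'.
    rewrite andbT eq_sym; case: (r' == r) => //=.
    have -> : (j' == ord_pred j') = false; last by [].
    apply/negbTE; apply: contra (ordS_neq (ord_pred j')) => /eqP e.
    by rewrite ord_predK -e.
  by rewrite andbF.
rewrite !add0n !inE !xpair_eqE [j == j']eq_sym.
have [jj|nj] /= := eqVneq j' j; last by rewrite !andbF.
rewrite !andbT eq_ordS // (eq_sym r').
have [->|nr] := eqVneq r r'.
  have -> /= : r' == r'.+1 :> nat = false by lia.
  case r0 : (0 < r')%N => //=; rewrite (eq_sym r') eq_ord_pred //.
  by have -> : r' == r'.+1 :> nat = false by lia.
rewrite /=; case r0 : (0 < r)%N; rewrite /= ?(eq_sym r') ?eq_ord_pred //.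
by have -> : r == r'.+1 :> nat = false by lia.
Qed.

Definition slot_set (HV : {ffun 'I_q -> {set 'I_p}} * {ffun 'I_q -> {set 'I_p}}) : {set slot} :=
  [set s : slot | if s.1.1 then s.2 \in HV.1 s.1.2 else s.2 \in HV.2 s.1.2].

Lemma card_slot_set tw H V (r : 'I_p) (j : 'I_q) : slot_set (H, V) \subset slots tw ->
  #|[set s in slot_set (H, V) | (r, j) \in slot_edge s]| =
  ((r \in prev_rows H j) + (r \in H j) + down_up (V j) r)%N.
Proof.
move=> /subsetP sub; rewrite -sum1dep_card big_mkcondr /=.
under eq_bigr => s sX.
  have -> : (if (r, j) \in slot_edge s then 1 else 0)%N = ((r, j) \in slot_edge s : nat).
    by case: ifP.
  rewrite (mem_slot_edge _ _ (sub _ sX)); over.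
have del (b : bool) s0 : (\sum_(s in slot_set (H, V)) (b && (s == s0)) =
    b && (s0 \in slot_set (H, V)))%N.
  case: b => /=; last by rewrite big1.
  have [s0X|s0X] := boolP (s0 \in slot_set (H, V)).
    by rewrite (bigD1 s0) //= eqxx big1 // => s /andP[_ /negbTE->].
  rewrite big1 // => s sX; apply/eqP; rewrite eqb0; apply: contraNneq s0X => <-.
  exact: sX.
rewrite !big_split /=.
rewrite (del true) (del true) (del true) del /= /down_up !inE /=.
by rewrite (addnC (_ \in H j)) addnA.
Qed.

(** Once the horizontal dominoes are fixed, the columns are filled independently of each other, so
    the sum over vertical dominoes factors. *)
Lemma weighted_tilings tw (w : {set gvertex p q} -> nat) (u : 'I_q -> 'I_p -> nat) :
  (tw -> ~~ odd p) ->
  (forall (j : 'I_q) (r : 'I_p), (r.+1 < p)%N -> w (slot_edge (false, j, r)) = 1%N) ->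
  (forall (j : 'I_q) (r : 'I_p), tw || (j.+1 < q)%N -> w (slot_edge (true, j, r)) = u j r) ->
  weighted_matchings (tiling_adj tw) w =
  (\sum_(H : {ffun 'I_q -> {set 'I_p}} | [forall j : 'I_q, [|| tw, j.+1 < q | H j == set0]])
    \prod_(j < q) (#|[set V | column_tiling (prev_rows H j) (H j) V]| *
                   \prod_(r in H j) u j r))%N.
Proof.
move=> twp wV wH.
rewrite (weighted_matchings_reindex w (slot_edge_inj twp) (edges_tiling twp)).
pose unslot (X : {set slot}) : {ffun 'I_q -> {set 'I_p}} * {ffun 'I_q -> {set 'I_p}} :=
  ([ffun j => [set r | (true, j, r) \in X]], [ffun j => [set r | (false, j, r) \in X]]).
rewrite (reindex_onto slot_set unslot) /=; last first.
  by move=> X _; apply/setP => -[[[] j] r]; rewrite !inE !ffunE !inE.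
have unslotK HV : unslot (slot_set HV) == HV.
  by case: HV => H V; rewrite xpair_eqE; apply/andP; split; apply/eqP/ffunP => j;
    rewrite ffunE; apply/setP => r; rewrite !inE.
under eq_bigl do rewrite unslotK andbT.
have tilE H j : (#|[set V | column_tiling (prev_rows H j) (H j) V]| *
      \prod_(r in H j) u j r = \sum_(V | column_tiling (prev_rows H j) (H j) V)
      \prod_(r in H j) u j r)%N.
  by rewrite sum_nat_const; congr (_ * _)%N; apply: eq_card => V; rewrite inE.
under [RHS]eq_bigr => H _ do
  ((under eq_bigr => j _ do rewrite tilE); rewrite bigA_distr_big_dep).
rewrite pair_big_dep /=; apply: eq_big => [[H V]|[H V] cond] /=.
  apply/andP/andP => [[sub /forallP h]|[/forallP hH /familyP hV]].
    split; first apply/forallP => j.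
      rewrite orbA; case: (set_0Vmem (H j)) => [h0|[r rH]]; apply/orP.
        by right; apply/eqP.
      by left; have := subsetP sub (true, j, r); rewrite !inE /= => /(_ rH).
    apply/familyP => j; rewrite unfold_in; apply/andP; split.
      apply/forallP => r; apply/implyP => rV.
      by have := subsetP sub (false, j, r); rewrite !inE /= => /(_ rV).
    by apply/forallP => r; rewrite -(card_slot_set _ _ sub) h.
  have sub : slot_set (H, V) \subset slots tw.
    apply/subsetP => -[[[] j] r]; rewrite !inE /=.
      move=> rH; have := hH j; rewrite orbA => /orP[//|/eqP h0].
      by rewrite h0 inE in rH.
    have := hV j; rewrite unfold_in => /andP[/forallP/(_ r)/implyP h _].
    exact: h.
  split=> //; apply/forallP => -[r j]; rewrite (card_slot_set _ _ sub).
  by have := hV j; rewrite unfold_in => /andP[_ /forallP/(_ r)].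
have {cond} sub : slot_set (H, V) \subset slots tw by case/andP: cond.
rewrite (eq_bigr (fun s : slot => if s.1.1 then u s.1.2 s.2 else 1%N)); last first.
  move=> [[h j] r] sX; have := subsetP sub _ sX; rewrite inE.
  by case: h {sX} => /= v; rewrite ?wV ?wH.
rewrite (bigID (fun s : slot => s.1.1)) /= [X in (_ * X)%N]big1 ?muln1; last first.
  by move=> s /andP[_ /negbTE->].
rewrite (reindex_onto (fun jr : 'I_q * 'I_p => (true, jr.1, jr.2))
  (fun s : slot => (s.1.2, s.2))); last by case=> [[[] j] r] //= /andP[].
by rewrite pair_big_dep; apply: eq_big => [[j r]|[j r] _] //=; rewrite inE eqxx !andbT.
Qed.
End Slots.

(** * Sums over sequences of states as products of transfer matrices *)

Section Chains.
Variables (K : comNzRingType) (T : finType) (t : nat -> T -> T -> K).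

Fixpoint chain q (A C : T) : K :=
  if q is q'.+1 then \sum_B chain q' A B * t q' B C else (A == C)%:R.

Definition chain_prev (A : T) q (H : {ffun 'I_q -> T}) (j : 'I_q) :=
  if (0 < j)%N then H (ord_pred j) else A.

Lemma sum_chain q (A C : T) :
  \sum_(H : {ffun 'I_q.+1 -> T} | H ord_max == C)
    \prod_(j < q.+1) t j (chain_prev A H j) (H j) = chain q.+1 A C.
Proof.
elim: q C => [|q IH] C.
  rewrite /= (bigD1 A) //= eqxx mul1r [X in _ + X]big1 ?addr0 => [|B]; last first.
    by rewrite eq_sym => /negbTE->; rewrite mul0r.
  rewrite (big_pred1 [ffun=> C]) => [|H].
    by rewrite big_ord1 ffunE.
  apply/eqP/eqP => [HC|->]; last by rewrite ffunE.
  by apply/ffunP => j; rewrite ffunE -HC; congr (H _); apply: ord_inj; case: j => [[]].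
rewrite [RHS]/= -/(chain q.+1 A _).
pose ext (Hx : {ffun 'I_q.+1 -> T} * T) : {ffun 'I_q.+2 -> T} :=
  [ffun i => if unlift ord_max i is Some k then Hx.1 k else Hx.2].
pose res (H : {ffun 'I_q.+2 -> T}) : {ffun 'I_q.+1 -> T} * T :=
  ([ffun k => H (lift ord_max k)], H ord_max).
rewrite (reindex_onto ext res) /=; last first.
  move=> H _; apply/ffunP => i; rewrite !ffunE.
  by case: unliftP => [k ->|->]; rewrite ?ffunE.
rewrite (eq_bigl (fun Hx => Hx.2 == C)) => [|[H x]]; last first.
  rewrite ffunE unlift_none /= -[RHS]andbT; congr (_ && _).
  apply/eqP; congr (_, _); rewrite ?ffunE ?unlift_none //.
  by apply/ffunP => k; rewrite !ffunE liftK.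
under eq_bigr => Hx _.
  rewrite big_ord_recr /=.
  have -> : \prod_(i < q.+1) t (widen_ord (leqnSn q.+1) i)
      (chain_prev A (ext Hx) (widen_ord (leqnSn q.+1) i)) (ext Hx (widen_ord (leqnSn q.+1) i))
      = \prod_(j < q.+1) t j (chain_prev A Hx.1 j) (Hx.1 j).
    have extE (k : 'I_q.+2) (k' : 'I_q.+1) : k = k' :> nat -> ext Hx k = Hx.1 k'.
      move=> kk; rewrite ffunE; have -> : k = lift ord_max k'.
        by apply: ord_inj; rewrite lift_max.
      by rewrite liftK.
    apply: eq_bigr => j _; congr (t _ _ _); last exact: extE.
    rewrite /chain_prev /=; case: ifP => // j0; apply: extE.
    by rewrite !val_ord_pred.
  have -> : chain_prev A (ext Hx) ord_max = Hx.1 ord_max.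
    rewrite /chain_prev /= ffunE; have -> : ord_pred ord_max = lift ord_max ord_max :> 'I_q.+2.
      by apply: ord_inj; rewrite val_ord_pred // lift_max.
    by rewrite liftK.
  have -> : ext Hx ord_max = Hx.2 by rewrite ffunE unlift_none.
  over.
rewrite -(pair_big xpredT (fun x => x == C) (fun H x =>
  \prod_(j < q.+1) t j (chain_prev A H j) (H j) * t q.+1 (H ord_max) x)) /=.
under eq_bigr => H _ do rewrite big_pred1_eq.
rewrite (partition_big (fun H : {ffun 'I_q.+1 -> T} => H ord_max) xpredT) //=.
apply: eq_bigr => B _; move: (IH B) => /= <-; rewrite mulr_suml.
by apply: eq_bigr => H /eqP->.
Qed.

(** The map [g] ties the state before the first step to the final state; for the Moebius board it
    turns a set of rows upside down. *)
Lemma sum_closed_chain q (P : pred T) (g : T -> T) :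
  \sum_(H : {ffun 'I_q.+1 -> T} | P (H ord_max))
    \prod_(j < q.+1) t j (chain_prev (g (H ord_max)) H j) (H j) =
  \sum_(C | P C) chain q.+1 (g C) C.
Proof.
rewrite (partition_big (fun H : {ffun 'I_q.+1 -> T} => H ord_max) P) //.
apply: eq_bigr => C PC; rewrite -sum_chain; apply: eq_big => [H|H /andP[_ /eqP->]] //.
by apply/andP/eqP => [[_ /eqP]|->].
Qed.

End Chains.

Section TilingsAsHops.
Variables (K : comNzRingType) (p : nat).
Implicit Types (u : nat -> 'I_p -> nat) (S A C : {set 'I_p}).

(** A loop of weight f r - 1, taken or not, contributes 1 + (f r - 1) = f r in total. *)
Definition weight_hops (f : 'I_p -> nat) : seq ('I_p * 'I_p * K) :=
  [seq (r, r, (f r)%:R - 1) | r : 'I_p <- enum 'I_p].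

Definition grid_hops c q u :=
  flatten [seq column_hops K p (c (+) odd j) ++ weight_hops (u j) | j <- iota 0 q].

Lemma hop_count_weight f A C :
  hop_count (weight_hops f) A C = (A == C)%:R * (\prod_(r in A) f r)%:R.
Proof.
have -> : (\prod_(r in A) f r = \prod_(r <- enum 'I_p | r \in A) f r)%N.
  by rewrite big_enum_cond; apply: eq_bigl => r; rewrite inE.
rewrite /weight_hops.
elim: (enum 'I_p) => [|r s IH] /=; first by rewrite big_nil mulr1.
rewrite setD11 /= andbT IH big_cons; case: ifP => rA; last by rewrite addr0.
by rewrite setD1K // IH mulrBl mul1r addrC subrK natrM mulrCA.
Qed.

(** Particles after column [j] are horizontal dominoes exactly in the rows of parity [c (+) odd j];
    only there can a weight on dominoes be read as a weight on particles. *)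
Lemma hop_count_grid c q u S C :
  (forall j (r : 'I_p), (j < q)%N -> odd r != c (+) odd j -> u j r = 1%N) ->
  hop_count (grid_hops c q u) (toggle c S) (toggle (c (+) odd q) C) =
  chain (fun j (B D : {set 'I_p}) =>
    (#|[set V | column_tiling B D V]| * \prod_(r in D) u j r)%:R) q S C.
Proof.
elim: q C => [|q IH] C u1.
  by rewrite /= addbF (inj_eq (inv_inj (toggleK c))).
rewrite /grid_hops -addn1 iotaD map_cat flatten_cat /= cats0 hop_count_cat addn1 add0n.
rewrite (reindex_inj (inv_inj (toggleK (c (+) odd q)))) /=.
apply: eq_bigr => B _; rewrite IH; last by move=> j r jq; apply: u1; apply: ltnW.
congr (_ * _); rewrite hop_count_cat (bigD1 (toggle (~~ (c (+) odd q)) C)) //=.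
rewrite addbN hop_count_column_tiling hop_count_weight eqxx mul1r.
rewrite [X in _ + X]big1 ?addr0 => [|D nD]; last first.
  by rewrite hop_count_weight (negbTE nD) mul0r mulr0.
rewrite -natrM; congr (_ * _)%:R.
rewrite (bigID (fun r : 'I_p => odd r == c (+) odd q)) /=.
rewrite [RHS](bigID (fun r : 'I_p => odd r == c (+) odd q)) /=.
congr (_ * _)%N; last by rewrite !big1 // => r /andP[_ nr]; apply: u1.
apply: eq_bigl => r; rewrite inE; rewrite eq_sym.
by case: (odd r) (c (+) odd q) => [] []; rewrite ?andbF //= !andbT addbF.
Qed.

(** Here [S] is the set of dominoes leaving the last column: arbitrary on the Moebius board, where
    it reenters upside down, and empty on the planar one. *)
Lemma tilings_hop_count q (tw : bool) (w : {set gvertex p q.+1} -> nat) u (c : bool) :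
  (1 < q.+1)%N -> (tw -> ~~ odd p) ->
  (forall (j : 'I_q.+1) (r : 'I_p), (r.+1 < p)%N -> w (slot_edge (false, j, r)) = 1%N) ->
  (forall (j : 'I_q.+1) (r : 'I_p), tw || (j.+1 < q.+1)%N ->
     w (slot_edge (true, j, r)) = u j r) ->
  (forall j (r : 'I_p), (j < q.+1)%N -> odd r != c (+) odd j -> u j r = 1%N) ->
  (weighted_matchings (@tiling_adj p q.+1 tw) w)%:R =
  \sum_(S : {set 'I_p} | tw || (S == set0))
    hop_count (grid_hops c q.+1 u) (toggle c [set r | rev_ord r \in S])
      (toggle (c (+) odd q.+1) S).
Proof.
move=> q0 twp wV wH u1; rewrite (weighted_tilings q0 twp wV wH) natr_sum.
under [RHS]eq_bigr => S _ do rewrite hop_count_grid //.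
rewrite -(sum_closed_chain _ q (fun S => tw || (S == set0)) (fun S => [set r | rev_ord r \in S])).
apply: eq_big => [H|H _].
  apply/forallP/idP => [/(_ ord_max)|h j]; first by rewrite ltnn.
  have [->|jq] := eqVneq j ord_max; first by rewrite ltnn.
  have -> : (j.+1 < q.+1)%N.
    by rewrite ltnS ltn_neqAle -ltnS ltn_ord andbT.
  by rewrite orbT.
rewrite natr_prod; apply: eq_bigr => j _; congr (_ * _)%:R.
apply: eq_card => V; rewrite !inE; congr column_tiling; apply/setP => r; rewrite inE.
rewrite /chain_prev /next_row; case: ltnP => j0.
  rewrite val_ord_pred // prednK // ltn_eqF //.
have jm : ord_pred j = ord_max.
  by apply: ord_inj => /=; case: j j0 => [[|j] hj] //= _; rewrite modn_small.
by rewrite jm eqxx inE.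
Qed.

End TilingsAsHops.

(** * The transfer matrices *)

(* [2 * T_n (x / 2)], which has integral coefficients. *)
Fixpoint cheb (A : pzRingType) (x : A) n : A :=
  match n with
  | 0 => 2%:R
  | 1 => x
  | (k.+1 as k1).+1 => x * cheb x k1 - cheb x k
  end.

Lemma chebS (A : pzRingType) (x : A) n : cheb x n.+2 = x * cheb x n.+1 - cheb x n.
Proof. by []. Qed.

Lemma nat_ind2 (P : nat -> Prop) :
  P 0%N -> P 1%N -> (forall n, P n -> P n.+1 -> P n.+2) -> forall n, P n.
Proof.
move=> P0 P1 P2 n; suff [] : P n /\ P n.+1 by [].
by elim: n => [|n [? ?]]; split=> //; apply: P2.
Qed.

(** The identity 2 T_n((b + 1/b) / 2) = b^n + 1/b^n needs no commutativity beyond that of [b] with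
    its inverse. *)
Lemma cheb_inv (A : pzRingType) (b b' : A) n : b * b' = 1 -> b' * b = 1 ->
  cheb (b + b') n = b ^+ n + b' ^+ n.
Proof.
move=> bb' b'b; elim/nat_ind2: n => [||n IH0 IH1]; rewrite ?expr0 ?expr1 //.
rewrite chebS IH1 IH0 mulrDl !mulrDr -!exprS.
rewrite (exprS b' n) (mulrA b b') bb' mul1r.
rewrite (exprS b n) (mulrA b' b) b'b mul1r.
by rewrite (addrC (b ^+ n) (b' ^+ _)) addrACA (addrC (b' ^+ n)) addrK.
Qed.

Lemma mulmx_cheb (K : comNzRingType) m p (J : 'M[K]_(m, p)) (x : 'M[K]_p) (y : 'M[K]_m) n :
  J *m x = y *m J -> J *m cheb x n = cheb y n *m J.
Proof.
move=> Jx; elim/nat_ind2: n => [||n IH0 IH1] //.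
  by rewrite /= !mulr2n mulmxDr mulmxDl [J *m 1]mulmx1 [1 *m J]mul1mx.
by rewrite !chebS mulmxBr mulmxBl IH0 mulmxA Jx -mulmxA IH1 mulmxA.
Qed.

Section Checkerboard.
(* An operator [P] exchanging the two halves of a decomposition [1 = e + e']. *)
Variables (A : pzRingType) (e e' P : A).
Hypotheses (eD : e + e' = 1) (ee : e * e = e) (ee' : e * e' = 0) (e'e : e' * e = 0).
Hypotheses (Pe : P * e = e' * P) (Pe' : P * e' = e * P).

Let M := 1 + e * P.
Let M' := 1 + e' * P.

Lemma half_sqr0 : (e * P) * (e * P) = 0.
Proof. by rewrite mulrA -(mulrA e P e) Pe mulrA ee' !mul0r. Qed.

Lemma half_sqr0' : (e' * P) * (e' * P) = 0.
Proof. by rewrite mulrA -(mulrA e' P e') Pe' mulrA e'e !mul0r. Qed.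

(** Since e P e P = e e' P P = 0, each half step is 1 plus an element of square zero and is inverted
    by changing the sign of that element. *)
Lemma two_step_inv : (M * M') * ((1 - e' * P) * (1 - e * P)) = 1.
Proof.
have h : M' * (1 - e' * P) = 1.
  by rewrite mulrBr mulr1 mulrDl mul1r half_sqr0' addr0 addrK.
rewrite mulrA -(mulrA M) h mulr1.
by rewrite mulrBr mulr1 mulrDl mul1r half_sqr0 addr0 addrK.
Qed.

Lemma two_step_inv' : ((1 - e' * P) * (1 - e * P)) * (M * M') = 1.
Proof.
have h : (1 - e * P) * M = 1.
  by rewrite mulrDr mulr1 mulrBl mul1r half_sqr0 subr0 subrK.
rewrite mulrA -(mulrA _ _ M) h mulr1.
by rewrite mulrDr mulr1 mulrBl mul1r half_sqr0' subr0 subrK.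
Qed.

(** The linear terms cancel, and the quadratic ones are e P P and e' P P, which add up to P P. *)
Lemma two_stepD : M * M' + (1 - e' * P) * (1 - e * P) = 2%:R + P * P.
Proof.
have E1 : (e * P) * (e' * P) = e * (P * P).
  by rewrite mulrA -(mulrA e P e') Pe' !mulrA ee.
have E2 : (e' * P) * (e * P) = e' * (P * P).
  have e'e' : e' * e' = e'.
    by rewrite -[RHS]mul1r -eD mulrDl ee' add0r.
  by rewrite mulrA -(mulrA e' P e) Pe !mulrA e'e'.
rewrite mulrDl mul1r mulrDr mulr1 E1 mulrBl mul1r mulrBr mulr1 E2 opprB.
set a := e' * P; set b := e * P; set c := P * P.
rewrite [1 - b + _]addrC addrACA [1 + a + _]addrACA subrr addr0.
rewrite (addrC b) [X in _ + X]addrACA subrr addr0 (addrC (e * c)) addrACA.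
rewrite (addrC (e' * c)).
by rewrite -mulrDl eD mul1r.
Qed.
End Checkerboard.

(** * The two-step matrix of a path and its block on the rows of one parity *)

Section PathMatrices.
Variables (K : comNzRingType).

Definition path_adj (a b : nat) : bool := (a == b.+1) || (b == a.+1).

Definition path_mx p : 'M[K]_p := \matrix_(i, j) (path_adj i j)%:R.

Definition parity_mx p (c : bool) : 'M[K]_p :=
  \matrix_(i, j) ((i == j) && (odd i == c))%:R.

Definition parity_rows m p (c : bool) : 'M[K]_(m, p) :=
  \matrix_(i, r) (r == i.*2 + c :> nat)%N%:R.

Lemma parity_mxE p c (B : 'M[K]_p) i j :
  (parity_mx p c *m B) i j = (odd i == c)%:R * B i j.
Proof.
rewrite mxE (bigD1 i) //= mxE eqxx big1 ?addr0 // => k nk.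
by rewrite mxE eq_sym (negbTE nk) mul0r.
Qed.

Lemma mx_parityE p c (B : 'M[K]_p) i j :
  (B *m parity_mx p c) i j = B i j * (odd j == c)%:R.
Proof.
rewrite mxE (bigD1 j) //= mxE eqxx big1 ?addr0 // => k nk.
by rewrite mxE (negbTE nk) mulr0.
Qed.

Lemma parity_mxD p c : parity_mx p c + parity_mx p (~~ c) = 1 :> 'M[K]_p.
Proof.
apply/matrixP => i j; rewrite !mxE; case: (i == j); rewrite /= ?addr0 //.
by case: (odd i) c => [] []; rewrite /= ?addr0 ?add0r.
Qed.

Lemma parity_mx_idem p c : parity_mx p c * parity_mx p c = parity_mx p c.
Proof.
apply/matrixP => i j; rewrite [LHS]parity_mxE !mxE.
by case: eqP => _; case: eqP => _; rewrite /= ?mulr0 ?mul0r ?mulr1.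
Qed.

Lemma parity_mx_orth p c : parity_mx p c * parity_mx p (~~ c) = 0.
Proof.
apply/matrixP => i j; rewrite [LHS]parity_mxE !mxE.
by case: (odd i) c => [] []; rewrite /= ?andbF ?mulr0 ?mul0r.
Qed.

Lemma parity_mx_orthC p c : parity_mx p (~~ c) * parity_mx p c = 0.
Proof. by rewrite -{2}(negbK c) parity_mx_orth. Qed.

Lemma path_mx_parity p c : path_mx p * parity_mx p c = parity_mx p (~~ c) * path_mx p.
Proof.
apply/matrixP => i j; rewrite [LHS]mx_parityE [RHS]parity_mxE mxE mulrC.
case h : (path_adj i j); rewrite ?mulr0 ?mulr1 //; congr (_ %:R).
by move: h => /orP[] /eqP->; case: c; rewrite /= ?eqbF_neg; case: odd.
Qed.

Lemma path_mulmx_parity p c :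
  path_mx p *m parity_mx p c = parity_mx p (~~ c) *m path_mx p.
Proof. exact: path_mx_parity. Qed.

Definition half_step p c : 'M[K]_p := 1 + parity_mx p c * path_mx p.

Definition two_step p c := half_step p c * half_step p (~~ c).

Definition two_step_inv_mx p c : 'M[K]_p :=
  (1 - parity_mx p (~~ c) * path_mx p) * (1 - parity_mx p c * path_mx p).

Lemma two_stepK p c : two_step p c * two_step_inv_mx p c = 1.
Proof.
apply: two_step_inv; rewrite ?parity_mx_orth ?path_mx_parity ?negbK //.
exact: parity_mx_orthC.
Qed.

Lemma two_stepVK p c : two_step_inv_mx p c * two_step p c = 1.
Proof.
apply: two_step_inv'; rewrite ?parity_mx_orth ?path_mx_parity ?negbK //.
exact: parity_mx_orthC.
Qed.

Lemma two_step_sum p c : two_step p c + two_step_inv_mx p c = 2%:R + path_mx p * path_mx p.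
Proof.
apply: two_stepD; rewrite ?parity_mx_orth ?path_mx_parity ?parity_mxD ?parity_mx_idem ?negbK //.
Qed.

Lemma cheb_two_step p c n :
  cheb (2%:R + path_mx p * path_mx p) n = two_step p c ^+ n + two_step_inv_mx p c ^+ n.
Proof. by rewrite -(two_step_sum p c) cheb_inv ?two_stepK ?two_stepVK. Qed.

(** No hop ends where another one starts, so all products of two elementary matrices vanish and the
    product of the factors becomes a sum. *)
Lemma hop_mx_orth p (c : bool) (L : seq ('I_p * 'I_p * K)) :
  all (fun o : 'I_p * 'I_p * K => (odd o.1.1 == c) && (odd o.1.2 == ~~ c)) L ->
  hop_mx L = 1%:M + \sum_(o <- L) o.2 *: delta_mx o.1.1 o.1.2.
Proof.
elim: L => [|[[a b] w] L IH] /=; first by rewrite big_nil addr0.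
move=> /andP[/andP[/eqP oa /eqP ob] allL]; rewrite IH // big_cons /=.
rewrite mulmxDl mul1mx mulmxDr mulmx1 -scalemxAl.
rewrite [delta_mx a b *m _](_ : _ = 0) ?scaler0 ?addr0; last first.
  rewrite mulmx_sumr big1_seq // => -[[a' b'] w'] /= /(allP allL) /= /andP[/eqP oa' _].
  rewrite -scalemxAr mul_delta_mx_cond; case: eqP => [e|_]; rewrite ?scaler0 //.
  by move: ob; rewrite e oa'; case: (c).
by rewrite -addrA [X in _ = _ + X]addrC addrA.
Qed.

Lemma hop_mx_column p c : hop_mx (column_hops K p c) = half_step p c.
Proof.
rewrite (@hop_mx_orth p c); last first.
  apply/allP => _ /mapP[r + ->]; rewrite mem_filter => /andP[rp _].
  by rewrite /column_hop; case: ifP => h; rewrite /= modn_small //= ?h;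
    case: (odd r) (c) h => [] [].
congr (_ + _); rewrite /column_hops big_map big_filter big_enum_cond /=.
apply/matrixP => i j; rewrite summxE [RHS]parity_mxE mxE.
have term (r : 'I_p) : (r.+1 < p)%N ->
    ((column_hop K c r).2 *: delta_mx (column_hop K c r).1.1 (column_hop K c r).1.2) i j
    = (odd i == c)%:R * (if j == i.+1 :> nat then (r == i)%:R
                         else if i == j.+1 :> nat then (r == j)%:R else 0).
  move=> rp; rewrite /column_hop; case: ifP => [/eqP oc|/negbT oc]; rewrite /= scale1r mxE eq_ordS //.
    have [->|nri] := eqVneq i r.
      rewrite oc eqxx mul1r; case: eqP => //= _; case: eqP => // e.
      by have [rj|//] := eqVneq r j; move: e; rewrite rj; lia.
    rewrite andFb !mulr0n; case: (eqVneq (j : nat) i.+1) => [e|_]; first by rewrite mulr0.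
    case: (eqVneq (i : nat) j.+1) => [e|_]; last by rewrite mulr0.
    have [rj|_] := eqVneq r j; last by rewrite mulr0.
    by rewrite e -rj /= oc; case: (c); rewrite mul0r.
  have [->|nrj] := eqVneq j r.
    rewrite andbT; have [e|_] := eqVneq (i : nat) r.+1.
      have -> : r == i.+1 :> nat = false by lia.
      by rewrite e /= (_ : ~~ odd r == c) ?mulr1 //; case: (odd r) (c) oc => [] [].
    have [e|_] := eqVneq (r : nat) i.+1; last by rewrite mulr0.
    have [ri|_] := eqVneq r i; last by rewrite mulr0.
    by move: e; rewrite ri; lia.
  rewrite andbF; have [e|_] := eqVneq (j : nat) i.+1.
    have [ri|_] := eqVneq r i; last by rewrite mulr0.
    by rewrite -ri (negbTE oc) mul0r.
  by rewrite if_same mulr0.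
rewrite (eq_bigr _ term) -mulr_sumr; congr (_ * _); rewrite /path_adj.
have [ij|nij] := eqVneq (j : nat) i.+1.
  have ip : (i.+1 < p)%N by rewrite -ij.
  rewrite orbT (bigD1 i) //= eqxx big1 ?addr0 // => r /andP[_ nr].
  by rewrite (negbTE nr).
have [ji|nji] := eqVneq (i : nat) j.+1; last by rewrite big1.
have jp : (j.+1 < p)%N by rewrite -ji.
rewrite (bigD1 j) //= eqxx big1 ?addr0 // => r /andP[_ nr].
by rewrite (negbTE nr).
Qed.

Lemma hop_mx_weight p (f : 'I_p -> nat) :
  hop_mx (weight_hops K f) = \matrix_(i, j) ((i == j)%:R * (f i)%:R).
Proof.
suff H s : uniq s -> hop_mx [seq (r, r, (f r)%:R - 1 : K) | r <- s] =
    \matrix_(i, j) ((i == j)%:R * (if i \in s then (f i)%:R else 1)).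
  by rewrite /weight_hops H ?enum_uniq //; apply/matrixP => i j; rewrite !mxE mem_enum.
elim: s => [_|r s IH /= /andP[rs us]].
  by apply/matrixP => i j; rewrite !mxE mulr1.
rewrite IH // mulmxDl mul1mx -scalemxAl; apply/matrixP => i j; rewrite !mxE in_cons.
have -> : \sum_k (delta_mx r r : 'M[K]_p) i k *
    (\matrix_(i0, j0) ((i0 == j0)%:R * (if i0 \in s then (f i0)%:R else 1)) : 'M[K]_p) k j
    = (i == r)%:R * (r == j)%:R.
  rewrite (bigD1 r) //= big1 ?addr0 => [|k nk]; last first.
    by rewrite [delta_mx _ _ _ _]mxE (negbTE nk) andbF mul0r.
  by rewrite !mxE eqxx andbT (negbTE rs) mulr1.
have [->|nir] := eqVneq i r; last by rewrite mul0r mulr0 addr0.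
by rewrite (negbTE rs) /= mul1r mulr1 mulrBl mul1r addrC subrK mulrC.
Qed.

(** Says that exactly [m] of the [p] rows, numbered from 0, have parity [c], in the cases that
    occur: p = 2m, or p = 2m - 1 with the even rows. *)
Definition parity_dim m p (c : bool) :=
  (p == m.*2) || [&& p == m.*2.-1, ~~ c & 0 < m]%N.

Lemma parity_row_subproof m p c (h : parity_dim m p c) (i : 'I_m) : (i.*2 + c < p)%N.
Proof.
have := ltn_ord i; case/orP: h => [/eqP->|/and3P[/eqP-> /negbTE-> m0]]; last by lia.
by case: c; lia.
Qed.

Definition parity_row m p c (h : parity_dim m p c) (i : 'I_m) : 'I_p :=
  Ordinal (parity_row_subproof h i).

Section ParityRows.
Variables (m p : nat) (c : bool).
Hypothesis h : parity_dim m p c.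
Local Notation x := (parity_row h).
Local Notation J := (parity_rows m p c).

Lemma parity_row_inj : injective x.
Proof. by move=> i j /(congr1 (@nat_of_ord _)) /= e; apply: ord_inj; lia. Qed.

Lemma odd_parity_row i : odd (x i) = c.
Proof. by rewrite /= oddD odd_double oddb. Qed.

Lemma parity_rowP (r : 'I_p) : odd r = c -> exists i, r = x i.
Proof.
move=> oc; have rm : (r./2 < m)%N.
  have := ltn_ord r; have := odd_double_half r; rewrite oc.
  by case/orP: h => [/eqP|/and3P[/eqP]]; case: (c); lia.
by exists (Ordinal rm); apply: ord_inj; rewrite /= -oc addnC odd_double_half.
Qed.

Lemma parity_rowsE i r : J i r = (r == x i)%:R.
Proof. by rewrite mxE. Qed.

Lemma parity_rows_mul (B : 'M[K]_p) i r : (J *m B) i r = B (x i) r.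
Proof.
rewrite mxE (bigD1 (x i)) //= parity_rowsE eqxx mul1r big1 ?addr0 // => k nk.
by rewrite parity_rowsE (negbTE nk) mul0r.
Qed.

Lemma parity_rows_mxsub (B : 'M[K]_p) : J *m B *m J^T = mxsub x x B.
Proof.
apply/matrixP => i j; rewrite mxE (bigD1 (x j)) //= parity_rows_mul !mxE.
rewrite eqxx mulr1 big1 ?addr0 // => k nk.
by rewrite [J^T _ _]mxE parity_rowsE (negbTE nk) mulr0.
Qed.

Lemma parity_rows_orth : J *m J^T = 1%:M.
Proof.
rewrite -[J in J *m _]mulmx1 parity_rows_mxsub; apply/matrixP => i j.
by rewrite !mxE (inj_eq parity_row_inj).
Qed.

Lemma parity_rows_proj : J^T *m J = parity_mx p c.
Proof.
apply/matrixP => r s; rewrite !mxE; have [or|nor] := eqVneq (odd r) c; last first.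
  rewrite andbF big1 // => i _; rewrite [J^T _ _]mxE parity_rowsE.
  by case: eqP => [e|_]; rewrite ?mul0r //; move: nor; rewrite e odd_parity_row eqxx.
have [i ri] := parity_rowP or; rewrite (bigD1 i) //= big1 => [|k nk]; last first.
  by rewrite [J^T _ _]mxE parity_rowsE ri (inj_eq parity_row_inj) eq_sym (negbTE nk) mul0r.
by rewrite [J^T _ _]mxE !parity_rowsE ri eqxx mul1r addr0 andbT eq_sym.
Qed.

Lemma parity_rows_parity : J *m parity_mx p c = J.
Proof. by rewrite -parity_rows_proj mulmxA parity_rows_orth mul1mx. Qed.

Lemma parity_rows_parityC : J *m parity_mx p (~~ c) = 0.
Proof. by rewrite -parity_rows_parity -mulmxA [X in _ *m X]parity_mx_orth mulmx0. Qed.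

Lemma parity_parity_rowsT : parity_mx p c *m J^T = J^T.
Proof. by rewrite -parity_rows_proj -mulmxA parity_rows_orth mulmx1. Qed.

(** P exchanges the parities, so P P preserves them and the selection of rows intertwines it with
    its block. *)
Lemma parity_rows_sqr (Q := 2%:R + path_mx p * path_mx p) : J *m Q = (J *m Q *m J^T) *m J.
Proof.
rewrite -!mulmxA parity_rows_proj -{1}parity_rows_parity -mulmxA; congr (_ *m _).
rewrite /Q [LHS]mulrDr [RHS]mulrDl !mulr2n mulrDr mulrDl mulr1 mul1r; congr (_ + _).
by rewrite -[RHS]mulrA path_mx_parity [RHS]mulrA path_mx_parity negbK mulrA.
Qed.

Lemma parity_path_parity (d : bool) : parity_mx p d * path_mx p * parity_mx p d = 0.
Proof. by rewrite -mulrA path_mx_parity mulrA parity_mx_orth mul0r. Qed.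

Lemma half_parity_rowsT : half_step p (~~ c) *m J^T = J^T + path_mx p *m J^T.
Proof.
rewrite mulmxDl [1 *m _]mul1mx; congr (_ + _).
by rewrite -[parity_mx p (~~ c) * _]path_mx_parity -[_ * _ *m _]mulmxA parity_parity_rowsT.
Qed.

Lemma parity_rows_half' : J *m half_step p c = J + J *m path_mx p.
Proof.
by rewrite mulmxDr [J *m 1]mulmx1 [J *m (_ * _)]mulmxA parity_rows_parity.
Qed.

Let u n := J *m (two_step p c ^+ n) *m J^T.
Let v n := J *m (two_step_inv_mx p c ^+ n.+1) *m J^T.
Let G := J *m (2%:R + path_mx p * path_mx p) *m J^T.

Lemma cheb_parity_rows n : cheb G n = J *m cheb (2%:R + path_mx p * path_mx p) n *m J^T.
Proof.
by rewrite (mulmx_cheb n parity_rows_sqr) -(mulmxA _ J) parity_rows_orth mulmx1.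
Qed.

Lemma parity_rows_path : J *m path_mx p *m J^T = 0.
Proof.
rewrite -parity_parity_rowsT mulmxA -(mulmxA J) [path_mx p *m _]path_mx_parity.
by rewrite -mulmxE mulmxA parity_rows_parityC !mul0mx.
Qed.

Lemma inv_block : J *m two_step_inv_mx p c *m J^T = 1%:M.
Proof.
rewrite /two_step_inv_mx -!mulmxE (mulmxA J) (mulmxBr J) [J *m 1]mulmx1 (mulmxA J).
rewrite parity_rows_parityC mul0mx subr0 (mulmxBr J) [J *m 1]mulmx1 (mulmxA J).
by rewrite parity_rows_parity mulmxBl parity_rows_orth parity_rows_path subr0.
Qed.

(** Multiply B^2 = (B + B') B - 1 by a power of B; the sum B + B' passes through [J] as the block
    [G]. *)
Lemma block_rec n (B B' : 'M[K]_p) : B * B' = 1 ->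
  B + B' = 2%:R + path_mx p * path_mx p ->
  J *m (B ^+ n.+2) *m J^T = G *m (J *m (B ^+ n.+1) *m J^T) - J *m (B ^+ n) *m J^T.
Proof.
move=> BB' BD; have QJ : J *m (B + B') = G *m J by rewrite BD; exact: parity_rows_sqr.
have -> : B ^+ n.+2 = (B + B') *m B ^+ n.+1 - B ^+ n.
  rewrite [(_ + _) *m _]mulrDl -exprS (exprS B n) (mulrA B').
  have -> : B' * B = 1 by apply: mulmx1C.
  by rewrite mul1r addrK.
by rewrite mulmxBr mulmxBl (mulmxA J) QJ !mulmxA.
Qed.

(** Both sequences of blocks satisfy x_(k+2) = G x_(k+1) - x_k and start with 1 and G - 1. So on the
    rows of parity [c] the inverse power n + 1 of the two-step matrix looks like its power n. *)
Lemma inv_block_shift n : v n = u n.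
Proof.
have u0 : u 0 = 1%:M by rewrite /u expr0 [J *m 1]mulmx1 parity_rows_orth.
have v0 : v 0 = 1%:M by rewrite /v expr1 inv_block.
elim/nat_ind2: n => [||n IH0 IH1]; first by rewrite u0 v0.
  rewrite /v (@block_rec 0 _ (two_step p c)) ?two_stepVK ?(addrC (two_step_inv_mx _ _)) ?two_step_sum //.
  rewrite -/(v 0) v0 -/(u 0) u0 mulmx1 /u expr1 /G -(two_step_sum p c) mulmxDr mulmxDl.
  by rewrite inv_block addrK.
rewrite /v (@block_rec n.+1 _ (two_step p c)) ?two_stepVK ?(addrC (two_step_inv_mx _ _)) ?two_step_sum //.
by rewrite -/(v n.+1) -/(v n) IH0 IH1 /u (block_rec n (two_stepK _ _) (two_step_sum _ _)).
Qed.

(** Doubling the weights adds to the power n + 1 the block of the power n, which by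
    [inv_block_shift] is that of the inverse power n + 1. The two powers sum to the Chebyshev
    value. *)
Lemma weighted_block n :
  J *m (two_step p c ^+ n * (half_step p c * (1 + parity_mx p c) * half_step p (~~ c))) *m J^T
  = cheb G n.+1.
Proof.
rewrite cheb_parity_rows (cheb_two_step p c n.+1) mulmxDr mulmxDl -/(v n) -/(u n.+1).
rewrite inv_block_shift.
have -> : half_step p c * (1 + parity_mx p c) * half_step p (~~ c) =
    two_step p c + parity_mx p c.
  have E1 : half_step p c * parity_mx p c = parity_mx p c.
    by rewrite mulrDl mul1r parity_path_parity addr0.
  have E2 : parity_mx p c * half_step p (~~ c) = parity_mx p c.
    by rewrite mulrDr mulr1 mulrA parity_mx_orth mul0r addr0.
  by rewrite (mulrDr (half_step p c) 1) E1 mulr1 (mulrDl (half_step p c)) E2.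
rewrite mulrDr -exprSr mulmxDr mulmxDl; congr (_ + _).
by rewrite -!mulmxE (mulmxA J) -(mulmxA _ (parity_mx p c)) parity_parity_rowsT.
Qed.

(** After expansion the terms with a single P change the parity and vanish; in P F P the factor F
    acts on rows of the other parity, where it is 1. *)
Lemma weighted_block1 (F : 'M[K]_p) :
  (forall d, F * parity_mx p d = parity_mx p d * F) -> F * parity_mx p (~~ c) = parity_mx p (~~ c) ->
  J *m (half_step p c * F * half_step p (~~ c)) *m J^T = J *m (F + path_mx p * path_mx p) *m J^T.
Proof.
move=> Fc F1; rewrite -!mulmxE.
have FP : F *m (path_mx p *m J^T) = path_mx p *m J^T.
  have e : path_mx p *m J^T = parity_mx p (~~ c) *m (path_mx p *m J^T).
    by rewrite mulmxA -path_mulmx_parity -mulmxA parity_parity_rowsT.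
  by rewrite {1}e mulmxA [F *m _]F1 -e.
have JPF : J *m path_mx p *m (F *m J^T) = 0.
  rewrite -parity_parity_rowsT (mulmxA F) [F *m _]Fc -mulmxE -!mulmxA (mulmxA (path_mx p)).
  by rewrite path_mulmx_parity -!mulmxA mulmxA parity_rows_parityC mul0mx.
rewrite (mulmxA J) (mulmxA J) parity_rows_half' -!mulmxA half_parity_rowsT.
rewrite (mulmxDr F) FP (mulmxDl J) !(mulmxDr J) (mulmxDr (J *m path_mx p)) JPF add0r.
by rewrite (mulmxA J (path_mx p)) parity_rows_path addr0 mulmxDl mulmxDr !mulmxA.
Qed.

End ParityRows.

End PathMatrices.

(** * The planar board *)

Section Tri.
Variable K : comNzRingType.

Definition tri_mx m : 'M[K]_m :=
  \matrix_(i, j) (if i == j then if i.+1 == m then 3%:R else 4%:R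
                  else (path_adj i j)%:R).

Lemma sum_path_adj p r (F : nat -> K) : (r < p)%N ->
  \sum_(k < p) (path_adj r k)%:R * F k =
  (0 < r)%N%:R * F r.-1 + (r.+1 < p)%N%:R * F r.+1.
Proof.
move=> rp; under eq_bigr => k _.
  have -> : (path_adj r k)%:R = (r == k.+1)%:R + (k == r.+1 :> nat)%:R :> K.
    rewrite /path_adj; have [->|_] := eqVneq r k.+1; last by rewrite add0r.
    by have -> : k == k.+2 :> nat = false; [lia | rewrite orTb addr0].
  rewrite mulrDl; over.
rewrite big_split /=; congr (_ + _).
  case: r rp => [|r] rp; first by rewrite mul0r big1 // => k _; rewrite mul0r.
  rewrite (bigD1 (Ordinal (ltnW rp))) //= eqxx big1 ?addr0 // => k nk.
  rewrite (_ : r.+1 == k.+1 = false) ?mul0r //; apply: contraNF nk => /eqP[e].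
  by apply/eqP/ord_inj.
have [rp1|rp1] := boolP (r.+1 < p)%N; last first.
  rewrite mul0r big1 // => k _; have := ltn_ord k.
  by have [->|_] := eqVneq (k : nat) r.+1; rewrite ?mul0r // (negbTE rp1).
rewrite (bigD1 (Ordinal rp1)) //= eqxx big1 ?addr0 // => k nk.
rewrite (_ : k == r.+1 :> nat = false) ?mul0r //; apply: contraNF nk => /eqP e.
by apply/eqP/ord_inj.
Qed.

Lemma path_sqrE p (r s : 'I_p) : (path_mx K p * path_mx K p) r s =
  (0 < r)%N%:R * (path_adj r.-1 s)%:R + (r.+1 < p)%N%:R * (path_adj r.+1 s)%:R.
Proof.
rewrite mxE -(sum_path_adj (fun k => (path_adj k s)%:R) (ltn_ord r)).
by apply: eq_bigr => k _; rewrite !mxE.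
Qed.

Lemma parity_dim_even m : parity_dim m (2 * m)%N true.
Proof. by apply/orP; left; rewrite mul2n. Qed.

Lemma parity_dim_odd m : (0 < m)%N -> parity_dim m (2 * m - 1)%N false.
Proof. by move=> m0; apply/orP; right; rewrite mul2n subn1 eqxx. Qed.

Lemma natr_mx2 p (i j : 'I_p) : (2%:R : 'M[K]_p) i j = (2 * (i == j))%N%:R.
Proof. by rewrite mulr2n !mxE -natrD addnn mul2n. Qed.

(** Every selected row has two neighbours on the path except the bottom one, which has a single
    neighbour; hence the corner entry 2 + 1 = 3. *)
Lemma tri_even m (p := (2 * m)%N) :
  parity_rows K m p true *m (2%:R + path_mx K p * path_mx K p) *m (parity_rows K m p true)^T
  = tri_mx m.
Proof.
rewrite (parity_rows_mxsub (parity_dim_even m)); apply/matrixP => i j.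
rewrite [LHS]mxE [LHS]mxE path_sqrE natr_mx2 (inj_eq (@parity_row_inj _ _ _ _)) /=.
have -> : (i.*2 + true)%N = i.*2.+1 by lia.
have -> : (j.*2 + true)%N = j.*2.+1 by lia.
rewrite /= mul1r -!natrM -!natrD mxE.
have im := ltn_ord i; have jm := ltn_ord j.
have [->|nij] := eqVneq i j.
  by case: eqP => e; congr (_%:R); rewrite /path_adj /p; lia.
have nij' : (i : nat) != j by [].
by congr (_%:R); rewrite /path_adj /p; lia.
Qed.

(** For m > 1 the weight 3 makes up for the missing neighbour of the top row, and the bottom row
    yields 2 + 1. For m = 1 the only entry is that weight. *)
Lemma tri_odd m (p := (2 * m - 1)%N) (F : 'M[K]_p) : (0 < m)%N ->
  (forall i j, F i j = ((i == j) * (if odd i then 1 else if i == 0 :> nat then 3 else 2))%N%:R) ->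
  parity_rows K m p false *m (F + path_mx K p * path_mx K p) *m (parity_rows K m p false)^T
  = tri_mx m.
Proof.
move=> m0 FE; rewrite (parity_rows_mxsub (parity_dim_odd m0)); apply/matrixP => i j.
rewrite [LHS]mxE [LHS]mxE path_sqrE FE (inj_eq (@parity_row_inj _ _ _ _)) odd_parity_row /=.
rewrite !addn0 -!natrM -!natrD mxE.
have im := ltn_ord i; have jm := ltn_ord j.
have [->|nij] := eqVneq i j.
  rewrite double_eq0.
  by case: (eqVneq (j.+1) m) => e; case: (eqVneq (j : nat) 0%N) => j0; congr (_%:R);
    rewrite /path_adj /p; lia.
have nij' : (i : nat) != j by [].
by congr (_%:R); rewrite /path_adj /p mul0n add0n; lia.
Qed.

Lemma hop_mx_grid_const p (c : bool) k u : (forall j (r : 'I_p), (j < k.*2)%N -> u j r = 1%N) ->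
  hop_mx (grid_hops K c k.*2 u) = two_step K p c ^+ k.
Proof.
elim: k => [|k IH] u1; first by rewrite expr0.
have W j : (j < k.*2.+2)%N -> hop_mx (weight_hops K (u j)) = 1%:M.
  by move=> jk; rewrite hop_mx_weight; apply/matrixP => r s; rewrite !mxE u1 ?mulr1.
rewrite doubleS -addn2 /grid_hops iotaD map_cat flatten_cat /= cats0.
rewrite !hop_mx_cat -/(grid_hops _ _ _ _) IH => [|j r jk]; last by apply: u1; lia.
rewrite !hop_mx_column !W ?mulmx1; try lia.
by rewrite add0n /= odd_double addbF addbT exprSr.
Qed.

Lemma hop_mx_grid p (c : bool) k u : (forall j (r : 'I_p), j != k.*2 -> u j r = 1%N) ->
  hop_mx (grid_hops K c k.+1.*2 u) = two_step K p c ^+ k *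
    (half_step K p c * hop_mx (weight_hops K (u k.*2)) * half_step K p (~~ c)).
Proof.
move=> u1; rewrite doubleS -addn2 /grid_hops iotaD map_cat flatten_cat /= cats0.
rewrite !hop_mx_cat -/(grid_hops _ _ _ _) hop_mx_grid_const => [|j r jk]; last by apply: u1; lia.
rewrite !hop_mx_column !add0n /= odd_double addbF addbT.
have -> : hop_mx (weight_hops K (u k.*2.+1)) = 1%:M; last by rewrite mulmx1.
by rewrite hop_mx_weight; apply/matrixP => r s; rewrite !mxE u1 ?mulr1 //; lia.
Qed.

End Tri.

Lemma toggle0 p c : toggle c (set0 : {set 'I_p}) = [set r : 'I_p | odd r == c].
Proof. by apply/setP => r; rewrite !inE. Qed.

Lemma parity_row_imset m p c (h : parity_dim m p c) :
  parity_row h @: setT = [set r : 'I_p | odd r == c].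
Proof.
apply/setP => r; rewrite inE; apply/imsetP/eqP => [[i _ ->]|/(parity_rowP h)[i ->]].
  exact: odd_parity_row.
by exists i.
Qed.

Lemma parity_row_increasing m p c (h : parity_dim m p c) : increasing (parity_row h).
Proof. by move=> i j /= ij; rewrite ltn_add2r ltn_double. Qed.

Lemma last_edge_horizontal p q (a : nat) (j : 'I_q) (r : 'I_p) : (j.+1 < q)%N -> (0 < a <= p)%N ->
  (slot_edge (true, j, r) == last_edge p q a) = (j.+2 == q) && (r.+1 == a).
Proof.
move=> jq /andP[a0 ap]; apply/eqP/andP => [e|[/eqP jq2 /eqP ra]].
  have : (r, j) \in last_edge p q a by rewrite -e set21.
  by rewrite !inE /= => /orP[]; lia.
apply/setP => -[s k]; rewrite !inE !xpair_eqE /next_row ltn_eqF // eq_ordS // /=.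
rewrite -!(inj_eq (@ord_inj _)) /=; have := ltn_ord k; lia.
Qed.

Lemma last_edge_vertical p q (a : nat) (j : 'I_q) (r : 'I_p) : (r.+1 < p)%N ->
  (slot_edge (false, j, r) == last_edge p q a) = false.
Proof.
move=> rp; apply/eqP => e.
have : (r, j) \in last_edge p q a by rewrite -e set21.
have : (ordS r, j) \in last_edge p q a by rewrite -e set22.
by rewrite !inE /= modn_small //; lia.
Qed.

(** The row p - 2h, counted from 1, has index p - 2h - 1, of parity opposite to p. Given the parity,
    the inequality only excludes row 0 of an odd board, which has weight 3. *)
Definition last_weight (p q : nat) (j : nat) (r : 'I_p) : nat :=
  if j.+2 == q then
    if (p <= r + 2 * p./2)%N && (odd r == ~~ odd p) then 2
    else if odd p && (r == 0 :> nat) then 3 else 1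
  else 1.

Lemma mobius_weight_vertical p q (j : 'I_q) (r : 'I_p) : (r.+1 < p)%N ->
  mobius_weight (slot_edge (false, j, r)) = 1%N.
Proof.
move=> rp; rewrite /mobius_weight last_edge_vertical // andbF.
by case: existsP => // -[h]; rewrite last_edge_vertical.
Qed.

Lemma mobius_weight_horizontal p q (j : 'I_q) (r : 'I_p) : (j.+1 < q)%N ->
  mobius_weight (slot_edge (true, j, r)) = last_weight q j r.
Proof.
move=> jq; rewrite /mobius_weight /last_weight; have rp := ltn_ord r.
have p2 := odd_double_half p.
have hp (h : 'I_(p./2)) : (0 < p - 2 * h <= p)%N by have := ltn_ord h; lia.
rewrite last_edge_horizontal //; last by rewrite (leq_ltn_trans _ rp).
under eq_existsb => h do rewrite last_edge_horizontal //.
have [jq2|_] /= := eqVneq; last first.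
  by case: existsP => [[]//|_]; rewrite andbF.
rewrite eqSS; congr (if _ then _ else _).
apply/existsP/andP => [[h /eqP e]|[rh /eqP ro]].
  have := ltn_ord h; move: e p2; case: (odd p); case: (odd r) (odd_double_half r) => /= *; lia.
have hl : ((p - r.+1)./2 < p./2)%N by lia.
exists (Ordinal hl); apply/eqP => /=.
by move: p2 rp rh ro; case: (odd p); case: (odd r) (odd_double_half r) => //= *; lia.
Qed.

Lemma grid_hops_near (K : comNzRingType) p (c : bool) q u :
  all (@hop_near K p) (grid_hops K c q u).
Proof.
rewrite /grid_hops; elim: (iota 0 q) => [//|j s IH] /=.
rewrite !all_cat IH column_hops_near andbT /=.
by apply/allP => _ /mapP[r _ ->]; rewrite /hop_near /= leqnSn.
Qed.

Lemma last_weight_other p q j (r : 'I_p) : j.+2 != q -> last_weight q j r = 1%N.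
Proof. by rewrite /last_weight => /negbTE->. Qed.

(** The number of columns is even, so the empty set of dominoes at either end is toggled into the
    same set, all rows of parity [c]. *)
Lemma planar_hop_count p k (c : bool) : c = ~~ odd p ->
  (mobius_weighted_tilings p k.+1.*2)%:R =
  hop_count (grid_hops int c k.+1.*2 (@last_weight p k.+1.*2))
    [set r : 'I_p | odd r == c] [set r : 'I_p | odd r == c].
Proof.
move=> pc; rewrite doubleS /mobius_weighted_tilings -[@grid_adj _ _]/(@tiling_adj _ _ false).
rewrite (@tilings_hop_count int _ _ _ _ (@last_weight p k.*2.+2) c) //; first last.
- move=> j r jq; rewrite /last_weight; case: (eqVneq j.+2) => // -[->].
  rewrite odd_double addbF => ro; rewrite -pc (negbTE ro) andbF.
  case: ifP => // /andP[op /eqP r0]; move: ro.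
  by rewrite pc op r0.
- by move=> j r jq; apply: mobius_weight_horizontal.
- by move=> j r; apply: mobius_weight_vertical.
rewrite (big_pred1 set0) // -doubleS odd_double addbF.
rewrite (_ : [set r | _] = set0); last by apply/setP => r; rewrite !inE.
by rewrite toggle0.
Qed.

Lemma planar_det m p k (c : bool) (h : parity_dim m p c) : c = ~~ odd p ->
  (mobius_weighted_tilings p k.+1.*2)%:R =
  \det (parity_rows int m p c *m
    (two_step int p c ^+ k * (half_step int p c *
      hop_mx (weight_hops int (@last_weight p k.+1.*2 k.*2)) * half_step int p (~~ c)))
    *m (parity_rows int m p c)^T).
Proof.
move=> pc; rewrite (planar_hop_count _ pc) -(parity_row_imset h) -det_hop_mx; first last.
- exact: parity_row_increasing.
- exact: parity_row_increasing.
- exact: grid_hops_near.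
rewrite hop_mx_grid => [|j r nj]; last by rewrite last_weight_other // doubleS !eqSS.
by rewrite -(parity_rows_mxsub h).
Qed.

Lemma planar_tilings_even m k :
  (mobius_weighted_tilings (2 * m) k.+1.*2)%:R = \det (cheb (tri_mx int m) k.+1).
Proof.
rewrite (planar_det _ (parity_dim_even m)) ?oddM //; congr (\det _).
rewrite (_ : hop_mx (weight_hops _ _) = 1 + parity_mx _ _ true).
  by rewrite (weighted_block _ (parity_dim_even m)) tri_even.
rewrite hop_mx_weight; apply/matrixP => r s; rewrite !mxE /last_weight doubleS eqxx.
rewrite oddM /= (_ : (2 * m <= r + 2 * (2 * m)./2)%N); last by lia.
by case: (r == s); case: (odd r); rewrite /= ?mul1r ?mul0r ?addr0 // -natrD.
Qed.

Lemma planar_tilings_odd m : (0 < m)%N ->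
  (mobius_weighted_tilings (2 * m - 1) 2)%:R = \det (tri_mx int m).
Proof.
move=> m0; have op : odd (2 * m - 1) by rewrite oddB ?oddM //; lia.
rewrite (planar_det 0 (parity_dim_odd m0)) ?op //; congr (\det _).
set F := hop_mx _; have FE i j : F i j =
    ((i == j) * (if odd i then 1 else if i == 0 :> nat then 3 else 2))%N%:R.
  rewrite /F hop_mx_weight mxE -natrM; congr ((_ * _)%N%:R).
  rewrite /last_weight /= op /=.
  have -> : (2 * m - 1 <= i + 2 * (2 * m - 1)./2)%N = (0 < i)%N by lia.
  by case: (nat_of_ord i) => [|[|i']] //=; case: (odd i').
rewrite expr0 mul1r (weighted_block1 (parity_dim_odd m0)).
- exact: (tri_odd m0).
- move=> d; apply/matrixP => i j; rewrite [LHS]mx_parityE [RHS]parity_mxE FE.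
  by have [->|_] := eqVneq i j; rewrite ?mulr0 ?mul0r // mulrC.
- apply/matrixP => i j; rewrite [LHS]mx_parityE FE !mxE.
  have [->|_] := eqVneq i j; last by rewrite mul0r.
  by case: (odd j); rewrite ?mulr1 ?mulr0.
Qed.

(** * The Moebius board *)

Section Halves.
Variables (K : comNzRingType) (m : nat).
Local Notation N := (m + m)%N.
Implicit Types (Y : 'M[K]_N) (s t : 'S_N) (A : {set 'I_N}).

Definition lhalf s (i : 'I_m) : 'I_N := s (lshift m i).
Definition rhalf s (i : 'I_m) : 'I_N := s (rshift m i).

(** A permutation encodes a splitting of the rows into two ordered halves; its sign makes the minor
    independent of the two orders. *)
Definition half_minor Y s : K := (-1) ^+ s * \det (mxsub (lhalf s) (rhalf s) Y).

Lemma lhalf_inj s : injective (lhalf s).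
Proof. by move=> i j /perm_inj/lshift_inj. Qed.

Lemma rhalf_inj s : injective (rhalf s).
Proof. by move=> i j /perm_inj/rshift_inj. Qed.

Lemma rhalf_imset s : rhalf s @: setT = ~: (lhalf s @: setT).
Proof.
apply/setP => r; rewrite inE; apply/imsetP/negP => [[i _ ->] /imsetP[j _ /perm_inj/eqP]|nl].
  by rewrite eq_sym eq_lrshift.
have := splitK (s^-1%g r); case: split => i /= e; last first.
  by exists i => //; rewrite /rhalf e permKV.
by case: nl; apply/imsetP; exists i => //; rewrite /lhalf e permKV.
Qed.

(** Passing from [t] to [s] permutes each half separately. The permutation matrix is block diagonal,
    and the determinants of its blocks multiply to the change of sign. *)
Lemma half_minor_eq Y s t : lhalf s @: setT = lhalf t @: setT ->
  half_minor Y s = half_minor Y t.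
Proof.
move=> st; pose b := (s * t^-1)%g; have bt x : t (b x) = s x by rewrite permM permKV.
pose Yt : 'M[K]_N := \matrix_(i, j) Y (t i) (t j).
pose B := perm_mx b : 'M[K]_N.
have imb i : exists j, b (lshift m i) = lshift m j.
  have : lhalf s i \in lhalf t @: setT by rewrite -st imset_f.
  by case/imsetP => j _ e; exists j; apply: (@perm_inj _ t); rewrite bt.
have ur0 : ursubmx B = 0.
  apply/matrixP => i j; rewrite !mxE; have [k ->] := imb i.
  by rewrite eq_lrshift.
have imbr i : exists j, b (rshift m i) = rshift m j.
  have : rhalf s i \in rhalf t @: setT by rewrite rhalf_imset -st -rhalf_imset imset_f.
  by case/imsetP => j _ e; exists j; apply: (@perm_inj _ t); rewrite bt.
have dl0 : dlsubmx B = 0.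
  apply/matrixP => i j; rewrite !mxE; have [k ->] := imbr i.
  by rewrite eq_rlshift.
have BE : B = block_mx (ulsubmx B) 0 0 (drsubmx B) by rewrite -[LHS]submxK ur0 dl0.
have detB : \det (ulsubmx B) * \det (drsubmx B) = (-1) ^+ b.
  by rewrite -det_perm -/B [in RHS]BE det_ublock.
have E1 : mxsub (lhalf t) (rhalf t) Y = ursubmx Yt by apply/matrixP => i j; rewrite !mxE.
have E2 : mxsub (lhalf s) (rhalf s) Y = ursubmx (B *m Yt *m B^T).
  apply/matrixP => i j; rewrite tr_perm_mx -row_permE -col_permE !mxE !bt //.
rewrite /half_minor E1 E2 BE tr_block_mx !trmx0 -[Yt]submxK !mulmx_block !block_mxKur.
rewrite !mul0mx !mulmx0 !addr0 !add0r !det_mulmx det_tr.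
rewrite -(mulrA (\det _)) (mulrC _ (\det (drsubmx B))) !mulrA -(mulrA _ (\det (ulsubmx B))) detB.
have -> : s = (b * t)%g by rewrite /b mulgKV.
by rewrite odd_permM -signr_addb addbAC addbb.
Qed.

(** Each choice of half of the rows is counted with all orderings of both halves. This common
    multiplicity is never computed, only shown to be positive and the same for all sets. *)
Definition half_sum Y : K := \sum_(s : 'S_N) half_minor Y s.

Let pairing (t : 'S_m) (Z : 'I_m -> 'M[K]_N) :=
  \sum_(s : 'S_N) (-1) ^+ s * \prod_(i < m) Z i (lhalf s i) (rhalf s (t i)).

Lemma half_sumE Y : half_sum Y = \sum_(t : 'S_m) (-1) ^+ t * pairing t (fun=> Y).
Proof.
rewrite /half_sum; under eq_bigr => s _ do rewrite /half_minor /determinant mulr_sumr.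
rewrite exchange_big; apply: eq_bigr => t _; rewrite mulr_sumr; apply: eq_bigr => s _.
by rewrite mulrCA; congr (_ * (_ * _)); apply: eq_bigr => i _; rewrite mxE.
Qed.

(** Composing [s] with the transposition of the two points paired in factor [i] changes the sign and
    transposes the matrix in that factor. Hence putting Y - Y^T there doubles the sum. *)
Lemma pairing_antisym (t : 'S_m) Y (r : seq 'I_m) : uniq r ->
  pairing t (fun i => if i \in r then Y - Y^T else Y) = pairing t (fun=> Y) *+ 2 ^ size r.
Proof.
elim: r => [_|i r IH /= /andP[ir ur]]; first by rewrite mulr1n.
pose Z (Yi : 'M[K]_N) j := if j == i then Yi else if j \in r then Y - Y^T else Y.
have ZB (Y1 Y2 : 'M[K]_N) : pairing t (Z (Y1 - Y2)) = pairing t (Z Y1) - pairing t (Z Y2).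
  have sp Yi s : \prod_(j < m) Z Yi j (lhalf s j) (rhalf s (t j)) =
      Yi (lhalf s i) (rhalf s (t i)) *
      \prod_(j < m | j != i) (if j \in r then Y - Y^T else Y) (lhalf s j) (rhalf s (t j)).
    rewrite (bigD1 i) //= {1}/Z eqxx; congr (_ * _).
    by apply: eq_bigr => j /negbTE nj; rewrite /Z nj.
  rewrite /pairing -sumrB; apply: eq_bigr => s _.
  by rewrite !sp -mulrBr -mulrBl [(Y1 - Y2) _ _]mxE [(- Y2) _ _]mxE.
have ZT : pairing t (Z Y^T) = - pairing t (Z Y).
  pose x := tperm (lshift m i) (rshift m (t i)).
  rewrite /pairing (reindex_inj (mulgI x)) /= -sumrN; apply: eq_bigr => s _.
  rewrite odd_permM odd_tperm eq_lrshift /= signrN mulNr; congr (- (_ * _)).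
  apply: eq_bigr => j _; rewrite /Z /lhalf /rhalf !permM.
  have [->|nji] := eqVneq j i; first by rewrite mxE tpermL tpermR.
  rewrite !tpermD ?eq_lrshift ?eq_rlshift //.
    by rewrite eq_rshift (inj_eq perm_inj) eq_sym.
  by rewrite eq_lshift eq_sym.
have -> : pairing t (fun j => if j \in i :: r then Y - Y^T else Y) = pairing t (Z (Y - Y^T)).
  apply: eq_bigr => s _; congr (_ * _); apply: eq_bigr => j _; rewrite /Z in_cons.
  by case: (j == i).
rewrite ZB ZT opprK -mulr2n expnS mulnC mulrnA -IH //; congr (_ *+ 2).
apply: eq_bigr => s _; congr (_ * _); apply: eq_bigr => j _; rewrite /Z.
by case: eqP => [->|//]; rewrite (negbTE ir).
Qed.

Lemma half_sum_antisym Y1 Y2 : Y1 - Y1^T = Y2 - Y2^T ->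
  half_sum Y1 *+ 2 ^ m = half_sum Y2 *+ 2 ^ m.
Proof.
move=> e; rewrite !half_sumE -!sumrMnl; apply: eq_bigr => t _; rewrite -!mulrnAr.
congr (_ * _); rewrite -[m in (2 ^ m)%N](size_enum_ord m) -!pairing_antisym ?enum_uniq //.
by apply: eq_bigr => s _; congr (_ * _); apply: eq_bigr => i _; rewrite mem_enum /= e.
Qed.

End Halves.

Lemma tperm_increasing p k (x : 'I_k -> 'I_p) (a b : 'I_p) : a = b.+1 :> nat ->
  (forall i, x i != a) \/ (forall i, x i != b) ->
  increasing x -> increasing (fun i => tperm a b (x i)).
Proof.
move=> ab nab incx i j ij; have := incx _ _ ij.
have vE (y : 'I_p) : tperm a b y = (if y == a :> nat then b : nat else if y == b :> nat then a : nat else y) :> nat.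
  case: tpermP => [->|->|ya yb]; rewrite ?eqxx //; first by rewrite ifN // ab; lia.
  by rewrite !ifN //; apply/eqP => /ord_inj.
rewrite !vE; case: nab => h.
  have hi : (x i : nat) != a := h i; have hj : (x j : nat) != a := h j.
  rewrite (negbTE hi) (negbTE hj).
  by case: (eqVneq (x i : nat) b); case: (eqVneq (x j : nat) b); lia.
have hi : (x i : nat) != b := h i; have hj : (x j : nat) != b := h j.
rewrite (negbTE hi) (negbTE hj).
by case: (eqVneq (x i : nat) a); case: (eqVneq (x j : nat) a); lia.
Qed.

Section SortedHalves.
Variable m : nat.
Local Notation N := (m + m)%N.
Implicit Types (s t : 'S_N) (A : {set 'I_N}).

Definition sorted_halves s A :=
  [/\ increasing (lhalf s), increasing (rhalf s) & lhalf s @: setT = A].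

(** Moving an element of [A] one row down in index, when that row is free, flips both the sign of
    the permutation and that of the product. The moves end at the first [m] rows, with the
    identity. *)
Lemma sorted_halvesP (K : comNzRingType) A : #|A| = m ->
  exists2 s, sorted_halves s A &
    (-1) ^+ s = (\prod_(i < m) (-1) ^+ i) * \prod_(a in A) (-1) ^+ a :> K.
Proof.
have [w] := ubnP (\sum_(a in A) a)%N; elim: w A => // w IH A ltw cA.
have [[a [b [aA bA ab]]]|closed] : (exists a b : 'I_N, [/\ a \in A, b \notin A & a = b.+1 :> nat])
    \/ (forall a b : 'I_N, a \in A -> a = b.+1 :> nat -> b \in A).
- case: (boolP [exists a : 'I_N, [exists b : 'I_N, [&& a \in A, b \notin A & a == b.+1 :> nat]]]).
    by case/existsP=> a /existsP[b /and3P[? ? /eqP ?]]; left; exists a, b.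
  rewrite negb_exists => /forallP h; right => a b aA ab; apply/negPn/negP => bA.
  by have /negP := h a; case; apply/existsP; exists b; rewrite aA bA ab eqxx.
- have nab : a != b by apply: contraNneq bA => <-.
  have bAa : b \notin A :\ a by rewrite in_setD1 negb_and bA orbT.
  have [] := IH (b |: A :\ a).
  - by rewrite big_setU1 //=; move: ltw; rewrite (big_setD1 a) //= ab addSn ltnS.
  - by rewrite cardsU1 bAa -[RHS]cA (cardsD1 a A) aA.
  move=> s [incl incr im] sgn.
  have lE i : lhalf (s * tperm a b) i = tperm a b (lhalf s i) by rewrite /lhalf permM.
  have rE i : rhalf (s * tperm a b) i = tperm a b (rhalf s i) by rewrite /rhalf permM.
  have la i : lhalf s i != a.
    have : lhalf s i \in b |: A :\ a by rewrite -im imset_f.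
    by rewrite !inE => /orP[/eqP->|/andP[]//]; rewrite eq_sym.
  have rb i : rhalf s i != b.
    have : rhalf s i \in ~: (b |: A :\ a) by rewrite -im -rhalf_imset imset_f.
    by rewrite !inE negb_or => /andP[].
  exists (s * tperm a b)%g.
    split; first by move=> i j ij; rewrite !lE; apply: tperm_increasing; first [exact: ab|left|done].
      by move=> i j ij; rewrite !rE; apply: tperm_increasing; first [exact: ab|right|done].
    apply/setP => r; apply/imsetP/idP => [[i _ ->]|rA].
      rewrite lE; have : lhalf s i \in b |: A :\ a by rewrite -im imset_f.
      have [->|nb] := eqVneq (lhalf s i) b; first by rewrite tpermR.
      by rewrite !inE (negbTE nb) /= => /andP[_ lA]; rewrite tpermD // eq_sym.
    have : tperm a b r \in b |: A :\ a.
      have [->|nra] := eqVneq r a; first by rewrite tpermL setU11.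
      have nrb : r != b by apply: contraNneq bA => <-.
      by rewrite tpermD 1?eq_sym // !inE nra rA orbT.
    rewrite -im => /imsetP[i _ e]; exists i => //.
    by rewrite lE -e tpermK.
  rewrite odd_permM odd_tperm nab signr_addb sgn mulrN1 -mulrN; congr (_ * _).
  by rewrite big_setU1 //= [RHS](big_setD1 a) //= ab exprS mulN1r !mulNr.
(* No move is possible, so [A] is closed under taking smaller indices and consists of the first [m]
   rows. *)
have down (x y : 'I_N) : x \in A -> (y <= x)%N -> y \in A.
  move=> xA /subnK; move: (x - y)%N => d; elim: d y => [|d IHd] y e; first by rewrite (_ : y = x) //; apply: ord_inj.
  have yN : (y.+1 < N)%N by have := ltn_ord x; lia.
  by apply: (closed (Ordinal yN)) => //; apply: IHd; rewrite /=; lia.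
have imA : lhalf 1%g @: setT = A.
  apply/eqP; rewrite eq_sym eqEcard card_imset ?cA ?cardsT ?card_ord ?leqnn ?andbT; last exact: lhalf_inj.
  apply/subsetP => x xA; have xm : (x < m)%N.
    rewrite ltnNge; apply/negP => mx.
    have mN : (m.+1 <= N)%N by have := ltn_ord x; lia.
    have : (#|widen_ord mN @: setT| <= #|A|)%N.
      by apply/subset_leq_card/subsetP => _ /imsetP[i _ ->]; apply: (down x) => //=; have := ltn_ord i; lia.
    rewrite cA card_imset ?cardsT ?card_ord ?ltnn // => i j /(congr1 (@nat_of_ord _)) /= e.
    exact: ord_inj.
  by apply/imsetP; exists (Ordinal xm) => //; apply: ord_inj; rewrite /lhalf perm1.
exists 1%g; first by split=> // i j ij; rewrite /lhalf /rhalf !perm1 //= ltn_add2l.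
rewrite odd_perm1 expr0 -imA big_imset /=; last by move=> i j _ _; apply: lhalf_inj.
rewrite [X in _ * X](eq_bigl xpredT) => [|i]; last by rewrite inE.
rewrite -big_split big1 //= => i _; rewrite /lhalf perm1 /=.
by rewrite -exprMn mulrNN mulr1 expr1n.
Qed.

Definition rev_mx (K : comNzRingType) p : 'M[K]_p := \matrix_(i, j) (i == rev_ord j)%:R.
Definition alt_mx (K : comNzRingType) p : 'M[K]_p := \matrix_(i, j) ((i == j)%:R * (-1) ^+ i).

Lemma mul_alt_mx (K : comNzRingType) p (B : 'M[K]_p) i j : (alt_mx K p *m B) i j = (-1) ^+ i * B i j.
Proof.
rewrite mxE (bigD1 i) //= mxE eqxx mul1r big1 ?addr0 // => k nk.
by rewrite mxE eq_sym (negbTE nk) !mul0r.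
Qed.

Lemma mul_mx_alt (K : comNzRingType) p (B : 'M[K]_p) i j : (B *m alt_mx K p) i j = B i j * (-1) ^+ j.
Proof.
rewrite mxE (bigD1 j) //= mxE eqxx mul1r big1 ?addr0 // => k nk.
by rewrite mxE (negbTE nk) mul0r mulr0.
Qed.

Lemma mul_rev_mx (K : comNzRingType) p (B : 'M[K]_p) i j : (rev_mx K p *m B) i j = B (rev_ord i) j.
Proof.
rewrite mxE (bigD1 (rev_ord i)) //= mxE rev_ordK eqxx mul1r big1 ?addr0 // => k nk.
rewrite mxE (_ : (i == rev_ord k) = false) ?mul0r //; apply: contraNF nk => /eqP->.
by rewrite rev_ordK.
Qed.

Lemma mul_mx_rev (K : comNzRingType) p (B : 'M[K]_p) i j : (B *m rev_mx K p) i j = B i (rev_ord j).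
Proof.
rewrite mxE (bigD1 (rev_ord j)) //= mxE eqxx mulr1 big1 ?addr0 // => k nk.
by rewrite mxE (negbTE nk) mulr0.
Qed.

Definition rev_perm k : 'S_k := perm (inv_inj (@rev_ordK k)).

Lemma det_mxsub_rev (K : comNzRingType) p k (x y : 'I_k -> 'I_p) (B : 'M[K]_p) :
  \det (mxsub x (fun j => rev_ord (y (rev_ord j))) B) =
  (-1) ^+ rev_perm k * \det (mxsub x y (B *m rev_mx K p)).
Proof.
have -> : mxsub x (fun j => rev_ord (y (rev_ord j))) B =
    col_perm (rev_perm k) (mxsub x y (B *m rev_mx K p)).
  by apply/matrixP => i j; rewrite [RHS]mxE [RHS]mxE mul_mx_rev mxE permE.
by rewrite col_permE det_mulmx det_perm odd_permV mulrC.
Qed.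

(** Multiplication by a permutation that carries A to B maps one fiber injectively into the
    other. *)
Lemma fiber_leq (A B : {set 'I_N}) : #|A| = m -> #|B| = m ->
  (#|[set s : 'S_N | lhalf s @: setT == A]| <= #|[set s : 'S_N | lhalf s @: setT == B]|)%N.
Proof.
move=> cA cB; have [sA [_ _ imA] _] := sorted_halvesP int cA.
have [sB [_ _ imB] _] := sorted_halvesP int cB.
pose p := (sA^-1 * sB)%g; have pE x : p (sA x) = sB x by rewrite permM permK.
rewrite -(card_imset _ (mulIg p)); apply/subset_leq_card/subsetP => _ /imsetP[s + ->].
rewrite !inE => /eqP imsA.
have -> : lhalf (s * p) @: setT = p @: (lhalf s @: setT).
  by rewrite -imset_comp; apply: eq_imset => i; rewrite /lhalf /= permM.
rewrite imsA -imA -imset_comp -imB; apply/eqP/eq_imset => i.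
by rewrite /lhalf /= -pE.
Qed.

Lemma fiber_card (A B : {set 'I_N}) : #|A| = m -> #|B| = m ->
  #|[set s : 'S_N | lhalf s @: setT == A]| = #|[set s : 'S_N | lhalf s @: setT == B]|.
Proof. by move=> cA cB; apply/eqP; rewrite eqn_leq !fiber_leq. Qed.

Lemma half_sum_sets (K : comNzRingType) (Y : 'M[K]_N) (g : {set 'I_N} -> K) (A0 : {set 'I_N}) :
  #|A0| = m -> (forall A s, #|A| = m -> sorted_halves s A -> half_minor Y s = g A) ->
  half_sum Y = (\sum_(A : {set 'I_N} | #|A| == m) g A) *+
    #|[set s : 'S_N | lhalf s @: setT == A0]|.
Proof.
move=> cA0 gE; rewrite /half_sum.
rewrite (partition_big (fun s : 'S_N => lhalf s @: setT) (fun A : {set 'I_N} => #|A| == m)) /=; last first.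
  by move=> s _; rewrite card_imset ?cardsT ?card_ord //; apply: lhalf_inj.
rewrite -sumrMnl; apply: eq_bigr => A /eqP cA.
have [sA sortA _] := sorted_halvesP int cA.
rewrite (eq_bigr (fun=> g A)) => [|s /eqP imA]; last first.
  have imsA : lhalf sA @: setT = A by case: sortA.
  by rewrite -(gE A sA cA sortA); apply: half_minor_eq; rewrite imA imsA.
rewrite sumr_const; congr (_ *+ _); rewrite (fiber_card cA0 cA).
by apply: eq_card => s; rewrite !inE.
Qed.

Lemma sorted_fiber_gt0 (A : {set 'I_N}) : #|A| = m -> (0 < #|[set s : 'S_N | lhalf s @: setT == A]|)%N.
Proof.
move=> cA; have [s [_ _ imA] _] := sorted_halvesP int cA.
by apply/card_gt0P; exists s; rewrite inE imA.
Qed.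

End SortedHalves.

(** The number of rows is even, so turning the board upside down exchanges the parities. Through the
    toggling, the particles end on the complement of their starting set, upside down. *)
Lemma mobius_hop_count m k (N := (m + m)%N) :
  (mobius_tilings N k.+1.*2)%:R =
  \sum_(A : {set 'I_N}) hop_count (grid_hops int true k.+1.*2 (fun _ _ => 1%N))
     A [set r | rev_ord r \in ~: A] :> int.
Proof.
have oN : odd N = false by rewrite /N addnn odd_double.
have -> : mobius_tilings N k.+1.*2 =
    weighted_matchings (@tiling_adj N k.+1.*2 true) (fun=> 1%N).
  rewrite /weighted_matchings (eq_bigr (fun=> 1%N)) => [|M _]; last by rewrite big1.
  by rewrite sum1_card.
rewrite doubleS (@tilings_hop_count int _ _ _ _ (fun _ _ => 1%N) true) ?oN //.
rewrite -doubleS odd_double addbF.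
have inj : involutive (fun S : {set 'I_N} => [set r | rev_ord r \in S]).
  by move=> S; apply/setP => r; rewrite !inE rev_ordK.
rewrite (reindex_inj (inv_inj inj)) /= (reindex_inj (inv_inj (toggleK true))).
apply: eq_bigr => A _; rewrite inj; congr hop_count; first exact: toggleK.
apply/setP => r; rewrite !inE /=.
have -> : odd (N - r.+1) = ~~ odd r by rewrite oddB ?oN //= ltn_ord.
by case: (_ \in A); case: odd.
Qed.

Lemma hop_count_half m k (N := (m + m)%N) (A : {set 'I_N}) s :
  #|A| = m -> sorted_halves s A ->
  hop_count (grid_hops int true k.*2 (fun _ _ => 1%N)) A [set r | rev_ord r \in ~: A] =
  (-1) ^+ rev_perm m * \det (mxsub (lhalf s) (rhalf s) (two_step int N true ^+ k *m rev_mx int N)).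
Proof.
move=> cA [incl incr imA]; rewrite -det_mxsub_rev -(@hop_mx_grid_const int N true k (fun _ _ => 1%N)) //.
rewrite det_hop_mx ?grid_hops_near //; last first.
  move=> i j ij; have : (rhalf s (rev_ord j) < rhalf s (rev_ord i))%N.
    by apply: incr => /=; have := ltn_ord j; lia.
  by have := ltn_ord (rhalf s (rev_ord i)); rewrite /=; lia.
congr hop_count; first by rewrite imA.
apply/setP => r; rewrite inE -imA -rhalf_imset; apply/imsetP/imsetP => [[i _ e]|[i _ ->]].
  by exists (rev_ord i) => //; rewrite rev_ordK -e rev_ordK.
by exists (rev_ord i) => //; rewrite rev_ordK.
Qed.

(** Up to a constant, the sign of a sorted splitting is the product of (-1)^a over its rows a;
    [alt_mx] contributes the same sign, so all hop counts enter with one common sign. *)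
Lemma mobius_half_sum m k (N := (m + m)%N) (A0 : {set 'I_N})
    (Y := alt_mx int N *m (two_step int N true ^+ k.+1 *m rev_mx int N)) :
  #|A0| = m ->
  exists e : bool, half_sum Y =
    (-1) ^+ e * (mobius_tilings N k.+1.*2)%:R *+ #|[set s : 'S_N | lhalf s @: setT == A0]|.
Proof.
move=> cA0; pose e := (rev_perm m : bool) (+) odd (\sum_(i < m) i).
exists e; rewrite mobius_hop_count (bigID (fun A : {set 'I_N} => #|A| == m)) /=.
(* Hops preserve the number of particles, and the final set has as many elements as the complement
   of [A]. *)
rewrite [X in _ + X]big1 ?addr0 => [|A cA]; last first.
  apply/eqP; apply: contraNT cA => /hop_count_card.
  rewrite (_ : [set r | _] = @rev_ord N @: ~: A); last first.
    apply/setP => r; rewrite inE; apply/idP/imsetP => [rA|[x xA ->]]; last by rewrite rev_ordK.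
    by exists (rev_ord r); rewrite ?rev_ordK.
  rewrite card_imset; last exact: (inv_inj (@rev_ordK N)).
  have cAC := cardsC A; rewrite card_ord in cAC => e1; rewrite -e1 in cAC.
  by apply/eqP/double_inj; rewrite -!addnn cAC.
rewrite mulr_sumr (half_sum_sets cA0 (g := fun A => (-1) ^+ e *
  hop_count (grid_hops int true k.+1.*2 (fun _ _ => 1%N)) A [set r | rev_ord r \in ~: A])) //.
move=> A s cA sortA; rewrite (hop_count_half k.+1 cA sortA).
have [s' [incl' incr' imA'] sgn] := sorted_halvesP int cA.
have [incl incr imA] := sortA.
have -> : s = s'.
  apply/permP => x; rewrite -[x]splitK; case: (split x) => i /=.
    by apply: (increasing_eq incl incl'); rewrite imA imA'.
  by apply: (increasing_eq incr incr'); rewrite !rhalf_imset imA imA'.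
rewrite /half_minor sgn.
have -> : mxsub (lhalf s') (rhalf s') Y =
    diag_mx (\row_i (-1) ^+ lhalf s' i) *m mxsub (lhalf s') (rhalf s') (two_step int N true ^+ k.+1 *m rev_mx int N).
  by rewrite mul_diag_mx; apply/matrixP => i j; rewrite mxE mul_alt_mx !mxE.
rewrite det_mulmx det_diag -[in X in X * _]imA' big_imset /=; last by move=> i j _ _; apply: lhalf_inj.
set P := \prod_(i in _) _; rewrite (_ : \prod_(i < m) (\row_i0 (-1) ^+ lhalf s' i0) 0 i = P); last first.
  by apply: eq_big => i; rewrite ?inE // mxE.
have PP : P * P = 1.
  by rewrite -big_split big1 //= => i _; rewrite -exprMn mulrNN mulr1 expr1n.
have -> : \prod_(i < m) (-1) ^+ i = (-1) ^+ odd (\sum_(i < m) i) :> int.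
  by rewrite signr_odd expr_sum.
rewrite /e signr_addb -mulrA (mulrA P) PP mul1r [RHS]mulrA; congr (_ * _).
by rewrite mulrAC -signr_addb addbb mul1r.
Qed.

(** * Alternating signs and reversal applied to the two-step matrix *)

Section Symmetries.
Variables (K : comNzRingType) (p : nat).
Local Notation D := (alt_mx K p).
Local Notation R := (rev_mx K p).
Local Notation P := (path_mx K p).
Local Notation pi c := (parity_mx K p c).

Lemma alt_mxK : D * D = 1.
Proof.
apply/matrixP => i j; rewrite [LHS]mul_alt_mx !mxE; have [->|_] := eqVneq i j.
  by rewrite mul1r -exprMn mulrNN mulr1 expr1n.
by rewrite mul0r mulr0.
Qed.

Lemma alt_mx_path : D * P = - (P * D).
Proof.
apply/matrixP => i j; rewrite [LHS]mul_alt_mx [RHS]mxE [(P * D) i j]mul_mx_alt mxE mulrC -mulrN.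
case h : (path_adj i j); last by rewrite !mul0r.
by congr (_ * _); case/orP: h => /eqP->; rewrite exprS mulN1r ?opprK.
Qed.

Lemma alt_mx_parity c : D * pi c = pi c * D.
Proof.
apply/matrixP => i j; rewrite [LHS]mul_alt_mx [RHS]parity_mxE !mxE.
by have [->|_] := eqVneq i j; rewrite ?mul0r ?mulr0 // mul1r mulrC.
Qed.

Lemma alt_half_step c : D * half_step K p c = (1 - pi c * P) * D.
Proof.
rewrite mulrDr mulr1 mulrBl mul1r; congr (_ + _).
by rewrite mulrA alt_mx_parity -mulrA alt_mx_path mulrN mulrA.
Qed.

Lemma alt_mx_tr : D^T = D.
Proof. by apply/matrixP => i j; rewrite !mxE eq_sym; case: eqP => [->|]; rewrite ?mul0r. Qed.

Lemma rev_mx_tr : R^T = R.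
Proof.
apply/matrixP => i j; rewrite !mxE; congr (_ %:R); congr nat_of_bool.
by rewrite -(inj_eq (inv_inj (@rev_ordK p))) rev_ordK eq_sym.
Qed.

Lemma half_step_tr c : (half_step K p c)^T = half_step K p (~~ c).
Proof.
rewrite /half_step -path_mx_parity.
apply/matrixP => i j; rewrite mxE mxE [(pi c * P) _ _]parity_mxE [RHS]mxE [(P * pi c) _ _]mx_parityE.
by rewrite !mxE eq_sym mulrC /path_adj orbC.
Qed.

Lemma two_step_tr c : (two_step K p c)^T = two_step K p c.
Proof. by rewrite /two_step -mulmxE trmx_mul !half_step_tr negbK. Qed.

Lemma two_step_exp_tr c n : (two_step K p c ^+ n)^T = two_step K p c ^+ n.
Proof.
elim: n => [|n IH]; first exact: trmx1.
by rewrite [in LHS]exprS -mulmxE trmx_mul IH two_step_tr exprSr.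
Qed.

Hypothesis p_even : odd p = false.

Lemma odd_rev_ord (i : 'I_p) : odd (rev_ord i) = ~~ odd i.
Proof. by rewrite /= oddB ?p_even. Qed.

Lemma rev_alt_mx : R * D = - (D * R).
Proof.
apply/matrixP => i j; rewrite [LHS]mul_mx_alt [RHS]mxE [(D * R) i j]mul_alt_mx !mxE.
have [->|_] := eqVneq i (rev_ord j); last by rewrite mul0r mulr0 oppr0.
by rewrite mul1r mulr1 -signr_odd -[in RHS]signr_odd odd_rev_ord signrN opprK.
Qed.

Lemma rev_mx_parity c : R * pi c = pi (~~ c) * R.
Proof.
apply/matrixP => i j; rewrite [LHS]mul_rev_mx [RHS]parity_mxE !mxE odd_rev_ord.
rewrite -(inj_eq (inv_inj (@rev_ordK p))) rev_ordK; have [->|_] := eqVneq i (rev_ord j).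
  by rewrite /= mulr1 odd_rev_ord; case: odd c => [] [].
by rewrite mulr0.
Qed.

Lemma rev_mx_path : R * P = P * R.
Proof.
apply/matrixP => i j; rewrite [LHS]mul_rev_mx [RHS]mul_mx_rev !mxE; congr (_%:R).
by have := ltn_ord i; have := ltn_ord j; rewrite /path_adj /=; lia.
Qed.

Lemma rev_half_step c : R * half_step K p c = half_step K p (~~ c) * R.
Proof.
rewrite mulrDr mulr1 mulrDl mul1r; congr (_ + _).
by rewrite mulrA rev_mx_parity -mulrA rev_mx_path mulrA.
Qed.

(** R exchanges the two half steps and D changes the sign of P, so D R conjugates the two-step
    matrix into its inverse. *)
Lemma alt_rev_two_step c n :
  D * R * two_step K p c ^+ n = two_step_inv_mx K p c ^+ n * (D * R).
Proof.
elim: n => [|n IH]; first by rewrite !expr0 mul1r mulr1.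
have E1 : D * R * two_step K p c = two_step_inv_mx K p c * (D * R).
  rewrite /two_step /two_step_inv_mx mulrA -(mulrA D R) rev_half_step.
  rewrite -!mulrA rev_half_step negbK !mulrA alt_half_step -!mulrA; congr (_ * _).
  by rewrite !mulrA alt_half_step -mulrA.
by rewrite !exprS mulrA E1 -mulrA IH mulrA.
Qed.

(** W is symmetric, hence Y^T = R W D. Moving D R past W inverts W, and R anticommutes with D, so
    Y^T = - D W^(-1) R; the sum of W and its inverse is the Chebyshev value. *)
Lemma mobius_antisym c n (W := two_step K p c ^+ n) (Y := D *m (W *m R)) :
  Y - Y^T = D *m (cheb (2%:R + P * P) n *m R).
Proof.
rewrite /Y !trmx_mul alt_mx_tr rev_mx_tr two_step_exp_tr -/W (cheb_two_step K p c n) -/W.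
rewrite mulmxDl mulmxDr; congr (_ + _); rewrite !mulmxE.
have RW : R * W = D * (two_step_inv_mx K p c ^+ n * (D * R)).
  by rewrite -alt_rev_two_step !mulrA alt_mxK mul1r.
by rewrite RW -!mulrA rev_alt_mx !mulrN opprK !mulrA -(mulrA _ D D) alt_mxK mulr1.
Qed.

End Symmetries.

Lemma parity_mx_cheb (K : comNzRingType) p c n :
  parity_mx K p c * cheb (2%:R + path_mx K p * path_mx K p) n =
  cheb (2%:R + path_mx K p * path_mx K p) n * parity_mx K p c.
Proof.
apply: mulmx_cheb; rewrite [LHS]mulrDr [RHS]mulrDl !mulr2n mulrDr mulrDl mulr1 mul1r.
congr (_ + _); rewrite -[RHS]mulrA path_mx_parity [RHS]mulrA path_mx_parity negbK.
by rewrite mulrA.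
Qed.

Lemma cheb_parity0 (K : comNzRingType) p n (i j : 'I_p) : odd i != odd j ->
  cheb (2%:R + path_mx K p * path_mx K p) n i j = 0.
Proof.
move=> ij; have := congr1 (fun B : 'M[K]_p => B i j) (parity_mx_cheb K p (odd i) n).
rewrite [LHS]parity_mxE eqxx mul1r [RHS]mx_parityE eq_sym (negbTE ij) mulr0; exact.
Qed.

(** The sign is left open; it is settled in the end by the positivity of the determinant. *)
Lemma mobius_det m k :
  exists e : bool, (mobius_tilings (2 * m) k.+1.*2)%:R =
    (-1) ^+ e * \det (cheb (tri_mx int m) k.+1) :> int.
Proof.
rewrite -(tri_even int m) mul2n -addnn.
set N := (m + m)%N; pose Q : 'M[int]_N := 2%:R + path_mx int N * path_mx int N.
have oN : odd N = false by rewrite /N addnn odd_double.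
have h : parity_dim m N true by apply/orP; left; rewrite -addnn.
pose X := [set r : 'I_N | odd r == true].
have cX : #|X| = m.
  by rewrite /X -(parity_row_imset h) card_imset ?cardsT ?card_ord //; apply: parity_row_inj.
have [sX sortX _] := sorted_halvesP int cX.
have [inclX incrX imX] := sortX.
have lX i : lhalf sX i = parity_row h i.
  by apply: (increasing_eq inclX (@parity_row_increasing _ _ _ h)); rewrite imX parity_row_imset.
pose Z := cheb Q k.+1.
pose Kx := alt_mx int N *m (Z *m rev_mx int N).
(* [Kx] links only rows of different parity, so its entries in odd rows and even columns form a
   matrix with the antisymmetric part of [Y]. *)
pose Y0 : 'M[int]_N := \matrix_(i, j) (if odd i && ~~ odd j then Kx i j else 0).
have KxE i j : Kx i j = (-1) ^+ i * Z i (rev_ord j) by rewrite mul_alt_mx mul_mx_rev.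
have [e he] := mobius_half_sum k cX.
set Y := alt_mx int N *m _ in he.
have YY : Y - Y^T = Kx by apply: mobius_antisym.
clearbody Kx.
have Kx0 (i j : 'I_N) : odd i == odd j -> Kx i j = 0.
  by move=> ij; rewrite KxE cheb_parity0 ?mulr0 // odd_rev_ord // (eqP ij); case: odd.
have KxT i j : Kx j i = - Kx i j.
  by rewrite -YY !mxE opprB.
have Y0Y : Y - Y^T = Y0 - Y0^T.
  rewrite YY; apply/matrixP => i j; rewrite !mxE.
  have [ij|] := eqVneq (odd i) (odd j).
    by rewrite Kx0 ?ij // andbN subr0.
  by case: (odd i) (odd j) => [] [] //= _; rewrite ?subr0 // sub0r -KxT.
have hs : half_sum Y = half_sum Y0.
  by have /eqP := half_sum_antisym Y0Y; rewrite eqrMn2r expn_eq0 => /eqP.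
(* The even rows of [Y0] are zero, so only the minor whose rows are all the odd ones survives. *)
have f0 (A : {set 'I_N}) (s : 'S_N) : #|A| = m -> sorted_halves s A ->
    half_minor Y0 s = if A == X then half_minor Y0 sX else 0.
  move=> cA [_ _ imA]; case: eqP => [AX|AX]; first by apply: half_minor_eq; rewrite imA imX.
  have [i oi] : exists i, ~~ odd (lhalf s i).
    apply/existsP; apply: contraT; rewrite negb_exists => /forallP hi; case: AX.
    apply/eqP; rewrite eqEcard cA cX leqnn andbT -imA.
    by apply/subsetP => _ /imsetP[i _ ->]; rewrite inE eqb_id; have := hi i; rewrite negbK.
  rewrite /half_minor (expand_det_row _ i) big1 ?mulr0 // => j _.
  by rewrite mxE mxE (negbTE oi) mul0r.
move: he; rewrite hs (half_sum_sets cX f0) -big_mkcondr (big_pred1 X); last first.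
  by move=> A /=; have [->|_] := eqVneq A X; rewrite ?andbF // andbT; apply/eqP.
move/eqP; rewrite eqrMn2r (negbTE (lt0n_neq0 _)) ?sorted_fiber_gt0 // orFb.
move/eqP=> key.
have key2 : half_minor Y0 sX = (-1) ^+ sX * ((-1) ^+ m * ((-1) ^+ rev_perm m *
    \det (cheb (parity_rows int m N true *m Q *m (parity_rows int m N true)^T) k.+1))).
  rewrite /half_minor; congr (_ * _).
  have -> : mxsub (lhalf sX) (rhalf sX) Y0 =
      (-1) *: mxsub (lhalf sX) (rhalf sX) (Z *m rev_mx int N).
    apply/matrixP => i j; rewrite mxE mxE [RHS]mxE [X in _ * X]mxE.
    have -> : odd (lhalf sX i) by rewrite lX odd_parity_row.
    have -> /= : ~~ odd (rhalf sX j).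
      have : rhalf sX j \in ~: X by rewrite -imX -rhalf_imset imset_f.
      by rewrite !inE eqb_id.
    by rewrite KxE mul_mx_rev -signr_odd lX odd_parity_row.
  rewrite detZ; congr (_ * _).
  (* The right half consists of the even rows; reversed, it lists the odd rows again, so a principal
     minor of [Z] appears. *)
  have rE j : rev_ord (rhalf sX (rev_ord j)) = parity_row h j.
    apply: (@increasing_eq _ _ (fun j => rev_ord (rhalf sX (rev_ord j)))) => [i j' ij||].
    - have : (rhalf sX (rev_ord j') < rhalf sX (rev_ord i))%N.
        by apply: incrX => /=; have := ltn_ord j'; lia.
      by have := ltn_ord (rhalf sX (rev_ord i)); rewrite /=; lia.
    - exact: parity_row_increasing.
    rewrite parity_row_imset -/X.
    apply/eqP; rewrite eqEcard cX card_imset ?cardsT ?card_ord ?leqnn ?andbT; last first.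
      by move=> i j' /rev_ord_inj/rhalf_inj/rev_ord_inj.
    apply/subsetP => _ /imsetP[i _ ->]; rewrite inE eqb_id odd_rev_ord //.
    have : rhalf sX (rev_ord i) \in ~: X by rewrite -imX -rhalf_imset imset_f.
    by rewrite !inE eqb_id.
  have E : \det (mxsub (lhalf sX) (fun j => rev_ord (rhalf sX (rev_ord j))) Z) =
      \det (cheb (parity_rows int m N true *m Q *m (parity_rows int m N true)^T) k.+1).
    rewrite (cheb_parity_rows int h) (parity_rows_mxsub h); congr (\det _).
    by apply/matrixP => i j; rewrite !mxE lX rE.
  by rewrite -E det_mxsub_rev mulrA -signr_addb addbb mul1r.
exists (e (+) (sX (+) (odd m (+) rev_perm m))).
rewrite -/Q; move: key2; set T := \det (cheb _ _); rewrite key => key2.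
apply: (can_inj (@signrMK _ e)); rewrite key2 [RHS]mulrA -signr_addb addKb !signr_addb.
by rewrite (signr_odd _ m) !mulrA.
Qed.

(** * Symmetric recurrents *)

Section Sandpile.
Variables p q : nat.
Local Notation V := (gvertex p q).
Local Notation conf := (configuration p q).
Local Notation adj := (@grid_adj p q).
Local Notation reach := (clos_refl_trans conf (@firing p q)).
Implicit Types (c d : conf) (v w : V).

Lemma grid_adjC v w : adj v w = adj w v.
Proof. by case: v w => [a b] [a' b']; rewrite /grid_adj /= (distnC a) (distnC b). Qed.

Lemma grid_adjxx v : adj v v = false.
Proof. by case: v => a b; rewrite /grid_adj /= !distnn. Qed.

Definition laplacian (z : V -> int) v : int := 4%:R * z v - \sum_w (adj v w)%:R * z w.

Lemma grid_adj_split (a a' : 'I_p) (b b' : 'I_q) :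
  (adj (a, b) (a', b') : nat) =
  ((b == b') * path_adj a a' + (a == a') * path_adj b b')%N.
Proof.
rewrite /grid_adj /path_adj /= -!(inj_eq (@ord_inj _)).
by case: (eqVneq (a : nat) a') => [->|na]; case: (eqVneq (b : nat) b') => [->|nb]; rewrite ?distnn; lia.
Qed.

(* Outside of the grid, [z] is read as 0. *)
Lemma laplacianE (z : nat -> nat -> int) (a : 'I_p) (b : 'I_q) :
  laplacian (fun v => z v.1 v.2) (a, b) = 4%:R * z a b
   - ((0 < a)%N%:R * z a.-1 b + (a.+1 < p)%N%:R * z a.+1 b)
   - ((0 < b)%N%:R * z a b.-1 + (b.+1 < q)%N%:R * z a b.+1).
Proof.
rewrite /laplacian -addrA -opprD; congr (_ - _).
rewrite -(sum_path_adj (fun k => z k b) (ltn_ord a)) -(sum_path_adj (z a) (ltn_ord b)).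
rewrite -(pair_bigA _ (fun a' b' => (adj (a, b) (a', b'))%:R * z a' b')) /=.
under eq_bigr => a' _ do (under eq_bigr => b' _ do rewrite grid_adj_split natrD mulrDl;
  rewrite big_split /=).
rewrite big_split /=; congr (_ + _).
  apply: eq_bigr => a' _; rewrite (bigD1 b) //= eqxx mul1n big1 ?addr0 // => b' nb.
  by rewrite eq_sym (negbTE nb) mul0n mul0r.
rewrite (bigD1 a) //= [X in _ + X]big1 ?addr0 => [|a' na]; last first.
  by rewrite big1 // => b' _; rewrite eq_sym (negbTE na) mul0n mul0r.
by apply: eq_bigr => b' _; rewrite eqxx mul1n.
Qed.

Lemma fireE c v w : unstable c v ->
  (fire c v w)%:Z = (c w)%:Z - laplacian (fun x => (x == v)%:R) w.
Proof.
move=> uv; rewrite ffunE /laplacian (bigD1 v) //= eqxx mulr1 big1 ?addr0 => [|x nx]; last first.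
  by rewrite (negbTE nx) mulr0.
have [->|nw] := eqVneq w v; first by rewrite grid_adjxx subr0 mulr1 -subzn.
by rewrite mulr0 sub0r opprK PoszD grid_adjC natz.
Qed.

Lemma laplacianD (y z : V -> int) v : laplacian (fun x => y x + z x) v = laplacian y v + laplacian z v.
Proof.
rewrite /laplacian mulrDr addrACA -opprD -big_split /=; congr (_ - _).
by apply: eq_bigr => w _; rewrite mulrDr.
Qed.

Lemma laplacianZ (k : int) (y : V -> int) v : laplacian (fun x => k * y x) v = k * laplacian y v.
Proof.
rewrite /laplacian mulrBr mulrCA mulr_sumr; congr (_ - _).
by apply: eq_bigr => w _; rewrite mulrCA.
Qed.

Lemma eq_laplacian (y z : V -> int) v : y =1 z -> laplacian y v = laplacian z v.
Proof.
by move=> yz; rewrite /laplacian yz; congr (_ - _); apply: eq_bigr => w _; rewrite yz.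
Qed.

Lemma laplacianN (y : V -> int) v : laplacian (fun x => - y x) v = - laplacian y v.
Proof.
by rewrite -mulN1r -laplacianZ; apply: eq_laplacian => x; rewrite mulN1r.
Qed.

Lemma reach_laplacian c d : reach c d ->
  exists u : V -> int, forall v, (d v)%:Z = (c v)%:Z - laplacian u v.
Proof.
elim=> {c d} [c _ [v uv ->]|c|c d e _ [u hu] _ [u' hu']].
- by exists (fun x => (x == v)%:R) => w; apply: fireE.
- exists (fun=> 0) => v; rewrite /laplacian mulr0 big1 ?subr0 // => w _.
  by rewrite mulr0.
exists (fun x => u x + u' x) => v.
by rewrite laplacianD hu' hu (opprD (laplacian u v)) [RHS]addrA.
Qed.

(** A concave parabola in the row index, zero just outside of the grid. Its second difference is -2,
    and the column direction contributes nothing negative, so its Laplacian is at least 2. *)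
Definition hill (v : V) : nat := (v.1.+1 * (p - v.1))%N.

Lemma laplacian_hill v : (2 : int) <= laplacian (fun x => (hill x)%:Z) v.
Proof.
case: v => a b; pose z (a b : nat) := (a.+1 * (p - a))%N%:Z.
rewrite (_ : laplacian _ _ = laplacian (fun v => z v.1 v.2) (a, b)) //.
rewrite laplacianE /z /hill; have := ltn_ord a; set x := (p - a)%N => ap.
have -> : (a.+1 < p)%N%:R * (a.+2 * (p - a.+1))%N%:Z = (a.+2 * (p - a.+1))%N%:Z :> int.
  by case: ltnP => [_|h]; rewrite ?mul1r // (_ : (p - a.+1 = 0)%N) ?muln0 ?mulr0 //; lia.
have -> : (0 < a)%N%:R * (a.-1.+1 * (p - a.-1))%N%:Z = (a * x.+1)%N%:Z :> int.
  case: (posnP a) => [->|a0]; first by rewrite mul0r.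
  by rewrite mul1r prednK // /x; congr (_ * _)%N%:Z; lia.
have -> : (p - a.+1)%N = x.-1 by rewrite /x; lia.
have x0 : (0 < x)%N by rewrite /x; lia.
rewrite -(prednK x0) /=; move: x.-1 => y; move: (a : nat) => a'.
by case: (0 < b)%N; case: (b.+1 < q)%N; rewrite ?mul1r ?mul0r; nia.
Qed.

Lemma laplacian_adjoint (y z : V -> int) :
  \sum_v y v * laplacian z v = \sum_v laplacian y v * z v.
Proof.
under eq_bigr => v _ do rewrite mulrBr mulr_sumr.
under [RHS]eq_bigr => v _ do rewrite mulrBl mulr_suml.
rewrite !sumrB; congr (_ - _); first by apply: eq_bigr => v _; rewrite mulrCA mulrA.
rewrite exchange_big; apply: eq_bigr => w _; apply: eq_bigr => v _.
by rewrite grid_adjC mulrCA mulrA.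
Qed.

(* If [z] is in the kernel then [`|z|] is subharmonic, and pairing it with the
   strictly superharmonic function [hill] shows that it vanishes. *)
Lemma laplacian_inj0 (z : V -> int) : (forall v, laplacian z v = 0) -> forall v, z v = 0.
Proof.
move=> z0; pose h v := `|z v|.
have sub v : laplacian h v <= 0.
  rewrite subr_le0 /h -[4%:R]normr_nat -normrM; have /eqP := z0 v; rewrite subr_eq0 => /eqP->.
  apply: le_trans (ler_norm_sum _ _ _) _; apply: ler_sum => w _.
  by rewrite normrM normr_nat.
have s0 : \sum_v h v <= 0.
  have le1 : \sum_v h v <= \sum_v laplacian (fun x => (hill x)%:Z) v * h v.
    apply: ler_sum => v _; rewrite -[leLHS]mul1r ler_wpM2r ?normr_ge0 //.
    by apply: le_trans (laplacian_hill v).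
  apply: le_trans le1 _; rewrite -laplacian_adjoint; apply: sumr_le0 => v _.
  by rewrite mulr_ge0_le0.
move=> v; apply/eqP; rewrite -normr_eq0 eq_le normr_ge0 andbT.
apply: le_trans s0; rewrite (bigD1 v) //= lerDl; apply: sumr_ge0 => w _.
exact: normr_ge0.
Qed.

Definition addc c d : conf := [ffun v => (c v + d v)%N].

Lemma firing_diamond c d e : firing c d -> firing c e ->
  d = e \/ exists2 f, firing d f & firing e f.
Proof.
case=> v uv -> [w uw ->]; have [->|nvw] := eqVneq v w; first by left.
have nwv : w != v by rewrite eq_sym.
right; exists (fire (fire c v) w).
  by exists w => //; rewrite /unstable ffunE (negbTE nwv); apply: leq_trans uw (leq_addr _ _).
exists v; first by rewrite /unstable ffunE (negbTE nvw); apply: leq_trans uv (leq_addr _ _).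
apply/ffunP => x; rewrite !ffunE; have [->|nxv] := eqVneq x v.
  rewrite (negbTE nvw); move: uv; rewrite /unstable; lia.
have [->|nxw] := eqVneq x w; first by move: uw; rewrite /unstable; lia.
by rewrite addnAC.
Qed.

(** By self-adjointness, firing [v] lowers it by the Laplacian of [hill] at [v], which is positive;
    so firing terminates. *)
Definition energy c : int := \sum_v (hill v)%:Z * (c v)%:Z.

Lemma energy_ge0 c : 0 <= energy c.
Proof. by apply: sumr_ge0 => v _; rewrite mulr_ge0. Qed.

Lemma energy_fire c v : unstable c v -> energy (fire c v) < energy c.
Proof.
move=> uv; rewrite -subr_gt0 /energy -sumrB.
under eq_bigr => w _ do rewrite -mulrBr fireE // opprB addrCA subrr addr0.
rewrite laplacian_adjoint (bigD1 v) //= eqxx mulr1 big1 ?addr0 => [|w nw]; last first.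
  by rewrite (negbTE nw) mulr0.
by apply: lt_le_trans (laplacian_hill v).
Qed.

Lemma stable_firing c d : stable c -> ~ firing c d.
Proof. by move=> /forallP sc [v uv _]; have := sc v; rewrite uv. Qed.

Lemma reach_inv c d : reach c d -> c = d \/ exists2 e, firing c e & reach e d.
Proof.
elim=> {c d} [c d cd|c|c d e _ [-> //|[f cf fd]] de IH]; first by right; exists d => //; apply: rt_refl.
  by left.
by right; exists f => //; apply: rt_trans fd _.
Qed.

(** Newman's argument: firing terminates because the energy drops, and two different firings can be
    joined again by one firing each. *)
Lemma unique_stabilization c :
  exists2 d, stabilizes_to c d & forall e, stabilizes_to c e -> e = d.
Proof.
have [k] := ubnP `|energy c|%N; elim: k c => // k IH c lek.
have lt d e : firing d e -> (`|energy e| < `|energy d|)%N.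
  case=> v uv ->; have := energy_fire uv.
  by have := energy_ge0 d; have := energy_ge0 (fire d v); lia.
have [sc|nsc] := boolP (stable c).
  exists c; first by split=> //; apply: rt_refl.
  by move=> e [/reach_inv[->//|[f /(stable_firing sc)]]].
have [v uv] : exists v, unstable c v.
  by apply/existsP; move: nsc; rewrite /stable negb_forall => /existsP[v]; rewrite negbK => uv; apply/existsP; exists v.
have fv : firing c (fire c v) by exists v.
have ltk d : firing c d -> (`|energy d| < k)%N by move/lt/leq_trans; apply.
have [d [rd sd] ud] := IH _ (ltk _ fv).
exists d; first by split=> //; apply: rt_trans rd; apply: rt_step.
move=> e [/reach_inv[ce|[f cf fe]] se].
  by case: (stable_firing (c := c) _ fv); rewrite ce.
have [df|[g fg1 fg2]] := firing_diamond fv cf; first by apply: ud; rewrite df.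
have [x [rx sx] _] := IH g (ltn_trans (lt _ _ fg1) (ltk _ fv)).
have [y _ uy] := IH _ (ltk _ cf).
rewrite (uy e) // -(uy x); first by apply: ud; split=> //; apply: rt_trans rx; apply: rt_step.
by split=> //; apply: rt_trans rx; apply: rt_step.
Qed.

Lemma stabilizes_to_inj c d e : stabilizes_to c d -> stabilizes_to c e -> d = e.
Proof. by have [f _ uf] := unique_stabilization c => /uf-> /uf->. Qed.

Lemma stabilizes_to_reach c d e : reach c d -> stabilizes_to d e -> stabilizes_to c e.
Proof. by move=> cd [de se]; split=> //; apply: rt_trans de. Qed.

Lemma reach_stabilizes_to c d e : reach c d -> stabilizes_to c e -> stabilizes_to d e.
Proof.
move=> cd ce; have [f df _] := unique_stabilization d.
by rewrite (stabilizes_to_inj ce (stabilizes_to_reach cd df)).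
Qed.

Lemma reach_addc c d e : reach c d -> reach (addc c e) (addc d e).
Proof.
elim=> {c d} [c _ [v uv ->]|c|c d f _ cd _ df]; [|exact: rt_refl|exact: rt_trans df].
apply: rt_step; exists v; first by rewrite /unstable ffunE (leq_trans uv) ?leq_addr.
apply/ffunP => w; rewrite !ffunE; case: eqP => [->|_]; last by rewrite addnAC.
by rewrite addnBAC.
Qed.

(** A vertex loses grains only by its own firings; with 4 u(v) grains at hand these are legal in any
    order. *)
Lemma reach_fires c d (u : V -> nat) : (forall v, 4 * u v <= c v)%N ->
  (forall v, (d v)%:Z = (c v)%:Z - laplacian (fun x => (u x)%:Z) v) -> reach c d.
Proof.
have [k] := ubnP (\sum_v u v)%N; elim: k c u => // k IH c u lek uc du.
have [|/existsP[v uv]] := boolP [forall v, u v == 0%N].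
  move=> /forallP u0; have -> : d = c; last exact: rt_refl.
  apply/ffunP => v; apply/eqP; rewrite -eqz_nat du (eq_laplacian (z := fun=> 0)); last first.
    by move=> x; rewrite (eqP (u0 x)).
  by rewrite /laplacian mulr0 big1 ?subr0 // => w _; rewrite mulr0.
have uv4 : unstable c v by have := uc v; rewrite /unstable; lia.
pose u' x := (u x - (x == v))%N.
apply: (rt_trans _ _ _ (fire c v)); first by apply: rt_step; exists v.
apply: (IH _ u').
- have lt : (\sum_x u' x < \sum_x u x)%N; last by apply: leq_trans lt _.
  rewrite (bigD1 v) //= [ltnRHS](bigD1 v) //= -addSn leq_add //.
    by rewrite /u' eqxx subn1 prednK // lt0n.
  by apply: leq_sum => x _; apply: leq_subr.
- move=> w; have := uc w; rewrite /u' ffunE; case: eqP => [->|_]; lia.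
move=> w; rewrite du fireE // -addrA -opprD -laplacianD; congr (_ - _).
apply: eq_laplacian => x; rewrite /u'; have [->|_] := eqVneq x v; last by rewrite add0r subn0.
by rewrite -subzn ?lt0n // addrC subrK.
Qed.

(** A large configuration that firing each vertex [k * hill v] times removes again, as in the
    burning test for recurrence. *)
Definition burn (k : nat) : conf := [ffun v => absz (k%:Z * laplacian (fun x => (hill x)%:Z) v)].

Lemma burnE k v : (burn k v)%:Z = laplacian (fun x => (k * hill x)%N%:Z) v.
Proof.
rewrite ffunE gez0_abs; last by rewrite mulr_ge0 // (le_trans _ (laplacian_hill v)).
by rewrite -laplacianZ; apply: eq_laplacian => x; rewrite PoszM.
Qed.

Lemma burn_ge k v : (k <= burn k v)%N.
Proof.
rewrite -lez_nat burnE (eq_laplacian (z := fun x => k%:Z * (hill x)%:Z)); last by move=> x; rewrite PoszM.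
by rewrite laplacianZ ler_peMr // (le_trans _ (laplacian_hill v)).
Qed.

Lemma recurrent_burn c k : recurrent c -> stabilizes_to (addc c (burn k)) c.
Proof.
case=> sc rec; pose a : conf := [ffun v => 4 * (k * hill v)]%N.
have [b ab] := rec a; set x := [ffun v => _] in ab.
have r1 : reach (addc x (burn k)) (addc c (burn k)) by apply: reach_addc; case: ab.
have r2 : reach (addc x (burn k)) x.
  apply: (@reach_fires _ _ (fun v => k * hill v)%N) => v.
    by rewrite !ffunE -addnA leq_addr.
  by rewrite [addc _ _ _]ffunE PoszD burnE addrK.
by apply: reach_stabilizes_to r1 _; apply: stabilizes_to_reach r2 ab.
Qed.

(** Split z = u - u' into positive and negative parts. After adding a large [burn k], firing u from
    c and u' from d leads to one common configuration. *)
Lemma recurrent_unique c d (z : V -> int) : recurrent c -> recurrent d ->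
  (forall v, (c v)%:Z - (d v)%:Z = laplacian z v) -> c = d.
Proof.
move=> rc rd cd; pose u v := absz (Num.max (z v) 0); pose u' v := absz (Num.max (- z v) 0).
have uu v : z v = (u v)%:Z - (u' v)%:Z by rewrite /u /u'; lia.
pose k := (4 * \max_v (u v + u' v))%N.
have kE v : (4 * u v <= k)%N /\ (4 * u' v <= k)%N.
  by have := leq_bigmax (F := fun v => u v + u' v)%N v; rewrite /k; lia.
pose e : conf := [ffun v => absz ((addc c (burn k) v)%:Z - laplacian (fun x => (u x)%:Z) v)].
have lap_le (y : V -> nat) v : laplacian (fun x => (y x)%:Z) v <= (4 * y v)%N%:Z.
  rewrite /laplacian PoszM gerBl; apply: sumr_ge0 => w _.
  by rewrite mulr_ge0.
have ce v : (4 * u v <= addc c (burn k) v)%N.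
  by rewrite ffunE (leq_trans _ (leq_addl _ _)) // (leq_trans _ (burn_ge k v)) //; case: (kE v).
have de v : (4 * u' v <= addc d (burn k) v)%N.
  by rewrite ffunE (leq_trans _ (leq_addl _ _)) // (leq_trans _ (burn_ge k v)) //; case: (kE v).
have eE v : (e v)%:Z = (addc c (burn k) v)%:Z - laplacian (fun x => (u x)%:Z) v.
  rewrite ffunE gez0_abs // subr_ge0; apply: le_trans (lap_le u v) _.
  by rewrite lez_nat ce.
have rce : reach (addc c (burn k)) e by apply: reach_fires eE.
have rde : reach (addc d (burn k)) e.
  apply: (reach_fires de) => v; rewrite eE; have := cd v.
  rewrite (eq_laplacian _ uu) laplacianD laplacianN ![addc _ _ _]ffunE !PoszD; lia.
have se := reach_stabilizes_to rce (recurrent_burn k rc).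
exact: stabilizes_to_inj se (reach_stabilizes_to rde (recurrent_burn k rd)).
Qed.

(** A configuration with at least 3 grains everywhere dominates every stable one, so it is reached
    from any [a] by stabilizing [a] and adding the difference. *)
Lemma stable_recurrent c d : (forall v, 3 <= c v)%N -> stabilizes_to c d -> recurrent d.
Proof.
move=> c3 cd; split; first by case: cd.
move=> a; have [a' [aa' sa'] _] := unique_stabilization a.
have a3 v : (a' v <= c v)%N.
  apply: leq_trans (c3 v); move/forallP: sa' => /(_ v); rewrite /unstable; lia.
pose b : conf := [ffun v => c v - a' v]%N; exists b; apply: stabilizes_to_reach cd.
have <- : addc a' b = c by apply/ffunP => v; rewrite !ffunE subnKC.
exact: reach_addc.
Qed.

Section Symmetry.
Variable g : V -> V.
Hypotheses (gK : involutive g) (g_adj : forall v w, adj (g v) (g w) = adj v w).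

Definition relabel c : conf := [ffun v => c (g v)].

Lemma relabel_reach c d : reach c d -> reach (relabel c) (relabel d).
Proof.
elim=> {c d} [c _ [v uv ->]|c|c d e _ cd _ de]; [|exact: rt_refl|exact: rt_trans de].
apply: rt_step; exists (g v); first by rewrite /unstable ffunE gK.
apply/ffunP => w; rewrite !ffunE -{1}(inj_eq (inv_inj gK)) gK.
by rewrite -(g_adj v) gK.
Qed.

Lemma relabel_stabilizes c d : relabel c = c -> stabilizes_to c d -> relabel d = d.
Proof.
move=> gc cd; have [rcd sd] := cd; apply: stabilizes_to_inj cd; split.
  by rewrite -{1}gc; apply: relabel_reach.
by apply/forallP => v; rewrite /unstable ffunE; apply: (forallP sd).
Qed.

Lemma laplacian_relabel (z : V -> int) v : laplacian (fun x => z (g x)) v = laplacian z (g v).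
Proof.
rewrite /laplacian; congr (_ - _); rewrite [RHS](reindex_inj (inv_inj gK)).
by apply: eq_bigr => w _; rewrite g_adj.
Qed.

(** A function and its reflection have the same Laplacian here, and the Laplacian is injective. *)
Lemma laplacian_sym (z : V -> int) : (forall v, laplacian z (g v) = laplacian z v) ->
  forall v, z (g v) = z v.
Proof.
move=> sz v; apply/eqP; rewrite -subr_eq0; apply/eqP.
apply: (laplacian_inj0 (z := fun v => z (g v) - z v)) => w.
by rewrite laplacianD laplacianN laplacian_relabel sz subrr.
Qed.

End Symmetry.

End Sandpile.

(* Imported only here because these libraries redefine the notations for sets. *)
From mathcomp Require Import finmap all_classical all_reals all_analysis.
From mathcomp Require Import complex.
Import Order.TTheory GRing.Theory Num.Theory.
Local Open Scope complex_scope.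
Local Open Scope ring_scope.

(** * Solving the folded Laplace equation column by column *)

Section FoldedMatrix.
Variables (K : comNzRingType) (m : nat).

Definition fold_mx : 'M[K]_m :=
  \matrix_(i, j) (if i == j then if i.+1 == m then 3%:R else 4%:R
                  else - (path_adj i j)%:R).

Lemma fold_mx_alt : fold_mx = alt_mx K m *m tri_mx K m *m alt_mx K m.
Proof.
apply/matrixP => i j; rewrite mul_mx_alt mul_alt_mx !mxE.
have [->|nij] := eqVneq i j.
  by rewrite -mulrA mulrC -mulrA -exprMn mulrNN mulr1 expr1n mulr1.
case h : (path_adj i j); last by rewrite !mulr0n mulr0 mul0r oppr0.
rewrite !mulr1n mulr1 -exprD /path_adj in h *.
by case/orP: h => /eqP->; rewrite ?addSn ?addnS exprS addnn -signr_odd odd_double mulr1.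
Qed.

Lemma det_cheb_fold n : \det (cheb fold_mx n) = \det (cheb (tri_mx K m) n).
Proof.
have DD := alt_mxK K m; have e : alt_mx K m *m fold_mx = tri_mx K m *m alt_mx K m.
  by rewrite fold_mx_alt !mulmxA [alt_mx K m *m alt_mx K m]DD mul1mx.
have /(congr1 (fun B => alt_mx K m *m B)) := mulmx_cheb n e.
rewrite mulmxA [_ *m alt_mx K m]DD mul1mx => ->; rewrite !det_mulmx mulrCA -det_mulmx.
by rewrite [_ *m _]DD det1 mulr1.
Qed.

(* Chebyshev polynomials of the second kind, in the variable [x / 2]. *)
Fixpoint cheb_snd (A : pzRingType) (x : A) k : A :=
  match k with
  | 0 => 0
  | 1 => 1
  | (k'.+1 as k1).+1 => x * cheb_snd x k1 - cheb_snd x k'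
  end.

(** This is U_(k+1) - U_(k-1) = 2 T_(k+1), as [cheb_snd x k] is U_(k-1)(x / 2). *)
Lemma cheb_sndB (A : pzRingType) (x : A) k : cheb_snd x k.+2 - cheb_snd x k = cheb x k.+1.
Proof.
elim/nat_ind2: k => [||k IH0 IH1]; first by rewrite /= mulr1 !subr0.
  by rewrite /= mulr1 subr0 -addrA -opprD.
rewrite chebS -IH0 -IH1 mulrBr.
rewrite -[cheb_snd x k.+4]/(x * cheb_snd x k.+3 - cheb_snd x k.+2).
rewrite -[in X in _ - X = _]/(x * cheb_snd x k.+1 - cheb_snd x k).
by rewrite !opprB addrACA [RHS]addrACA; congr (_ + _); rewrite addrC.
Qed.

Variable X : 'M[K]_m.
Implicit Types (x : nat -> 'cV[K]_m) (t : 'cV[K]_m).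

(* The solution of the Laplace equation with right hand side [x], computed column
   by column from its first column [t]; the entry [k] is the column [k.-1]. *)
Fixpoint sweep x t k : 'cV[K]_m :=
  match k with
  | 0 => 0
  | 1 => t
  | (k'.+1 as k1).+1 => X *m sweep x t k1 - sweep x t k' - x k'
  end.

Lemma sweepS x t k : sweep x t k.+2 = X *m sweep x t k.+1 - sweep x t k - x k.
Proof. by []. Qed.

Lemma sweepE x t k : sweep x t k = cheb_snd X k *m t + sweep x 0 k.
Proof.
elim/nat_ind2: k => [||k IH0 IH1]; first by rewrite /= mul0mx addr0.
  by rewrite /= addr0 [1 *m t]mul1mx.
rewrite !sweepS IH0 IH1 -[cheb_snd X k.+2]/(X *m cheb_snd X k.+1 - cheb_snd X k).
by rewrite mulmxBl mulmxDr mulmxA opprD addrACA !addrA.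
Qed.

Lemma sweepB x x' k : sweep (fun j => x j - x' j) 0 k = sweep x 0 k - sweep x' 0 k.
Proof.
elim/nat_ind2: k => [||k IH0 IH1]; rewrite ?subr0 // !sweepS IH0 IH1 mulmxBr !opprD !opprK.
by rewrite [RHS]addrACA; congr (_ + _); rewrite [RHS]addrACA.
Qed.

Lemma eq_sweep x x' t k : (forall j, (j.+1 < k)%N -> x j = x' j) -> sweep x t k = sweep x' t k.
Proof.
elim/nat_ind2: k => [||k IH0 IH1] xx' //; rewrite !sweepS xx' // IH0 ?IH1 //.
  by move=> j jk; apply: xx'; apply: ltn_trans jk _.
by move=> j jk; apply: xx'; apply: ltn_trans jk _.
Qed.

End FoldedMatrix.

Section Kernel.
Variables (K : comNzRingType) (m n : nat).
Local Notation X := (fold_mx K m).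
Implicit Types (y : nat -> nat -> K).

Definition column y j : 'cV[K]_m := \col_(i < m) y i j.

(* The Laplacian of the unfolding of [y] to the [2m] by [2n - 1] grid. *)
Definition fold_laplacian y j : 'cV[K]_m :=
  X *m column y j - (if (0 < j)%N then column y j.-1 else 0)
    - (if j.+1 == n then if (0 < j)%N then column y j.-1 else 0 else column y j.+1).

(** The sweep solves the equation on the whole board if its continuation past the last column
    mirrors the column before the last. This is the part of that condition independent of the first
    column. *)
Definition obstruction (x : nat -> 'cV[K]_m) : 'cV[K]_m :=
  sweep X x 0 n.-1 - sweep X x 0 n.+1.

Lemma obstructionE (x : nat -> 'cV[K]_m) t : (0 < n)%N ->
  sweep X x t n.+1 - sweep X x t n.-1 = cheb X n *m t - obstruction x.
Proof.
rewrite /obstruction; case: n => // k _; rewrite !(sweepE _ _ t) -cheb_sndB -[k.+1.-1]/k.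
move: (cheb_snd X k.+2) (cheb_snd X k) (sweep X x 0 k.+2) (sweep X x 0 k) => a b u v.
by rewrite mulmxBl opprD opprB addrACA.
Qed.

Lemma sweep_columns y (x : nat -> 'cV[K]_m) :
  (0 < n)%N -> (forall j, (j < n)%N -> fold_laplacian y j = x j) ->
  cheb X n *m column y 0 = obstruction x.
Proof.
move=> n0 yx; have w j : (j < n)%N -> sweep X x (column y 0) j.+1 = column y j.
  elim/nat_ind2: j => [||j IH0 IH1] jn //.
    by rewrite sweepS -yx ?(ltnW jn) // /fold_laplacian (ltn_eqF jn) /= !subr0 opprB addrC subrK.
  rewrite sweepS IH1 ?(ltnW jn) // IH0; last by do 2 apply: ltnW.
  by rewrite -yx ?(ltnW jn) // /fold_laplacian (ltn_eqF jn) /= opprB addrC subrK.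
apply/eqP; rewrite -subr_eq0 -obstructionE // subr_eq0; apply/eqP.
move: w yx n0; rewrite /fold_laplacian; case: n => // k w yx _.
rewrite sweepS w // -yx // eqxx -[k.+1.-1]/k.
have -> : sweep X x (column y 0) k = if (0 < k)%N then column y k.-1 else 0.
  by case: k w {yx} => // k w; rewrite w.
by rewrite opprB addrC subrK.
Qed.

Lemma columns_sweep (x : nat -> 'cV[K]_m) t (y := fun i j =>
    if insub i is Some k then sweep X x t j.+1 k 0 else 0) :
  (0 < n)%N -> cheb X n *m t = obstruction x ->
  forall j, (j < n)%N -> fold_laplacian y j = x j.
Proof.
move=> n0 ct; have cy j : column y j = sweep X x t j.+1.
  by apply/colP => i; rewrite mxE /y valK.
have wn : sweep X x t n.+1 = sweep X x t n.-1.
  by apply/eqP; rewrite -subr_eq0 obstructionE // ct subrr.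
move=> j jn; rewrite /fold_laplacian !cy.
have -> : (if (0 < j)%N then sweep X x t j.-1.+1 else 0) = sweep X x t j by case: j {jn}.
have -> : (if j.+1 == n then sweep X x t j else sweep X x t j.+2) = sweep X x t j.+2.
  by case: eqP => // jn1; rewrite jn1 wn -jn1.
by rewrite sweepS opprB addrC subrK.
Qed.

Lemma obstructionB x x' : obstruction (fun j => x j - x' j) = obstruction x - obstruction x'.
Proof.
rewrite /obstruction !sweepB !opprB addrACA [RHS]addrACA; congr (_ + _).
exact: addrC.
Qed.

Lemma eq_obstruction x x' : (forall j, (j < n)%N -> x j = x' j) -> obstruction x = obstruction x'.
Proof.
move=> xx'; rewrite /obstruction; congr (_ - _); apply: eq_sweep => j jn; apply: xx'; first by lia.
by rewrite -ltnS.
Qed.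

(** A right hand side supported in the last column keeps the sweep from 0 equal to 0 until entry
    [n.+1], which is - v. *)
Lemma obstruction_surj (v : 'cV[K]_m) : (0 < n)%N ->
  obstruction (fun j => if j.+1 == n then v else 0) = v.
Proof.
move=> n0; rewrite /obstruction; set x := fun j => _.
have w k : (k <= n)%N -> sweep X x 0 k = 0.
  elim/nat_ind2: k => [||k IH0 IH1] kn //.
  by rewrite sweepS IH1 ?(ltnW kn) // IH0 ?mulmx0 ?subr0 /x ?ltn_eqF ?subr0 //; do 2 apply: ltnW.
rewrite w ?leq_pred // sub0r; move: w n0; rewrite /x; case: n => // k w _.
by rewrite sweepS !w // mulmx0 eqxx subrr sub0r opprK.
Qed.

End Kernel.

Lemma card_fset_set_rel (T : choiceType) (B : finType) (S : set T) (P : B -> T -> Prop) :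
  finite_set S ->
  (forall b, exists2 c, S c & P b c) -> (forall c, S c -> exists b, P b c) ->
  (forall b c c', S c -> S c' -> P b c -> P b c' -> c = c') ->
  (forall b b' c, P b c -> P b' c -> b = b') ->
  #|` fset_set S| = #|B|.
Proof.
move=> finS surj tot inj fct; have [f Pf] := choice (fun b => let: ex_intro2 c Sc Pc := surj b in ex_intro _ c (conj Sc Pc)).
have injf : injective f by move=> b b' e; apply: (fct _ _ (f b)); [case: (Pf b)|rewrite e; case: (Pf b')].
have -> : fset_set S = [fset f b | b in B]%fset.
  apply/fsetP => c; rewrite in_fset_set //; apply/idP/imfsetP => [|[b _ ->]].
    rewrite inE => Sc; have [b Pb] := tot c Sc; exists b => //.
    by have [Sf Pfb] := Pf b; apply: inj Pb Pfb.
  by rewrite inE; case: (Pf b).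
by rewrite card_imfset //= -cardE.
Qed.

Lemma card_dffun_ord m (D : 'I_m -> nat) : #|{dffun forall i : 'I_m, 'I_(D i)}| = (\prod_i D i)%N.
Proof.
transitivity #|(family (fun i : 'I_m => (predT : pred 'I_(D i))) :
    simpl_pred {dffun forall i : 'I_m, 'I_(D i)})|.
  by apply: eq_card => f; rewrite !inE; apply/esym/familyP.
rewrite card_family foldrE big_map big_enum /=.
by apply: eq_bigr => i _; rewrite card_ord.
Qed.

Lemma fold_mx_column m (y : nat -> nat -> int) j (i : 'I_m) :
  (fold_mx int m *m column m y j) i 0 =
  4%:R * y i j - ((0 < i)%N%:R * y i.-1 j + (i.+1 < m)%N%:R * y i.+1 j)
  - (i.+1 == m)%N%:R * y i j.
Proof.
rewrite -(sum_path_adj (fun k => y k j) (ltn_ord i)) mxE.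
rewrite (bigD1 i) //= [in RHS](bigD1 i) //= !mxE eqxx.
have -> : path_adj i i = false by rewrite /path_adj; lia.
rewrite mul0r add0r -addrAC -mulrBl; congr (_ * _ + _); last first.
  rewrite -sumrN; apply: eq_bigr => k nk.
  by rewrite !mxE eq_sym (negbTE nk) mulNr.
by case: eqP; rewrite ?subr0.
Qed.

(** * Symmetric functions on the grid and their classes modulo the Laplacian *)

Section Symmetric.
Variables (m n : nat).
Hypotheses (m_gt0 : (0 < m)%N) (n_gt0 : (0 < n)%N).
Local Notation p := (2 * m)%N.
Local Notation q := (2 * n - 1)%N.
Local Notation V := (gvertex p q).

Definition fold_row a := if (a < m)%N then a else (2 * m - a.+1)%N.
Definition fold_col b := if (b < n)%N then b else (2 * n - b.+2)%N.

Definition unfolding (y : nat -> nat -> int) a b := y (fold_row a) (fold_col b).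

(** Row m is the mirror image of row m - 1, which turns the last diagonal entry 4 into 3. Column n
    mirrors column n - 2, because column n - 1 lies on the axis. *)
Lemma laplacian_unfolding y (a : 'I_p) (b : 'I_q) (i : 'I_m) : a = i :> nat -> (b < n)%N ->
  laplacian (fun v : V => unfolding y v.1 v.2) (a, b) = fold_laplacian m n y b i 0.
Proof.
move=> ai bn; rewrite laplacianE mxE mxE fold_mx_column ai.
have im := ltn_ord i; have bq := ltn_ord b.
have fi k : (k < m)%N -> fold_row k = k by rewrite /fold_row => ->.
have fj k : (k < n)%N -> fold_col k = k by rewrite /fold_col => ->.
rewrite /unfolding (fi i im) (fi i.-1) ?(fj b bn) ?(fj b.-1); try lia.
have -> : (i.+1 < p)%N by lia.
have -> : y (fold_row i.+1) b = if i.+1 == m then y i b else y i.+1 b.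
  by rewrite /fold_row; case: eqP => e; [rewrite e ltnn; congr y; lia | rewrite ifT //; lia].
have -> : (b.+1 < q)%N%:R * y i (fold_col b.+1) =
    if b.+1 == n then (0 < b)%N%:R * y i b.-1 else y i b.+1.
  rewrite /fold_col; case: eqP => e.
    rewrite e ltnn; have -> : (n < q)%N = (0 < b)%N by lia.
    by congr (_ * y i _); lia.
  have -> : (b.+1 < q)%N by lia.
  by rewrite ifT ?mul1r //; lia.
have -> : (i.+1 == m) = ~~ (i.+1 < m)%N by lia.
rewrite mul1r !mxE.
have colE j : column m y j i 0 = y i j by rewrite mxE.
case: (0 < b)%N; case: (b.+1 == n); case: (i.+1 < m)%N; rewrite /= ?colE ?mxE; ring.
Qed.

Definition flip_row (v : V) : V := (rev_ord v.1, v.2).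
Definition flip_col (v : V) : V := (v.1, rev_ord v.2).

Lemma flip_rowK : involutive flip_row.
Proof. by case=> a b; rewrite /flip_row /= rev_ordK. Qed.

Lemma flip_colK : involutive flip_col.
Proof. by case=> a b; rewrite /flip_col /= rev_ordK. Qed.

Lemma flip_row_adj v w : @grid_adj p q (flip_row v) (flip_row w) = grid_adj v w.
Proof.
case: v w => [a b] [a' b']; rewrite /grid_adj /=.
by have := ltn_ord a; have := ltn_ord a'; lia.
Qed.

Lemma flip_col_adj v w : @grid_adj p q (flip_col v) (flip_col w) = grid_adj v w.
Proof.
case: v w => [a b] [a' b']; rewrite /grid_adj /=.
by have := ltn_ord b; have := ltn_ord b'; lia.
Qed.

Definition flip_symmetric (z : V -> int) :=
  (forall v, z (flip_row v) = z v) /\ (forall v, z (flip_col v) = z v).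

Lemma flip_symmetricB y z : flip_symmetric y -> flip_symmetric z -> flip_symmetric (fun v => y v - z v).
Proof. by case=> y1 y2 [z1 z2]; split=> v; rewrite ?y1 ?z1 ?y2 ?z2. Qed.

Lemma symmetric_unfolding y : flip_symmetric (fun v => unfolding y v.1 v.2).
Proof.
split=> -[a b]; rewrite /unfolding /=; congr y.
  have := ltn_ord a; rewrite /fold_row; move: (nat_of_ord a) => k kp.
  by case: (ltnP k m) => k1; case: (ltnP (p - k.+1) m) => k2; lia.
have := ltn_ord b; rewrite /fold_col; move: (nat_of_ord b) => k kq.
by case: (ltnP k n) => k1; case: (ltnP (q - k.+1) n) => k2; lia.
Qed.

Lemma flip_symmetric_eq y z : flip_symmetric y -> flip_symmetric z ->
  (forall (a : 'I_p) (b : 'I_q), (a < m)%N -> (b < n)%N -> y (a, b) = z (a, b)) -> y =1 z.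
Proof.
move=> [y1 y2] [z1 z2] yz [a b].
have {}yz (b' : 'I_q) : (b' < n)%N -> y (a, b') = z (a, b').
  move=> bn; have [am|am] := ltnP a m; first exact: yz.
  rewrite -y1 -z1; apply: yz => //=; have := ltn_ord a; lia.
have [bn|bn] := ltnP b n; first exact: yz.
rewrite -y2 -z2; apply: yz => /=; have := ltn_ord b; lia.
Qed.

Definition grid_value (z : V -> int) (i j : nat) : int :=
  if (insub i, insub j) is (Some a, Some b) then z (a, b) else 0.

Lemma grid_valueE z (a : 'I_p) (b : 'I_q) : grid_value z a b = z (a, b).
Proof. by rewrite /grid_value !valK. Qed.

Lemma grid_value_unfolding y (i : 'I_m) j : (j < n)%N ->
  grid_value (fun v => unfolding y v.1 v.2) i j = y i j.
Proof.
move=> jn; have ip : (i < p)%N by have := ltn_ord i; lia.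
have jq : (j < q)%N by lia.
rewrite -[i : nat]/(nat_of_ord (Ordinal ip)) -[j]/(nat_of_ord (Ordinal jq)) grid_valueE.
by rewrite /unfolding /fold_row /fold_col /= ltn_ord jn.
Qed.

Lemma unfolding_grid_value z : flip_symmetric z -> z =1 (fun v => unfolding (grid_value z) v.1 v.2).
Proof.
move=> sz; apply: (flip_symmetric_eq sz (symmetric_unfolding _)) => a b am bn.
by rewrite /unfolding /fold_row /fold_col /= am bn grid_valueE.
Qed.

Lemma column_grid_valueB y z j :
  column m (grid_value (fun v => y v - z v)) j =
  column m (grid_value y) j - column m (grid_value z) j.
Proof.
apply/colP => i; rewrite !mxE /grid_value.
by case: insub => [a|]; [case: insub => [b|]|]; rewrite ?subr0.
Qed.

(** A preimage of a symmetric function is itself symmetric, so only its folded part matters; the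
    sweep turns the existence of that part into one linear system. *)
Lemma laplacian_image z : flip_symmetric z ->
  (exists u, forall v, laplacian u v = z v) <->
  (exists t, cheb (fold_mx int m) n *m t = obstruction n (column m (grid_value z))).
Proof.
move=> sz; split=> [[u uz]|[t tz]].
  have su : flip_symmetric u.
    case: sz => z1 z2; split.
      by apply: (laplacian_sym flip_rowK flip_row_adj) => v; rewrite !uz z1.
    by apply: (laplacian_sym flip_colK flip_col_adj) => v; rewrite !uz z2.
  exists (column m (grid_value u) 0); apply: sweep_columns => // j jn.
  apply/colP => i; have ip : (i < p)%N by have := ltn_ord i; lia.
  have jq : (j < q)%N by lia.
  have := @laplacian_unfolding (grid_value u) (Ordinal ip) (Ordinal jq) i erefl jn.
  rewrite /= => <-; rewrite mxE -[i : nat]/(nat_of_ord (Ordinal ip)).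
  rewrite -[in RHS](_ : nat_of_ord (Ordinal jq) = j) // grid_valueE -uz.
  by apply: eq_laplacian => v; rewrite -unfolding_grid_value.
pose x := column m (grid_value z).
have := columns_sweep n_gt0 tz; set y := fun i j => _ => yx.
exists (fun v : V => unfolding y v.1 v.2); have [u1 u2] := symmetric_unfolding y.
apply: flip_symmetric_eq sz _.
  split=> v.
    by rewrite -(laplacian_relabel flip_rowK flip_row_adj); apply: eq_laplacian => w; rewrite u1.
  by rewrite -(laplacian_relabel flip_colK flip_col_adj); apply: eq_laplacian => w; rewrite u2.
move=> a b am bn; rewrite (@laplacian_unfolding y a b (Ordinal am)) // yx //.
by rewrite mxE /= grid_valueE.
Qed.

Lemma symmetric_conf (c : configuration p q) :
  grid_symmetric c <-> flip_symmetric (fun v => (c v)%:Z).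
Proof.
split=> [sc|[c1 c2] a b]; last first.
  have [] := c1 (a, b); have [] := c2 (a, b); rewrite /flip_row /flip_col /=.
  by move=> -> ->.
by split=> -[a b]; rewrite /flip_row /flip_col /=; have [e1 e2] := sc a b; rewrite -?e1 -?e2.
Qed.

Lemma symmetric_stabilizes (c d : configuration p q) :
  flip_symmetric (fun v => (c v)%:Z) -> stabilizes_to c d -> flip_symmetric (fun v => (d v)%:Z).
Proof.
move=> [c1 c2] cd; split=> v.
  have rc : relabel flip_row c = c by apply/ffunP => w; rewrite ffunE; have [] := c1 w.
  by rewrite -[in RHS](relabel_stabilizes flip_rowK flip_row_adj rc cd) ffunE.
have rc : relabel flip_col c = c by apply/ffunP => w; rewrite ffunE; have [] := c2 w.
by rewrite -[in RHS](relabel_stabilizes flip_colK flip_col_adj rc cd) ffunE.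
Qed.

(* Every symmetric integer function is congruent, modulo the Laplacian of an
   integer function, to a symmetric recurrent. *)
Lemma symmetric_recurrent_repr z : flip_symmetric z ->
  exists2 c, symmetric_recurrents p q c & exists u, forall v, laplacian u v = z v - (c v)%:Z.
Proof.
move=> sz; pose k := (3 + \sum_v `|z v|)%N.
have lap_ge (v : V) : (k : int) <= laplacian (fun x => (k * hill x)%N%:Z) v.
  by rewrite -(burnE k) lez_nat burn_ge.
have zk (v : V) : - (k : int) + 3%:R <= z v.
  have : (`|z v| <= \sum_v `|z v|)%N by rewrite [leqRHS](bigD1 v) //= leq_addr.
  by rewrite /k; lia.
pose c0 : configuration p q := [ffun v => absz (z v + laplacian (fun x => (k * hill x)%N%:Z) v)].
have c0E v : (c0 v)%:Z = z v + laplacian (fun x => (k * hill x)%N%:Z) v.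
  by rewrite ffunE gez0_abs //; have := lap_ge v; have := zk v; lia.
have s0 : flip_symmetric (fun v => (c0 v)%:Z).
  have hs : flip_symmetric (fun v => (k * hill v)%N%:Z).
    split=> -[a b] //; rewrite /hill /=; congr (_ * _)%N%:Z; rewrite mulnC; congr (_ * _)%N;
      have := ltn_ord a; lia.
  case: sz hs => z1 z2 [h1 h2]; split=> v; rewrite !c0E ?z1 ?z2; congr (_ + _).
    by rewrite -(laplacian_relabel flip_rowK flip_row_adj); apply: eq_laplacian => w; rewrite h1.
  by rewrite -(laplacian_relabel flip_colK flip_col_adj); apply: eq_laplacian => w; rewrite h2.
have [c cc _] := unique_stabilization c0; exists c.
  split; last by apply/symmetric_conf; apply: symmetric_stabilizes cc.
  apply: stable_recurrent cc => v; rewrite -lez_nat c0E.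
  by have := lap_ge v; have := zk v; lia.
have [u hu] := reach_laplacian (proj1 cc).
exists (fun v => u v - (k * hill v)%N%:Z) => v.
by rewrite laplacianD laplacianN hu c0E; lia.
Qed.

End Symmetric.

Lemma unitmx_absz_det m (L : 'M[int]_m) : L \in unitmx -> `|\det L|%N = 1%N.
Proof. by rewrite unitmxE => /orP[] /eqP->. Qed.

Lemma Smith_solvable m (T L R : 'M[int]_m) (d : seq int) (v : 'cV_m) :
  L \in unitmx -> R \in unitmx ->
  T = L *m \matrix_(i, j) (d`_i *+ (i == j :> nat)) *m R ->
  (exists t, T *m t = v) <-> (forall i : 'I_m, (d`_i %| ((invmx L *m v) i 0)%R)%Z).
Proof.
move=> uL uR TE; set Dg := \matrix_(i, j) _ in TE.
have DgE (s : 'cV[int]_m) (i : 'I_m) : (Dg *m s) i 0 = d`_i * s i 0.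
  rewrite mxE (bigD1 i) //= mxE eqxx mulr1n big1 ?addr0 // => k nk.
  by rewrite mxE eq_sym (negbTE (nk : (k : nat) != i)) mulr0n mul0r.
split=> [[t <-] i|dv].
  by rewrite TE -!mulmxA mulKmx // DgE dvdz_mulr.
pose s : 'cV[int]_m := \col_i (((invmx L *m v) i 0)%R %/ d`_i)%Z.
exists (invmx R *m s); rewrite TE -!mulmxA mulKVmx //.
have -> : Dg *m s = invmx L *m v.
  by apply/colP => i; rewrite DgE mxE mulrC divzK.
by rewrite mulKVmx.
Qed.

(** In Smith coordinates, the residues of the obstruction modulo the invariant factors separate the
    classes of symmetric functions modulo the Laplacian and take all values; each class contains
    exactly one symmetric recurrent. *)
Lemma card_symmetric_recurrents m n : (0 < m)%N -> (0 < n)%N ->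
  \det (cheb (tri_mx int m) n) != 0 ->
  num_symmetric_recurrents (2 * m) (2 * n - 1) = `|\det (cheb (tri_mx int m) n)|%N.
Proof.
move=> m0 n0; rewrite -det_cheb_fold; set T := cheb _ n => T0.
have [L uL [R uR [d _ TE]]] := int_Smith_normal_form T.
have detT : `|\det T|%N = (\prod_(i < m) absz (d`_i)%R)%N.
  rewrite TE !det_mulmx !abszM (unitmx_absz_det uL) (unitmx_absz_det uR) mul1n muln1.
  rewrite (_ : \matrix_(i, j) _ = diag_mx (\row_i d`_i)); last first.
    by apply/matrixP => i j; rewrite !mxE.
  rewrite det_diag (big_morph absz abszM (erefl : `|1|%N = 1%N)).
  by apply: eq_bigr => i _; rewrite mxE.
have d0 (i : 'I_m) : d`_i != 0.
  have : (0 < `|\det T|)%N by rewrite absz_gt0.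
  by rewrite detT (bigD1 i) //= muln_gt0 absz_gt0 => /andP[].
rewrite detT -card_dffun_ord.
pose ob (z : gvertex (2 * m) (2 * n - 1) -> int) :=
  invmx L *m obstruction n (column m (grid_value z)).
have obB y z : ob (fun v => y v - z v) = ob y - ob z.
  rewrite /ob -mulmxBr -obstructionB; congr (_ *m _); apply: eq_obstruction => j _.
  exact: column_grid_valueB.
have obP z : flip_symmetric z -> (exists u, forall v, laplacian u v = z v) <->
    forall i : 'I_m, (d`_i %| (ob z i 0)%R)%Z.
  move=> sz; apply: iff_trans (laplacian_image m0 n0 sz) _.
  exact: (Smith_solvable _ uL uR TE).
have ob_sym (c : configuration (2 * m) (2 * n - 1)) :
    symmetric_recurrents _ _ c -> flip_symmetric (fun v => (c v)%:Z).
  by case=> _ /symmetric_conf.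
pose P (r : {dffun forall i : 'I_m, 'I_(absz d`_i)}) (c : configuration (2 * m) (2 * n - 1)) :=
  forall i : 'I_m, ((ob (fun v => (c v)%:Z) i 0)%R %% d`_i)%Z = (r i : nat).
apply: (card_fset_set_rel (P := P)).
- exact: finite_symmetric_recurrents.
(* Prescribed residues are realized by a function supported in the last column, whose obstruction is
   that column. *)
- move=> r; pose x j : 'cV[int]_m := if j.+1 == n then L *m \col_i (r i : nat)%:Z else 0.
  pose y i j : int := if insub i is Some k then x j (k : 'I_m) 0 else 0.
  have sy := symmetric_unfolding m0 n0 y.
  have [c Sc uc] := symmetric_recurrent_repr m0 n0 sy; exists c => // i.
  have oby : ob (fun v => unfolding m n y v.1 v.2) i 0 = (r i : nat)%:Z.
    rewrite /ob (eq_obstruction (x' := x)) => [|j jn]; last first.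
      by apply/colP => k; rewrite mxE grid_value_unfolding // /y valK.
    by rewrite obstruction_surj // mulKmx // mxE.
  have /(obP _ (flip_symmetricB sy (ob_sym c Sc)))/(_ i) := uc.
  rewrite obB mxE [X in _ + X]mxE oby -eqz_mod_dvd => /eqP <-.
  by rewrite -modz_abs modz_small //; have := ltn_ord (r i); lia.
- move=> c _; have lt (i : 'I_m) : (absz ((ob (fun v => (c v)%:Z) i 0)%R %% d`_i)%Z < absz (d`_i)%R)%N.
    by rewrite -ltz_nat !abszE ger0_norm ?modz_ge0 // ltz_mod.
  exists [ffun i => Ordinal (lt i)] => i; rewrite ffunE /= abszE ger0_norm //.
  exact: modz_ge0.
- move=> r c c' Sc Sc' rc rc'.
  have /(obP _ (flip_symmetricB (ob_sym c Sc) (ob_sym c' Sc')))[u uE] :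
      forall i : 'I_m, (d`_i %| (ob (fun v => (c v)%:Z - (c' v)%:Z) i 0)%R)%Z.
    by move=> i; rewrite obB mxE [X in _ + X]mxE -eqz_mod_dvd rc rc'.
  exact: (recurrent_unique (proj1 Sc) (proj1 Sc') (fun v => esym (uE v))).
move=> r r' c rc rc'; apply/ffunP => i; apply: ord_inj; apply/eqP.
by rewrite -eqz_nat -rc rc'.
Qed.

(** * Roots and eigenvalues *)

Lemma rmorph_cheb (A B : pzRingType) (f : {rmorphism A -> B}) (x : A) n :
  f (cheb x n) = cheb (f x) n.
Proof.
elim/nat_ind2: n => [||n IH0 IH1] //; first by rewrite /= rmorph_nat.
by rewrite !chebS rmorphB rmorphM IH0 IH1.
Qed.

Lemma cheb_double (A : comPzRingType) (x : A) n : cheb x n.*2 = cheb (x ^+ 2 - 2%:R) n.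
Proof.
elim/nat_ind2: n => [||n IH0 IH1]; first by rewrite double0.
  by rewrite -[1.*2]/2%N chebS expr2.
rewrite [RHS]chebS -IH0 -IH1 !doubleS !chebS.
by move: (cheb x n.*2) (cheb x n.*2.+1) => a b; ring.
Qed.

Lemma chebN (A : comPzRingType) (x : A) n : cheb (- x) n = (-1) ^+ n * cheb x n.
Proof.
elim/nat_ind2: n => [||n IH0 IH1]; first by rewrite /= expr0 mul1r.
  by rewrite /= expr1 mulN1r.
by rewrite !chebS IH0 IH1 !exprS; ring.
Qed.

Lemma cheb_chebyshevT (A : comNzRingType) (x : A) n :
  2%:R * (chebyshevT A n).[x] = cheb (2%:R * x) n.
Proof.
elim/nat_ind2: n => [||n IH0 IH1]; first by rewrite /= hornerC mulr1.
  by rewrite /= hornerX.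
rewrite chebS -IH0 -IH1.
rewrite -[chebyshevT A n.+2]/(2%:R * 'X * chebyshevT A n.+1 - chebyshevT A n).
by rewrite hornerD hornerN !hornerM hornerX -polyC_natr hornerC; ring.
Qed.

Lemma horner_cheb (A : comNzRingType) (p : {poly A}) (x : A) n :
  (cheb p n).[x] = cheb p.[x] n.
Proof.
elim/nat_ind2: n => [||n IH0 IH1] //; first by rewrite /= -polyC_natr hornerC.
by rewrite !chebS hornerD hornerN hornerM IH0 IH1.
Qed.

Section Roots.
Variable R : realType.

Lemma cheb_cos (x : R) n : cheb (2%:R * cos x) n = 2%:R * cos (n%:R * x).
Proof.
elim/nat_ind2: n => [||n IH0 IH1]; first by rewrite /= mul0r cos0 mulr1.
  by rewrite /= mul1r.
rewrite chebS IH0 IH1.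
have -> : n%:R * x = n.+1%:R * x - x by rewrite -natr1; ring.
have -> : n.+2%:R * x = n.+1%:R * x + x by rewrite -[n.+2%:R]natr1; ring.
by rewrite !cosD cosN sinN; ring.
Qed.

Lemma sin_natpi n : sin (n%:R * pi) = 0 :> R.
Proof.
elim: n => [|n IH]; first by rewrite mul0r sin0.
by rewrite -natr1 mulrDl mul1r sinDpi IH oppr0.
Qed.

Lemma cos_odd_pihalf n : cos ((2 * n + 1)%N%:R * (pi / 2%:R)) = 0 :> R.
Proof.
elim: n => [|n IH]; first by rewrite muln0 add0n mul1r cos_pihalf.
have -> : (2 * n.+1 + 1)%N%:R * (pi / 2%:R) = (2 * n + 1)%N%:R * (pi / 2%:R) + pi :> R.
  rewrite (_ : (2 * n.+1 + 1 = 2 * n + 1 + 2)%N); last by lia.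
  by rewrite [(_ + 2)%N%:R]natrD; field.
by rewrite cosDpi IH oppr0.
Qed.

(** In this form subtraction from an eigenvalue gives the factor of the double product; [cheb_rootE]
    is the form with a single cosine. *)
Definition cheb_root n (k : nat) : R :=
  2%:R - 4%:R * cos ((2 * k + 1)%N%:R * pi / (4 * n)%N%:R) ^+ 2.

Lemma cheb_rootE n k : (0 < n)%N ->
  cheb_root n k = - (2%:R * cos ((2 * k + 1)%N%:R * pi / (2 * n)%N%:R)).
Proof.
move=> n0; have n0' : (n%:R : R) != 0 by rewrite pnatr_eq0 -lt0n.
have -> : (2 * k + 1)%N%:R * pi / (2 * n)%N%:R =
    ((2 * k + 1)%N%:R * pi / (4 * n)%N%:R) *+ 2 :> R by rewrite !natrM; field.
by rewrite cos_mulr2n /cheb_root; ring.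
Qed.

Lemma cheb_rootP n k : (0 < n)%N -> cheb (cheb_root n k) n = 0.
Proof.
move=> n0; have n0' : (n%:R : R) != 0 by rewrite pnatr_eq0 -lt0n.
rewrite cheb_rootE // chebN cheb_cos.
have -> : n%:R * ((2 * k + 1)%N%:R * pi / (2 * n)%N%:R) = (2 * k + 1)%N%:R * (pi / 2%:R) :> R.
  by rewrite !natrM; field.
by rewrite cos_odd_pihalf !mulr0.
Qed.

Lemma cheb_root_inj n : {in [pred k | k < n]%N &, injective (cheb_root n)}.
Proof.
move=> k l; rewrite !inE => kn ln; have n0 : (0 < n)%N by apply: leq_ltn_trans kn.
have n0' : (n%:R : R) != 0 by rewrite pnatr_eq0 -lt0n.
rewrite !cheb_rootE // => /oppr_inj/(mulfI _) e.
have itv j : (j < n)%N -> (2 * j + 1)%N%:R * pi / (2 * n)%N%:R \in `[0, pi : R].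
  move=> jn; rewrite in_itv /=; apply/andP; split.
    by rewrite divr_ge0 // mulr_ge0 // pi_ge0.
  rewrite ler_pdivrMr ?ltr0n ?muln_gt0 // mulrC ler_wpM2l ?pi_ge0 // ler_nat; lia.
have := cos_inj (itv _ kn) (itv _ ln) (e _); rewrite pnatr_eq0 => /(_ isT).
move=> /(congr1 (fun x => x * (2 * n)%N%:R)); rewrite !divfK; try by rewrite pnatr_eq0; lia.
move/(mulIf (lt0r_neq0 (pi_gt0 R)))/eqP; rewrite eqr_nat => /eqP; lia.
Qed.

Lemma size_cheb (K : fieldType) n : size (cheb ('X : {poly K}) n.+1) = n.+2 /\
  lead_coef (cheb ('X : {poly K}) n.+1) = 1.
Proof.
elim/nat_ind2: n => [||n [sz0 _] [sz1 lc1]]; first by rewrite /= size_polyX lead_coefX.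
  rewrite /= -expr2 -polyC_natr -['X^2 - _]/('X^2 - 2%:R%:P).
  by rewrite size_XnsubC //; split=> //; apply/monicP/monicXnsubC.
rewrite chebS; have sX : size ('X * cheb ('X : {poly K}) n.+2) = n.+4.
  by rewrite mulrC size_mulX ?sz1 // -size_poly_gt0 sz1.
rewrite size_polyDl ?size_polyN ?sX ?sz0 // lead_coefDl ?size_polyN ?sX ?sz0 //.
by rewrite lead_coefM lead_coefX lc1 mulr1.
Qed.

Lemma cheb_factor n : (0 < n)%N ->
  cheb ('X : {poly R}) n = \prod_(k < n) ('X - (cheb_root n k)%:P).
Proof.
case: n => // n n0; have [sz lc] := size_cheb R n.
rewrite (@all_roots_prod_XsubC _ (cheb 'X n.+1) [seq cheb_root n.+1 k | k <- iota 0 n.+1]).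
- by rewrite lc scale1r big_map -[X in iota _ X]subn0 -/(index_iota 0 n.+1) big_mkord.
- by rewrite sz size_map size_iota.
- by apply/allP => _ /mapP[k _ ->]; rewrite /root horner_cheb hornerX cheb_rootP.
rewrite uniq_rootsE map_inj_in_uniq ?iota_uniq // => k l.
by rewrite !mem_iota !add0n => kn ln; apply: cheb_root_inj; rewrite inE.
Qed.

End Roots.

(** * The spectrum of the tridiagonal matrix *)

Section Eigenvalues.

(** The [m] eigenvalues are distinct, so they are all the roots of the monic characteristic
    polynomial, which is evaluated at [mu]. *)
Lemma det_sub_eigen (F : fieldType) m (A : 'M[F]_m) (l : 'I_m -> F) (mu : F) :
  injective l -> (forall i, eigenvalue A (l i)) ->
  \det (A - mu%:M) = \prod_i (l i - mu).
Proof.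
move=> injl eigl; have cp : char_poly A = \prod_(z <- [seq l i | i <- enum 'I_m]) ('X - z%:P).
  rewrite [LHS](@all_roots_prod_XsubC _ _ [seq l i | i <- enum 'I_m]).
  - by rewrite (monicP (char_poly_monic A)) scale1r.
  - by rewrite size_char_poly size_map size_enum_ord.
  - by apply/allP => _ /mapP[i _ ->]; rewrite -eigenvalue_root_char.
  by rewrite uniq_rootsE map_inj_uniq ?enum_uniq.
have e : (char_poly A).[mu] = \det (mu%:M - A).
  rewrite /char_poly -[_.[mu]]/(horner_eval mu _) -det_map_mx; congr (\det _).
  apply/matrixP => i j; rewrite !mxE /= /horner_eval hornerD hornerN hornerC.
  by rewrite hornerMn hornerX.
rewrite -opprB -scaleN1r detZ -e cp horner_prod big_map big_enum /=.
rewrite -[m in _ ^+ m]card_ord -prodr_const -big_split /=.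
by apply: eq_bigr => i _; rewrite hornerXsubC mulN1r opprB.
Qed.

Variable R : realType.

Definition tri_angle m (h : nat) : R := h.+1%:R * pi / (2 * m + 1)%N%:R.

Definition tri_eigen m h : R := 2%:R + 4%:R * cos (tri_angle m h) ^+ 2.

Lemma tri_eigenE m h : tri_eigen m h = 4%:R + 2%:R * cos (tri_angle m h *+ 2).
Proof. by rewrite cos_mulr2n /tri_eigen; ring. Qed.

Lemma tri_angle_bound m h : (h < m)%N -> 0 < tri_angle m h *+ 2 < pi.
Proof.
move=> hm; have d0 : (0 : R) < (2 * m + 1)%N%:R by rewrite ltr0n addn1.
rewrite -mulr_natr /tri_angle mulrAC; apply/andP; split.
  by rewrite divr_gt0 // !mulr_gt0 // ?pi_gt0 // ltr0n.
rewrite ltr_pdivrMr // mulrAC mulrC ltr_pM2l ?pi_gt0 // -natrM ltr_nat; lia.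
Qed.

Lemma tri_eigen_inj m : injective (fun h : 'I_m => tri_eigen m h).
Proof.
move=> h h' /=; rewrite !tri_eigenE => /addrI/(mulfI _) e.
have itv (j : 'I_m) : tri_angle m j *+ 2 \in `[0, pi].
  by have /andP[a b] := tri_angle_bound (ltn_ord j); rewrite in_itv /= !ltW.
have := cos_inj (itv _) (itv _) (e _); rewrite pnatr_eq0 => /(_ isT)/eqP.
rewrite eqrMn2r /= => /eqP/(congr1 (fun x => x * (2 * m + 1)%N%:R)); rewrite !divfK; try by rewrite pnatr_eq0 addn1.
by move/(mulIf (lt0r_neq0 (pi_gt0 R)))/eqP; rewrite eqr_nat => /eqP[/ord_inj].
Qed.

Lemma eigenvalue_tri m h : (h < m)%N -> eigenvalue (tri_mx R m) (tri_eigen m h).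
Proof.
move=> hm; pose t := tri_angle m h; pose F k : R := sin (k.+1%:R * (t *+ 2)).
apply/eigenvalueP; exists (\row_i F i); last first.
  have m0 : (0 < m)%N by apply: leq_ltn_trans hm.
  apply/eqP => /rowP/(_ (Ordinal m0)); rewrite !mxE /F mul1r /=.
  by apply/eqP/lt0r_neq0/sin_gt0_pi/tri_angle_bound.
apply/rowP => j; rewrite !mxE; under eq_bigr => i _ do rewrite !mxE.
have -> : \sum_(i < m) F i * (if i == j then if i.+1 == m then 3%:R else 4%:R else (path_adj i j)%:R) =
    (if j.+1 == m then 3%:R else 4%:R) * F j +
    ((0 < j)%N%:R * F j.-1 + (j.+1 < m)%N%:R * F j.+1).
  rewrite -(sum_path_adj F (ltn_ord j)) (bigD1 j) //= [in RHS](bigD1 j) //= eqxx.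
  have -> : path_adj j j = false by rewrite /path_adj; lia.
  rewrite mul0r add0r mulrC; congr (_ + _); apply: eq_bigr => k nk.
  by rewrite (negbTE nk) mulrC /path_adj orbC.
have Fm : (0 < j)%N%:R * F j.-1 = sin (j.+1%:R * (t *+ 2) - t *+ 2).
  have -> : j.+1%:R * (t *+ 2) - t *+ 2 = j%:R * (t *+ 2) by rewrite -natr1; ring.
  case: (nat_of_ord j) => [|k] /=; first by rewrite !mul0r sin0.
  by rewrite mul1r.
have Fp : F j.+1 = sin (j.+1%:R * (t *+ 2) + t *+ 2).
  by rewrite /F -[j.+2%:R]natr1; congr sin; ring.
(* The corner entry 3 amounts to the boundary condition F m = - F (m - 1). It holds because the two
   arguments lie symmetrically about (2m + 1) t, a multiple of pi. *)
have last : j.+1 = m -> F j.+1 = - F j.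
  move=> jm; have d0 : (2 * m + 1)%N%:R != 0 :> R by rewrite pnatr_eq0 addn1.
  have tE : (2 * m + 1)%N%:R * t = h.+1%:R * pi by rewrite /t /tri_angle mulrC divfK.
  apply/eqP; rewrite -addr_eq0; apply/eqP; rewrite /F jm.
  have -> : m.+1%:R * (t *+ 2) = (2 * m + 1)%N%:R * t + t.
    by rewrite -[m.+1%:R]natr1 natrD natrM; ring.
  have -> : m%:R * (t *+ 2) = (2 * m + 1)%N%:R * t - t.
    by rewrite natrD natrM; ring.
  by rewrite tE sinD sinB sin_natpi !mul0r add0r sub0r subrr.
rewrite tri_eigenE -/t.
have key : sin (j.+1%:R * (t *+ 2) - t *+ 2) + F j.+1 = 2%:R * cos (t *+ 2) * F j.
  rewrite Fp /F; move: (j.+1%:R * (t *+ 2)) (t *+ 2) => a b.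
  by rewrite !sinD sinN cosN; ring.
have jm := ltn_ord j; rewrite Fm; case: eqP => e.
  have -> : (j.+1 < m)%N = false by lia.
  by rewrite mul0r addr0; move: key; rewrite (last e) => key; rewrite [RHS]mulrDl -key; ring.
have -> : (j.+1 < m)%N by lia.
by rewrite mul1r key; ring.
Qed.

Lemma det_cheb_tri m n : (0 < m)%N -> (0 < n)%N ->
  \det (cheb (tri_mx R m) n) = \prod_(h < m) \prod_(k < n) (tri_eigen m h - cheb_root R n k).
Proof.
case: m => // m _ n0; set A := tri_mx R m.+1.
have -> : cheb A n = \prod_(k < n) (A - (cheb_root R n k)%:M).
  have := congr1 (horner_mx A) (cheb_factor R n0); rewrite rmorph_cheb /= horner_mx_X => ->.
  rewrite rmorph_prod; apply: eq_bigr => k _.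
  by rewrite rmorphB /= horner_mx_X horner_mx_C.
rewrite (big_morph (fun B : 'M[R]_m.+1 => \det B) (fun B C => det_mulmx B C) (det1 _ _)).
rewrite exchange_big; apply: eq_bigr => k _; apply: det_sub_eigen; first exact: tri_eigen_inj.
by move=> h; apply: eigenvalue_tri.
Qed.

Lemma cheb_tri_eigen m n h : (0 < n)%N ->
  cheb (tri_eigen m h) n = \prod_(k < n) (tri_eigen m h - cheb_root R n k).
Proof.
move=> n0; have := congr1 (fun p : {poly R} => p.[tri_eigen m h]) (cheb_factor R n0).
rewrite horner_cheb hornerX horner_prod => ->.
by apply: eq_bigr => k _; rewrite hornerXsubC.
Qed.

End Eigenvalues.

Lemma intr_det_cheb_tri (R : realType) m n : (0 < m)%N -> (0 < n)%N ->
  (\det (cheb (tri_mx int m) n))%:~R = \prod_(h < m) \prod_(k < n) (tri_eigen R m h - cheb_root R n k).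
Proof.
move=> m0 n0; rewrite -det_cheb_tri //; case: m m0 => // m _.
rewrite -(det_map_mx intr) rmorph_cheb; congr (\det (cheb _ n)).
apply/matrixP => i j; rewrite !mxE; case: (i == j); last by rewrite rmorph_nat.
by case: ifP; rewrite rmorph_nat.
Qed.

Lemma xiE (R : realType) (m h : nat) : xi R h.+1 m = cos (tri_angle R m h).
Proof. by rewrite /xi /tri_angle; congr (cos (_ * _ / _)). Qed.

Lemma zetaE (R : realType) (n k : nat) :
  zeta R k.+1 n = cos ((2 * k + 1)%N%:R * pi / (4 * n)%N%:R).
Proof.
rewrite /zeta (_ : 2 * k.+1%:Z - 1 = (2 * k + 1)%N%:Z); last by lia.
by rewrite (_ : 4 * n%:Z = (4 * n)%N%:Z).
Qed.

Lemma tri_eigen_sub_root (R : realType) (m n h k : nat) :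
  tri_eigen R m h - cheb_root R n k =
  4%:R * xi R h.+1 m ^+ 2 + 4%:R * zeta R k.+1 n ^+ 2.
Proof. by rewrite xiE zetaE /tri_eigen /cheb_root; ring. Qed.

Lemma tri_eigen_sub_root_gt0 (R : realType) (m n h k : nat) : (h < m)%N ->
  0 < tri_eigen R m h - cheb_root R n k.
Proof.
move=> hm; rewrite tri_eigen_sub_root.
apply: ltr_pwDl; last by rewrite mulr_ge0 // sqr_ge0.
rewrite xiE mulr_gt0 // exprn_gt0 //; have /andP[] := tri_angle_bound R hm.
move=> a0 api; apply: cos_gt0_pihalf; move: a0 api; rewrite mulr2n; lra.
Qed.

Theorem theorem4p5 (R : realType) (m n : nat) (hm : (1 <= m)%N) (hn : (1 <= n)%N) :
  let n1 : nat := num_symmetric_recurrents (2 * m) (2 * n - 1) in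
  let n2 : nat := if (1 < n)%N then mobius_weighted_tilings (2 * m) (2 * n)
                  else mobius_weighted_tilings (2 * m - 1) 2 in
  let z3 : R[i] := (-1) ^+ (m * n) * 2%:R ^+ m *
    \prod_(1 <= h < m.+1) (chebyshevT R[i] (2 * n)).['i%C * (xi R h m)%:C] in
  let x4 : R := \prod_(1 <= h < m.+1) \prod_(1 <= k < n.+1)
    (4%:R * xi R h m ^+ 2 + 4%:R * zeta R k n ^+ 2) in
  let n5 : nat := mobius_tilings (2 * m) (2 * n) in
  [/\ n1 = n2, n2%:R = z3, z3 = x4%:C & x4 = n5%:R].
Proof.
move=> n1 n2 z3 x4 n5; set d := \det (cheb (tri_mx int m) n).
have x4E : x4 = \prod_(h < m) \prod_(k < n) (tri_eigen R m h - cheb_root R n k).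
  rewrite /x4 big_add1 /= big_mkord; apply: eq_bigr => h _.
  rewrite big_add1 /= big_mkord; apply: eq_bigr => k _.
  by rewrite tri_eigen_sub_root.
have dE : d%:~R = x4 by rewrite x4E intr_det_cheb_tri.
have d_gt0 : 0 < d.
  rewrite -(ltr0z R) dE x4E; apply: prodr_gt0 => h _; apply: prodr_gt0 => k _.
  exact: tri_eigen_sub_root_gt0.
have n1E : n1%:Z = d.
  by rewrite /n1 card_symmetric_recurrents ?gt_eqF // gez0_abs // ltW.
have n2E : n2%:Z = d.
  rewrite /n2 /d; case: (n) hn => [//|[|k]] _.
    by rewrite /= -planar_tilings_odd // natz.
  by rewrite (_ : (1 < k.+2)%N = true) // [(2 * k.+2)%N]mul2n -planar_tilings_even natz.
have n5E : n5%:Z = d.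
  rewrite /n5; move: d_gt0; rewrite /d; case: (n) hn => [//|k] _ d_gt0.
  rewrite [(2 * k.+1)%N]mul2n.
  (* A number of tilings is not negative while [d] is positive, so the sign is +1. *)
  have [[|]] := mobius_det m k; rewrite ?expr1 ?expr0 ?mulN1r ?mul1r natz // => e.
  by move: d_gt0; set D := \det _; lia.
have z3E : z3 = x4%:C.
  (* Each of the m factors receives (-1)^n 2. Then 2 T_(2n)(i xi) = t_(2n)(2 i xi) = t_n(-(2 + 4
     xi^2)), and the parity of t_n cancels (-1)^n. *)
  rewrite /z3 mulnC exprM -exprMn big_add1 /= big_mkord.
  have -> : ((-1) ^+ n * 2%:R) ^+ m = \prod_(h < m) ((-1) ^+ n * 2%:R) :> R[i].
    by rewrite prodr_const card_ord.
  rewrite -big_split x4E rmorph_prod; apply: eq_bigr => h _ /=.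
  rewrite -cheb_tri_eigen // -mulrA cheb_chebyshevT mul2n cheb_double.
  have -> : (2%:R * ('i%C * (xi R h.+1 m)%:C)) ^+ 2 - 2%:R = - (tri_eigen R m h)%:C.
    rewrite xiE /tri_eigen rmorphD rmorphM rmorphXn !rmorph_nat.
    rewrite !exprMn sqr_i; ring.
  by rewrite chebN mulrA -exprMn mulrNN mulr1 expr1n mul1r -rmorph_cheb.
split=> //.
- by apply/eqP; rewrite -eqz_nat n1E n2E.
- by rewrite z3E -dE -n2E -[n2%:~R]/(n2%:R) rmorph_nat.
by rewrite -dE -n5E.
Qed.
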